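(* Let $X\in\mathcal{H}^*$ have expected record sequence $\{\rho_n\}_{n\ge1}$, set $w_n:=\mathbb{E}|R_n|$ and $T=\varphi(X)$, and define $$G_\rho(t):=\sum_{n\ge1}\rho_nt^{n-1},\qquad G_w(t):=\sum_{n\ge1}w_nt^{n-1},\qquad M_T(a):=\mathbb{E}e^{aT}.$$ Then the following statements are equivalent: (i) $\mathbb{E}(X^+)^p<\infty$ for some $p>1$. (ii) $G_\rho(t)$ is finite for $t$ in a neighborhood of zero. (iii) $G_w(t)<\infty$ for some $t>0$. (iv) $M_T(a)<\infty$ for some $a>0$. If (i)--(iv) hold, then there exists $\epsilon_0\in(0,1)$ such that $$G_\rho(t)=\frac{1}{1-t}\left\{\rho_1+(\rho_2-\rho_1)\int_0^tM_T(s)\,ds\right\},\qquad |t|<\epsilon_0,$$ and consequently $$M_T(t)=\frac{1}{\rho_2-\rho_1}\,\frac{d}{dt}\Big((1-t)G_\rho(t)\Big),\qquad |t|<\epsilon_0.$$ Therefore, under assumption (i), $X$ is characterized from the generating function $G_\rho$ of its expected record sequence through $X=\rho_1+(\rho_2-\rho_1)\varphi^{-1}(T)$ (equality in distribution), where $T$ has moment generating function $M_T$ given (for $|t|<\epsilon_0$) by the last displayed formula, and $\varphi^{-1}=\varphi'$.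
   Context: Identically distributed random variables are regarded as equal. Inverse distribution functions are left-continuous: $F^{-1}(u)=\inf\{x:F(x)\ge u\}$, $0<u<1$. Put $L(u)=-\log(1-u)$, $0<u<1$, and $X^+=\max(X,0)$. Records: let $U_1<U_2<\cdots$ be the sequence of (upper) record values of an i.i.d. sequence $V_1,V_2,\ldots$ from the uniform distribution on $(0,1)$: $\tau_1=1$, $U_1=V_1$, $\tau_{n+1}=\inf\{m>\tau_n:V_m>U_n\}$, $U_{n+1}=V_{\tau_{n+1}}$ (so $U_n$ has density $L(u)^{n-1}/(n-1)!$ on $(0,1)$). For $X$ with distribution function $F$, put $R_n=F^{-1}(U_n)$; the expected record sequence of $X$ is $\rho_n=\mathbb{E}R_n$, $n\ge1$. A function $H:(0,\infty)\to\mathbb{R}$ belongs to $\mathcal{H}^*$ if it is non-constant, non-decreasing, left-continuous and $\int_0^\infty y^m e^{-y}|H(y)|\,dy<\infty$ for $m=0,1,2,\ldots$. $\mathcal{H}_0$ is the set of $H\in\mathcal{H}^*$ with $\int_0^\infty e^{-y}H(y)\,dy=0$ and $\int_0^\infty y e^{-y}H(y)\,dy=1$. A random variable $X$ is said to belong to $\mathcal{H}^*$ (resp. $\mathcal{H}_0$) if its inverse distribution function $G$ can be written as $G(u)=H(-\log(1-u))$, $0<u<1$, with $H\in\mathcal{H}^*$ (resp. $H\in\mathcal{H}_0$). $\mathcal{T}$ is the set of all random variables $T$ with $\Pr(T>0)=1$ and finite moments of every order. Map $\varphi:\mathcal{H}^*\to\mathcal{T}$: for $X\in\mathcal{H}^*$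 with distribution function $F$, $\varphi(X):=L(F(V))$, where $V$ is a random variable with Lebesgue density $f_V(x)=(1-F(x))L(F(x))\big/\int_{\mathbb{R}}(1-F(y))L(F(y))\,dy$, $x\in\mathbb{R}$, with the convention $(1-F(x))L(F(x))=0$ if $F(x)\in\{0,1\}$. Map $\varphi':\mathcal{T}\to\mathcal{H}_0$ (the inverse of $\varphi$ restricted to $\mathcal{H}_0$): for $T\in\mathcal{T}$ with distribution function $F_T$, $\varphi'(T)$ is the random variable whose inverse distribution function $G_0$ is given by $G_0(1-e^{-y})=H_0(y)$, $y>0$, where $$H_0(y)=\frac{e^y}{y}F_T(y-)-\int_1^y\frac{x-1}{x^2}e^xF_T(x)\,dx-c_T,\qquad y>0,$$ $F_T(y-)=\Pr(T<y)$, $\int_1^y=-\int_y^1$ if $0<y<1$, and $c_T$ is the unique constant (depending only on $T$) for which $\int_0^\infty e^{-y}H_0(y)\,dy=0$. *)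

(* Defs.v *)
From HB Require Import structures.
From mathcomp Require Import all_boot all_order all_algebra.
From mathcomp Require Import all_classical all_reals all_analysis.
Set Implicit Arguments.
Unset Strict Implicit.
Unset Printing Implicit Defensive.
Import Order.TTheory GRing.Theory Num.Theory.
Import numFieldNormedType.Exports.
Local Open Scope classical_set_scope.
Local Open Scope ring_scope.

Definition same_law (R : realType)
    (d1 : measure_display) (Om1 : measurableType d1) (P1 : probability Om1 R)
    (d2 : measure_display) (Om2 : measurableType d2) (P2 : probability Om2 R)
    (X1 : Om1 -> R) (X2 : Om2 -> R) : Prop :=
  forall A : set R, measurable A -> P1 (X1 @^-1` A) = P2 (X2 @^-1` A).

(* The oriented integral: \int_a^b = - \int_b^a when b < a. *)
Definition oint (R : realType) (a b : R) (f : R -> R) : R :=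
  if a <= b then \int[lebesgue_measure]_(x in `[a, b]) f x
  else - \int[lebesgue_measure]_(x in `[b, a]) f x.

(* Only used for u < 1, or at u = 1 inside an event of probability 0 or
   multiplied by 0; as ln 0 = 0, one has L 1 = 0. *)
Definition L (R : realType) (u : R) : R := - ln (1 - u).

Section random_variable_defs.
Context (R : realType) (d : measure_display) (Om : measurableType d)
  (P : probability Om R).

Definition cdfR (X : {RV P >-> R}) (x : R) : R := fine (cdf X x).

Definition quantile (X : {RV P >-> R}) (u : R) : R :=
  inf [set x | u <= cdfR X x].

(* Product rule for every finite subfamily (s lists distinct indices). *)
Definition mutually_independent (V : nat -> {RV P >-> R}) : Prop :=
  forall s : seq nat, uniq s ->
  forall B : nat -> set R, (forall i, measurable (B i)) ->
    P (\bigcap_(i in [set` s]) (V i @^-1` B i)) =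
    (\prod_(i <- s) P (V i @^-1` B i))%E.

Definition iid_uniform (V : nat -> {RV P >-> R}) : Prop :=
  mutually_independent V /\
  forall i (A : set R), measurable A ->
    distribution P (V i) A = uniform_prob (@ltr01 R) A.

Definition in_T (T : {RV P >-> R}) : Prop :=
  P [set w | 0 < T w] = 1%E /\
  forall k : nat, ('E_P[fun x => (`|T x| ^+ k)%R] < +oo)%E.

End random_variable_defs.

(* Sequences are indexed from 0: v 0, record_time v 0, record_value v 0 stand
   for V_1, tau_1, U_1, and below recR X V n, rho X V n, rho_abs X V n stand for
   R_{n+1}, rho_{n+1}, w_{n+1} = E|R_{n+1}|. If there is no later record (an event of
   probability 0 for i.i.d. uniform variables), record_time takes the arbitrary
   value 0. *)
Fixpoint record_time (R : realType) (v : nat -> R) (n : nat) : nat :=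
  if n is n'.+1 then
    let tau := record_time v n' in
    if pselect (exists m, (tau < m)%N && (v tau < v m)) is left ex
    then ex_minn ex else 0%N
  else 0%N.

Definition record_value (R : realType) (v : nat -> R) (n : nat) : R :=
  v (record_time v n).

Section records.
Context (R : realType)
  (d : measure_display) (Om : measurableType d) (P : probability Om R)
  (d' : measure_display) (Om' : measurableType d') (Q : probability Om' R).
Implicit Types (X : {RV P >-> R}) (V : nat -> {RV Q >-> R}).

Definition recR X V (n : nat) (x : Om') : R :=
  quantile X (record_value (fun i => V i x) n).

Definition rho X V (n : nat) : R := fine ('E_Q[recR X V n])%E.

Definition rho_abs X V (n : nat) : \bar R := ('E_Q[fun x => `|recR X V n x|%R])%E.

Definition G_rho X V (t : R) : R := limn (pseries (rho X V) t).

Definition G_w X V (t : R) : \bar R :=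
  (\sum_(0 <= n <oo) rho_abs X V n * (t ^+ n)%:E)%E.

End records.

(* Membership in H^* and H_0 only constrains H on `]0, +oo[. *)
Definition Hstar (R : realType) (H : R -> R) : Prop :=
  [/\ exists x y, [/\ 0 < x, 0 < y & H x != H y],
      forall x y, 0 < x -> x <= y -> H x <= H y,
      forall y, 0 < y -> H x @[x --> y^'-] --> H y &
      forall m : nat,
        (\int[lebesgue_measure]_(y in `]0%R, +oo[)
           (y ^+ m * expR (- y) * `|H y|)%:E < +oo)%E].

Definition H0 (R : realType) (H : R -> R) : Prop :=
  [/\ Hstar H,
      \int[lebesgue_measure]_(y in `]0, +oo[) (expR (- y) * H y) = 0 &
      \int[lebesgue_measure]_(y in `]0, +oo[) (y * expR (- y) * H y) = 1].

Section classes.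
Context (R : realType) (d : measure_display) (Om : measurableType d)
  (P : probability Om R).
Implicit Types X T : {RV P >-> R}.

Definition in_Hstar X : Prop :=
  exists2 H : R -> R, Hstar H &
    forall u, 0 < u < 1 -> quantile X u = H (L u).

Definition in_H0 X : Prop :=
  exists2 H : R -> R, H0 H &
    forall u, 0 < u < 1 -> quantile X u = H (L u).

Definition phi_weight X (x : R) : R := (1 - cdfR X x) * L (cdfR X x).

Definition phi_density X (x : R) : R :=
  phi_weight X x / \int[lebesgue_measure]_(y in [set: R]) phi_weight X y.

(* H_0 of the definition of phi', with an arbitrary constant c for c_T. *)
Definition phi'_H0 T (c y : R) : R :=
  expR y / y * fine (P [set w | T w < y])
  - oint 1 y (fun x => (x - 1) / x ^+ 2 * expR x * cdfR T x) - c.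

End classes.

Section maps.
Context (R : realType)
  (d : measure_display) (Om : measurableType d) (P : probability Om R)
  (d' : measure_display) (Om' : measurableType d') (P' : probability Om' R).

(* T = phi(X), as laws. *)
Definition is_phi (X : {RV P >-> R}) (T : {RV P' >-> R}) : Prop :=
  exists (dV : measure_display) (OmV : measurableType dV)
         (PV : probability OmV R) (V : {RV PV >-> R}),
    (forall A : set R, measurable A ->
       distribution PV V A =
       (\int[lebesgue_measure]_(x in A) (phi_density X x)%:E)%E) /\
    same_law P' PV T (fun v => L (cdfR X (V v))).

(* Y = phi'(T), as laws; the first two conditions single out c = c_T. *)
Definition is_phi' (T : {RV P >-> R}) (Y : {RV P' >-> R}) : Prop :=
  exists c : R,
    [/\ lebesgue_measure.-integrable `]0%R, +oo[
          (fun y => (expR (- y) * phi'_H0 T c y)%:E),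
        \int[lebesgue_measure]_(y in `]0, +oo[)
          (expR (- y) * phi'_H0 T c y) = 0 &
        forall u, 0 < u < 1 -> quantile Y u = phi'_H0 T c (L u)].

End maps.

(* Main.v *)
Require Import Defs.
From HB Require Import structures.
From mathcomp Require Import all_boot all_order all_algebra.
From mathcomp Require Import all_classical all_reals all_analysis.
From mathcomp Require Import measurable_realfun.
From mathcomp Require Import ring lra zify.
Set Implicit Arguments.
Unset Strict Implicit.
Unset Printing Implicit Defensive.
Import Order.TTheory GRing.Theory Num.Theory.
Import numFieldNormedType.Exports.
Local Open Scope classical_set_scope.
Local Open Scope ring_scope.

(** Write F for the distribution function of X, H for its quantile function on
    the exponential scale, so that H y is the quantile of order 1 - e^-y, and
    lvl x = -log (1 - F x). The n-th uniform record (counting from 0) is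
    1 - e^-y with y of density y^n/n! e^-y; hence the expectation of k (R_n)
    is the integral of k (H y) y^n/n! e^-y (integral_record, integral_recR).
    Galois inversion turns R_n > x into y > lvl x, so P (R_n > x) is the tail
    of a gamma law at lvl x. Consecutive tails differ by
    rincr n x = lvl(x)^(n+1)/(n+1)! e^(-lvl x), and integrating over x gives the
    key identity (rho_diff): rho_(n+1) - rho_n is the integral of rincr n.

    For n = 0 the integrand is (1 - F) L(F), the unnormalised density in the
    definition of phi, and lvl^n rincr 0 = (n+1)! rincr n. With
    D = rho_1 - rho_0 this reads E T^n = (n+1)! (rho_(n+1) - rho_n) / D
    (moment_phi). So D M_T is the derivative of the power series whose
    coefficients are rho_0 and the increments of rho, that is, of
    (1 - t) G_rho(t). This single fact yields (ii) => (iv), the formulas for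
    G_rho and M_T, and, since all increments of rho are nonnegative and
    E|R_n| exceeds E|R_0| by at most rho_n - rho_0, also (iv) => (iii).
    The moment condition (i) is compared with (iii) through
    G_w(t) = int |H y| e^(-(1-t)y) dy (G_wE, power_moment_G_w,
    G_w_power_moment).

    For the inversion, both directions are measured by the slices
    E [e^T/T; a <= T < b] with 0 < a < b. Integration by parts shows that the
    slice is the increment over [a, b] of the function in the definition of phi'
    (phi'_H0_slice). On the other hand H a <= z < H b exactly when
    a <= lvl z < b, so integrating e^lvl/lvl times rincr 0 over that set gives
    its length, and H b - H a is D times the slice of phi(X)
    (is_phi_slices). Hence phi'(T) and X have the same increments up to the
    factor D, and the remaining constant is fixed by the mean. Conversely the
    slices determine a law on the positive half-line (eq_measure_slices), so a
    Y with the increments prescribed by T satisfies phi(Y) = T.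

    Finally a positive variable with exponential moments is determined by its
    moment generating function near 0 (same_law_of_mgf): power series give all
    moments; expanding about 0, then about -h, -2h and so on gives all
    E p(e^(-hT)) with p a polynomial; and the polynomials
    (1 - x^N)^[e^(Nhc)] converge at x = e^(-hT) to the indicator of T > c. *)

(** * Measures on the line *)

(** Open half-lines are stable under intersection and generate the Borel sets, so two finite
    measures agreeing on them coincide. *)
Lemma eq_measure_tails (R : realType)
    (m1 m2 : {measure set R -> \bar R}) :
    (m1 setT < +oo)%E ->
    (forall x : R, m1 `]x, +oo[%classic = m2 `]x, +oo[%classic) ->
  forall A : set R, measurable A -> m1 A = m2 A.
Proof.
move=> foo m12 A mA.
apply: (@measure_unique _ R R (@RGenOInfty.G R)
  (fun n => `]- n%:R, +oo[%classic) _ _ _ _ m1 m2) => //.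
- exact: RGenOInfty.measurableE.
- move=> _ _ [x ->] [y ->]; exists (Num.max x y).
  by apply/seteqP; split => z /=; rewrite !in_itv/= !andbT gt_max => /andP.
- by move=> i; exists (- i%:R).
- rewrite -subTset => x _; exists (Num.truncn `|x|).+1 => //=.
  rewrite in_itv/= andbT ltrNl (le_lt_trans (ler_norm _))// normrN.
  exact: truncnS_gt.
- by move=> _ [x ->]; exact: m12.
- move=> k; apply: le_lt_trans foo; apply: le_measure; rewrite ?inE//.
Qed.

Section density.
Local Open Scope ereal_scope.
Context d (T : measurableType d) (R : realType)
  (mu : {measure set T -> \bar R}) (f : T -> R).
Hypotheses (mf : measurable_fun [set: T] f) (f0 : forall x, (0 <= f x)%R).

(** The proofs are arguments so that the measure structure can be inferred from the term. *)
Definition mdens (_ : measurable_fun [set: T] f) (_ : forall x, (0 <= f x)%R)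
  (A : set T) : \bar R := \int[mu]_(x in A) (f x)%:E.

Let nu := mdens mf f0.

Let nu0 : nu set0 = 0. Proof. exact: integral_set0. Qed.
Let nu_ge0 A : 0 <= nu A.
Proof. by apply: integral_ge0 => x _; rewrite lee_fin. Qed.
Let nu_sigma : semi_sigma_additive nu.
Proof.
apply: semi_sigma_additive_nng_induced; first exact/measurable_EFinP.
by move=> x; rewrite lee_fin.
Qed.

HB.instance Definition _ := isMeasure.Build _ _ _ (mdens mf f0)
  nu0 nu_ge0 nu_sigma.

Import HBNNSimple.

Lemma ge0_integral_mdens (g : T -> \bar R) :
  measurable_fun setT g -> (forall x, 0 <= g x) ->
  \int[mdens mf f0]_x g x = \int[mu]_x (g x * (f x)%:E).
Proof.
move=> mg g0.
have ind (h : {nnsfun T >-> R}) :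
    \int[nu]_x (h x)%:E = \int[mu]_x ((h x)%:E * (f x)%:E).
  have hE x : (h x)%:E = \sum_(r \in range h) (r * \1_(h @^-1` [set r]) x)%:E.
    by rewrite fsumEFin//; congr EFin; exact: fimfunE.
  under [LHS]eq_integral do rewrite hE.
  rewrite ge0_integral_fsum//; last 2 first.
  - by move=> r; apply/measurable_EFinP; exact: measurable_funM.
  - by move=> r x _; exact: nnfun_muleindic_ge0.
  transitivity (\int[mu]_x
      (\sum_(r \in range h) (r * \1_(h @^-1` [set r]) x)%:E * (f x)%:E)); last first.
    apply: eq_integral => x _; rewrite hE -ge0_mule_fsuml// => r.
    exact: nnfun_muleindic_ge0.
  rewrite ge0_integral_fsum//; last 2 first.
  - move=> r; apply: emeasurable_funM; last exact/measurable_EFinP.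
    by apply/measurable_EFinP; exact: measurable_funM.
  - move=> r x _; apply: mule_ge0; last by rewrite lee_fin.
    by rewrite EFinM nnfun_muleindic_ge0.
  apply: eq_fsbigr => r; rewrite inE => -[t _ <-{r}].
  under [LHS]eq_integral do rewrite EFinM.
  under [RHS]eq_integral do rewrite EFinM -muleA.
  rewrite !ge0_integralZl ?lee_fin//; last 3 first.
  - by apply: emeasurable_funM => //; apply/measurable_EFinP.
  - by move=> x _; rewrite mule_ge0// lee_fin.
  - by apply/measurable_EFinP.
  congr (_ * _); rewrite integral_indic// setIT.
  rewrite [LHS](_ : _ = \int[mu]_(x in h @^-1` [set h t]) (f x)%:E)//.
  rewrite [LHS]integral_mkcond.
  by apply: eq_integral => x _; rewrite epatch_indic muleC.
have gE x : g x = limn (fun n => (nnsfun_approx measurableT mg n x)%:E).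
  by apply/esym/cvg_lim => //; exact: cvg_nnsfun_approx.
have nd x : nondecreasing_seq (fun n => (nnsfun_approx measurableT mg n x)%:E).
  by move=> m n mn; rewrite lee_fin; exact/lefP/nd_nnsfun_approx.
under [LHS]eq_integral do rewrite gE.
rewrite monotone_convergence//; last 2 first.
- by move=> n; apply/measurable_EFinP.
- by move=> n x _; rewrite lee_fin.
transitivity (\int[mu]_x
    limn (fun n => (nnsfun_approx measurableT mg n x)%:E * (f x)%:E)); last first.
  apply: eq_integral => x _.
  by apply/cvg_lim => //; apply: cvgeZr => //; exact: cvg_nnsfun_approx.
rewrite monotone_convergence//.
- by apply: congr_lim; apply/funext => n; exact: ind.
- move=> n; apply: emeasurable_funM; last exact/measurable_EFinP.
  exact/measurable_EFinP.
- by move=> n x _; rewrite mule_ge0 ?lee_fin.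
- by move=> x _ m n mn; rewrite lee_wpmul2r ?lee_fin//; exact: nd.
Qed.

End density.

Lemma ge0_integral_mrestr d (T : measurableType d) (R : realType)
    (mu : {measure set T -> \bar R}) (D : set T) (mD : measurable D)
    (f : T -> \bar R) :
  measurable_fun setT f -> (forall x, 0 <= f x)%E ->
  (\int[mrestr mu mD]_x f x = \int[mu]_(x in D) f x)%E.
Proof.
move=> mf f0.
have mI : measurable_fun setT (\1_D : T -> R) by exact: measurable_indic.
have I0 x : 0 <= (\1_D x : R) by [].
rewrite [LHS](eq_measure_integral (mdens mu mI I0)); last first.
  by move=> A mA _; rewrite /= /mrestr /mdens integral_indic// setIC.
rewrite ge0_integral_mdens// [RHS]integral_mkcond.
by apply: eq_integral => x _; rewrite epatch_indic.
Qed.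

(** * Antiderivatives and gamma densities *)

Section antiderivatives.
Context (R : realType) (G g : R -> R) (a : R).
Implicit Types b : R.

Let cG (s : R) : is_derive s 1 G (g s) -> {for s, continuous G}.
Proof.
by move=> [dG _]; apply: differentiable_continuous; exact/derivable1_diffP.
Qed.

(** The degenerate interval is included; differentiability at the end points spares one-sided limits. *)
Lemma integral_deriv b : a <= b ->
  (forall s : R, a <= s <= b -> is_derive s 1 G (g s)) ->
  (forall s : R, a <= s <= b -> {for s, continuous g}) ->
  (\int[lebesgue_measure]_(s in `[a, b]) (g s)%:E = (G b - G a)%:E)%E.
Proof.
rewrite le_eqVlt => /orP[/eqP ->|ab] dG cg.
  by rewrite set_itv1 integral_set1 subrr.
rewrite (@continuous_FTC2 _ _ G)//.
- by apply: continuous_in_subspaceT => s; rewrite inE/= in_itv/=; exact: cg.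
- split.
  + move=> s; rewrite in_itv/= => /andP[/ltW as_ /ltW sb].
    by have [] := dG s; rewrite ?as_.
  + by apply/cvg_at_right_filter/cG/dG; rewrite lexx ltW.
  + by apply/cvg_at_left_filter/cG/dG; rewrite lexx ltW.
- move=> s; rewrite in_itv/= => /andP[/ltW as_ /ltW sb].
  by rewrite derive1E; have := dG s; rewrite as_ => /(_ sb)/@derive_val.
Qed.

Lemma integral_derivy l : (forall s : R, is_derive s 1 G (g s)) ->
  (forall s : R, {for s, continuous g}) -> (forall s, a <= s -> 0 <= g s) ->
  G s @[s --> +oo] --> l ->
  (\int[lebesgue_measure]_(s in `]a, +oo[) (g s)%:E = (l - G a)%:E)%E.
Proof.
move=> dG cg g0 Gl; rewrite integral_itv_obnd_cbnd; last first.
  by apply/measurable_EFinP/measurable_funTS; exact: continuous_measurable_fun.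
rewrite (@ge0_continuous_FTC2y _ _ G _ l) ?EFinB//.
- exact: continuous_subspaceT.
- by apply: cvg_at_right_filter; apply: cG; exact: dG.
- by move=> s _; rewrite derive1E; have := dG s => /@derive_val.
Qed.

End antiderivatives.

Section gamma.
Context (R : realType).
Implicit Types (n : nat) (y : R).

Definition gam n y : R :=
  if 0 < y then y ^+ n / n`!%:R * expR (- y) else 0.

(** Tail of the gamma law of density [gam n]; equivalently, the probability that a Poisson
    variable of mean y is at most n. *)
Definition gtail n y : R := expR (- y) * \sum_(k < n.+1) y ^+ k / k`!%:R.

Lemma gam_ge0 n y : 0 <= gam n y.
Proof.
rewrite /gam; case: ifPn => // y0.
by rewrite mulr_ge0 ?expR_ge0// divr_ge0// exprn_ge0// ltW.
Qed.

Lemma gtailn0 n : gtail n 0 = 1.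
Proof.
rewrite /gtail oppr0 expR0 mul1r big_ord_recl/= expr0 fact0 divr1 big1 ?addr0//.
by move=> i _; rewrite /bump/= expr0n/= mul0r.
Qed.

Lemma gtailS n y :
  gtail n.+1 y = gtail n y + y ^+ n.+1 / n.+1`!%:R * expR (- y).
Proof. by rewrite /gtail big_ord_recr/= mulrDr; congr +%R; rewrite mulrC. Qed.

Lemma is_derive_exprn n y :
  is_derive y 1 (fun x : R => x ^+ n.+1) (n.+1%:R * y ^+ n).
Proof.
apply: DeriveDef; first exact: exprn_derivable.
by rewrite exp_derive /GRing.scale/= mulr1.
Qed.

(** The sum telescopes under differentiation: only the last term survives. *)
Lemma is_derive_gtail n y :
  is_derive y 1 (gtail n) (- (y ^+ n / n`!%:R * expR (- y))).
Proof.
elim: n => [|n IH].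
  rewrite (_ : gtail 0 = fun y => expR (- y)); last first.
    by apply/funext => x; rewrite /gtail big_ord1 expr0 fact0 divr1 mulr1.
  apply: is_derive_eq; rewrite expr0 fact0 divr1 mul1r.
  by rewrite mulrN1.
rewrite (_ : gtail n.+1 = gtail n \+
    (fun y => y ^+ n.+1 / n.+1`!%:R * expR (- y))); last first.
  by apply/funext => x; rewrite gtailS.
have dX := is_derive_exprn n y.
have dE : is_derive y 1 (fun x : R => expR (- x)) (- expR (- y)).
  by apply: is_derive_eq; rewrite mulrN1.
apply: (@is_derive_eq _ _ _ _ _ _ _ _ (is_deriveD IH (is_deriveM (is_deriveM dX (is_derive_cst _ _ _)) dE))).
rewrite [LHS](_ : _ = - (y ^+ n / n`!%:R * expR (- y)) +
  (y ^+ n.+1 / n.+1`!%:R * - expR (- y) + expR (- y) *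
   (y ^+ n.+1 * 0 + n.+1`!%:R^-1 * (n.+1%:R * y ^+ n))))//.
rewrite factS natrM invfM exprS.
have -> : n.+1%:R^-1 / n`!%:R * (n.+1%:R * y ^+ n) = y ^+ n / n`!%:R :> R.
  by rewrite mulrACA mulVf ?pnatr_eq0// mul1r mulrC.
by ring.
Qed.

Lemma measurable_gam n : measurable_fun setT (gam n).
Proof.
apply: measurable_fun_if => //.
- exact: measurable_fun_ltr.
- apply: measurable_funTS; apply: measurable_funM.
    by apply: measurable_funM => //; exact: exprn_measurable.
  by apply: measurableT_comp => //; exact: oppr_measurable.
Qed.

Lemma cvg_pow_expRN n : (y ^+ n / n`!%:R * expR (- y)) @[y --> +oo] --> (0 : R).
Proof.
apply: (@squeeze_cvgr _ _ _ _ (cst 0) (fun y => n.+1%:R * y^-1)).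
- near=> y.
  have y0 : 0 < y by near: y; exact: nbhs_pinfty_gt.
  rewrite /cst mulr_ge0 ?expR_ge0 ?divr_ge0 ?exprn_ge0 ?(ltW y0)//=.
  rewrite expRN ler_pdivrMr ?expR_gt0// mulrAC ler_pdivlMr//.
  rewrite mulrAC -exprSr.
  have := expR_ge1Dxn n (ltW y0).
  rewrite factS natrM invfM mulrCA => /(le_trans _) H.
  rewrite -ler_pdivrMl ?ltr0n//; apply: H.
  by rewrite lerDr.
- exact: cvg_cst.
- rewrite -[X in _ --> X](mulr0 (n.+1%:R : R)); apply: cvgMr.
  apply/gtr0_cvgV0; last exact: cvg_id.
  by near=> x; near: x; exact: nbhs_pinfty_gt.
Unshelve. all: by end_near. Qed.

Lemma cvg_gtail n : gtail n y @[y --> +oo] --> (0 : R).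
Proof.
elim: n => [|n IH].
  rewrite (_ : gtail 0 = fun y => y ^+ 0 / 0`!%:R * expR (- y)); last first.
    by apply/funext => x; rewrite /gtail big_ord1 mulrC.
  exact: cvg_pow_expRN.
rewrite (_ : gtail n.+1 = fun y => gtail n y + y ^+ n.+1 / n.+1`!%:R * expR (- y)); last first.
  by apply/funext => x; rewrite gtailS.
by rewrite -[X in _ --> X](addr0 (0 : R)); apply: cvgD => //; exact: cvg_pow_expRN.
Qed.

Lemma integral_gam_tail n y : 0 <= y ->
  (\int[lebesgue_measure]_(x in `]y, +oo[) (gam n x)%:E = (gtail n y)%:E)%E.
Proof.
move=> y0; pose f (x : R) := x ^+ n / n`!%:R * expR (- x).
transitivity (\int[lebesgue_measure]_(x in `]y, +oo[) (f x)%:E)%E.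
  apply: eq_integral => x; rewrite inE/= in_itv/= andbT => yx.
  by rewrite /gam (le_lt_trans y0 yx).
have df (x : R) : is_derive x 1 (- gtail n) (f x).
  by apply: (is_derive_eq (is_deriveN (is_derive_gtail n x))); rewrite opprK.
have cf (x : R) : {for x, continuous f}.
  apply: cvgM; last by apply: continuous_comp; [exact: opp_continuous|exact: continuous_expR].
  by apply: cvgM; [exact: exprn_continuous|exact: cvg_cst].
have f0 x : y <= x -> 0 <= f x.
  move=> yx; rewrite mulr_ge0 ?expR_ge0// divr_ge0// exprn_ge0//.
  exact: le_trans yx.
have cv : (- gtail n) x @[x --> +oo] --> (0 : R).
  by rewrite -[X in _ --> X]oppr0; apply: cvgN; exact: cvg_gtail.
by rewrite (integral_derivy df cf f0 cv) sub0r opprK.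
Qed.

Lemma integral_gam n : (\int[lebesgue_measure]_x (gam n x)%:E = 1)%E.
Proof.
rewrite -(gtailn0 n) -(integral_gam_tail n (lexx 0)) [RHS]integral_mkcond.
apply: eq_integral => x _; rewrite patchE; case: ifPn => //.
by rewrite notin_setE/= in_itv/= andbT /gam => /negP/negbTE ->.
Qed.

End gamma.

(** * The past of an i.i.d. sequence *)

Section records.
Context (R : realType) d (Om : measurableType d)
  (Q : probability Om R) (V : nat -> {RV Q >-> R}).
Hypothesis hV : iid_uniform V.
Local Notation unif := (uniform_prob (@ltr01 R)).

Lemma measurable_RV_preimage (X : {RV Q >-> R}) (B : set R) :
  measurable B -> measurable (X @^-1` B).
Proof. by move=> mB; rewrite -[X in measurable X]setTI; exact: measurable_funP. Qed.

Definition cylinder m : set (set Om) :=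
  [set A | exists2 B : nat -> set R, (forall i, measurable (B i)) &
    A = \bigcap_(i in [set i | (i < m)%N]) V i @^-1` B i].

(** Events that depend on the first m coordinates only. *)
Definition past m : set (set Om) := <<s cylinder m >>.

Lemma cylinder_setI m : setI_closed (cylinder m).
Proof.
move=> _ _ [B mB ->] [C mC ->]; exists (fun i => B i `&` C i).
  by move=> i; exact: measurableI.
by rewrite -bigcapI; apply: eq_bigcapr => i _; rewrite preimage_setI.
Qed.

Lemma cylinderT m : cylinder m setT.
Proof.
by exists (fun=> setT) => //; apply/seteqP; split.
Qed.

Lemma cylinder_measurable m : cylinder m `<=` measurable.
Proof.
move=> _ [B mB ->]; apply: fin_bigcap_measurable => [|i _].
  exact: finite_II.
exact: measurable_RV_preimage.
Qed.

Lemma past_measurable m : past m `<=` measurable.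
Proof.
by apply: smallest_sub; [exact: sigma_algebra_measurable|exact: cylinder_measurable].
Qed.

Lemma past_mono m n : (m <= n)%N -> past m `<=` past n.
Proof.
move=> mn; apply: smallest_sub; first exact: smallest_sigma_algebra.
move=> _ [B mB ->]; apply: sub_sigma_algebra.
exists (fun i => if (i < m)%N then B i else setT).
  by move=> i; case: ifP.
apply/seteqP; split => w /= wB i /= im.
  by case: ifPn => // im'; exact: (wB i).
by have := wB i (leq_trans im mn); rewrite im.
Qed.

Lemma past_coord m i (B : set R) : (i < m)%N -> measurable B ->
  past m (V i @^-1` B).
Proof.
move=> im mB; apply: sub_sigma_algebra.
exists (fun j => if j == i then B else setT); first by move=> j; case: ifP.
apply/seteqP; split => w /= wB.
  by move=> j _ /=; case: eqP => // ->.
by have := wB i im; rewrite /= eqxx.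
Qed.

Lemma uniform_law i (B : set R) : measurable B -> Q (V i @^-1` B) = unif B.
Proof. by case: hV => _; exact. Qed.

(** Mutual independence is the product rule on cylinders, which are stable under intersection;
    both sides are finite measures in A. *)
Lemma past_indep m A (B : set R) : past m A -> measurable B ->
  Q (A `&` V m @^-1` B) = (Q A * unif B)%E.
Proof.
move=> pA mB.
have mVB := measurable_RV_preimage (V m) mB.
have ufin : unif B \is a fin_num by rewrite -(uniform_law m)// fin_num_measure.
pose c : {nonneg R} := NngNum (fine_ge0 (measure_ge0 unif B)).
rewrite -[LHS]/(mrestr Q mVB A).
have -> : (Q A * unif B)%E = mscale c Q A.
  by rewrite /mscale/= fineK// muleC.
apply: (g_sigma_algebra_measure_unique (cylinder m) _ (fun=> setT)) => //.
- exact: cylinder_measurable.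
- by move=> _; exact: cylinderT.
- by rewrite bigcup_const//; exists 0%N.
- exact: cylinder_setI.
- move=> _ [C mC ->].
  rewrite [LHS]/= [RHS]/= /mrestr /mscale fineK//.
  have setE k : [set i | (i < k)%N] = [set` iota 0 k].
    by apply/seteqP; split=> j /=; rewrite mem_iota.
  rewrite [X in Q X](_ : _ = \bigcap_(i in [set i | (i < m.+1)%N])
      V i @^-1` (if i == m then B else C i)); last first.
    apply/seteqP; split => w /=.
      move=> [wC wB] i /=; rewrite ltnS.
      by case: ltngtP => // [im _|-> _]; [exact: (wC i im)|exact: wB].
    move=> wBC; split.
      move=> i /= im; have := wBC i; rewrite /= ltnS (ltnW im).
      by rewrite (ltn_eqF im); exact.
    by have := wBC m; rewrite /= ltnS leqnn eqxx; exact.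
  case: hV => indep _; rewrite !setE !(indep _ (iota_uniq _ _))//; last by move=> i; case: ifP.
  rewrite -addn1 iotaD big_cat/= big_seq1 eqxx muleC uniform_law//; congr (_ * _)%E.
  rewrite (indep _ (iota_uniq _ _))//; apply: eq_big_seq => i; rewrite mem_iota add0n => im.
  by rewrite (ltn_eqF im).
- by move=> _; rewrite /= /mrestr setTI (le_lt_trans (probability_le1 _ _)) ?ltry.
Qed.

(** On an event of the past, V m is independent of V i, so the joint law of the pair is a product
    measure and V m can be integrated out with V i frozen. *)
Lemma past_Fubini m i A (h : R * R -> \bar R) : past m A -> (i < m)%N ->
  measurable_fun setT h -> (forall z, 0 <= h z)%E ->
  (\int[Q]_(w in A) h (V i w, V m w) =
   \int[Q]_(w in A) \int[distribution Q (V m)]_y h (V i w, y))%E.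
Proof.
move=> pA im mh h0.
have mA := past_measurable pA.
have mVi : measurable_fun setT (V i) by exact: measurable_funP.
have mVm : measurable_fun setT (V m) by exact: measurable_funP.
pose Z w := (V i w, V m w).
have mZ : measurable_fun setT Z by exact: measurable_fun_pair.
pose nu' : {measure set _ -> \bar R} := pushforward (mrestr Q mA) (V i).
pose nuZ' : {measure set _ -> \bar R} := pushforward (mrestr Q mA) Z.
pose nu := nu' mVi; pose nuZ := nuZ' mZ.
pose un := distribution Q (V m).
have nuZE C : measurable C -> nuZ C = (nu \x un)%E C.
  move=> mC.
  apply: (@measure_unique _ R _ [set A `*` B | A in measurable & B in measurable]
    (fun=> setT) _ _ _ _ nuZ (nu \x un)%E) => //.
  - exact: measurable_prod_measurableType.
  - move=> _ _ [X1 mX1 [X2 mX2 <-]] [Y1 mY1 [Y2 mY2 <-]].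
    exists (X1 `&` Y1); first exact: measurableI.
    by exists (X2 `&` Y2); [exact: measurableI|rewrite setXI].
  - by move=> _; exists setT => //; exists setT => //; rewrite setXTT.
  - by rewrite bigcup_const//; exists 0%N.
  - move=> _ [X1 mX1 [X2 mX2 <-]].
    transitivity (nu X1 * un X2)%E; last by rewrite -product_measure1E.
    rewrite /nuZ /nuZ' /nu /nu' /= /pushforward /mrestr /un /distribution /pushforward uniform_law// -(@past_indep m)//.
      by congr (Q _); apply/seteqP; split => w /=; tauto.
    by apply: (@measurableI _ (g_sigma_algebraType (cylinder m))) => //; exact: past_coord.
  - move=> _; rewrite /= /pushforward /mrestr (le_lt_trans (probability_le1 _ _)) ?ltry//.
    by apply: measurableI => //; rewrite preimage_setT.
transitivity (\int[nuZ]_z h z)%E.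
  by rewrite ge0_integral_pushforward//= ge0_integral_mrestr//; exact: measurableT_comp.
rewrite (eq_measure_integral (nu \x un)%E)//; last by move=> C mC _; exact: nuZE.
have fin_nu : fin_num_fun nu.
  move=> B mB; rewrite ge0_fin_numE// (le_lt_trans (probability_le1 _ _)) ?ltry//.
  by apply: measurableI => //; exact: measurable_RV_preimage.
pose fnu : {finite_measure set _ -> \bar R} :=
  HB.pack (Measure.sort nu) (Measure_isFinite.Build _ _ _ nu fin_nu).
transitivity (\int[fnu \x un]_z h z)%E; first by [].
rewrite (fubini_tonelli1 (m1 := fnu) (m2 := un))//.
have mF : measurable_fun setT (fun x => \int[un]_y h (x, y))%E.
  exact: measurable_fun_fubini_tonelli_F.
rewrite ge0_integral_pushforward//=; last by move=> x _; exact: integral_ge0.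
rewrite ge0_integral_mrestr//; first exact: measurableT_comp.
by move=> x; exact: integral_ge0.
Qed.

End records.

Section record_time.
Context (R : realType) (v : nat -> R).

Lemma record_time_next n i m : record_time v n = i -> (i < m)%N -> v i < v m ->
  (forall j, (i < j < m)%N -> v j <= v i) -> record_time v n.+1 = m.
Proof.
move=> <- im vim vj /=; case: pselect => [ex|[]]; last first.
  by exists m; rewrite im.
case: ex_minnP => k /andP[ik vik] kmin.
have km : (k <= m)%N by apply: kmin; rewrite im.
apply/eqP; rewrite eqn_leq km/= leqNgt; apply/negP => kltm.
by have := vj k; rewrite ik kltm leNgt vik => /(_ isT).
Qed.

Lemma record_time_prev n m : record_time v n.+1 = m.+1 ->
  [/\ (record_time v n < m.+1)%N, v (record_time v n) < v m.+1 &
    forall j, (record_time v n < j < m.+1)%N -> v j <= v (record_time v n)].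
Proof.
move=> /=; case: pselect => [ex|//]; case: ex_minnP => k /andP[ik vik] kmin <-.
split => // j /andP[ij jk]; rewrite leNgt; apply/negP => vj.
by have := kmin j; rewrite ij vj leqNgt jk => /(_ isT).
Qed.
End record_time.

Section records_law.
Context (R : realType) d (Om : measurableType d)
  (Q : probability Om R) (V : nat -> {RV Q >-> R}).
Hypothesis hV : iid_uniform V.
Local Notation unif := (uniform_prob (@ltr01 R)).
Implicit Types (A : set Om) (i j k m n : nat).

(** The distribution function of the uniform law on (0, 1). *)
Definition clip (x : R) : R := Num.max 0 (Num.min x 1).

Lemma clip01 x : 0 <= clip x <= 1.
Proof. by rewrite /clip le_max lexx/= ge_max ler01/= ge_min lexx orbT. Qed.

Lemma clip_id x : 0 <= x <= 1 -> clip x = x.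
Proof. by case/andP=> x0 x1; rewrite /clip (min_idPl x1) (max_idPr x0). Qed.

Lemma measurable_clip : measurable_fun setT clip.
Proof. by apply: measurable_maxr => //; exact: measurable_minr. Qed.

Lemma uniform_le x : unif `]-oo, x]%classic = (clip x)%:E.
Proof.
transitivity (\int[unif]_y (\1_(`]-oo, x]%classic) y)%:E)%E.
  by rewrite integral_indic// setIT.
rewrite integral_uniform//; last by apply/measurable_EFinP.
rewrite subr0 invr1 mul1e integral_indic//=.
have [x0|x0] := ltP x 0.
  rewrite (_ : _ `&` _ = set0).
    rewrite measure0 /clip (min_idPl _) ?(ltW (lt_trans x0 _))//.
    by rewrite (max_idPl (ltW x0)).
  apply/seteqP; split => // y /=; rewrite !in_itv/= => -[yx /andP[y0 _]].
  by have := lt_le_trans x0 (le_trans y0 yx); rewrite ltxx.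
rewrite (_ : _ `&` _ = `[0, Num.min x 1]%classic); last first.
  apply/seteqP; split => y /=; rewrite !in_itv/= le_min.
    by move=> [-> /andP[-> ->]].
  by move=> /and3P[-> -> ->].
rewrite lebesgue_measure_itv/= lte_fin.
have m0 : 0 <= Num.min x 1 by rewrite le_min x0 ler01.
rewrite /clip (max_idPr m0); case: ifPn => [_|]; first by rewrite oppr0 adde0.
by rewrite -leNgt => m0'; congr EFin; apply/eqP; rewrite eq_le m0 m0'.
Qed.

Lemma uniform_gt x : unif `]x, +oo[%classic = (1 - clip x)%:E.
Proof.
rewrite -(setCitvl (BRight x)) probability_setC; last exact: measurable_itv.
by rewrite [X in (1 - X)%E]uniform_le EFinB.
Qed.

Lemma past_measurable_coord m i : (i < m)%N ->
  measurable_fun setT (V i : g_sigma_algebraType (cylinder V m) -> R).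
Proof. by move=> im _ B mB; rewrite setTI; exact: past_coord. Qed.

Lemma past_lt m i j : (i < m)%N -> (j < m)%N ->
  past V m [set w | V i w < V j w].
Proof.
move=> im jm.
have := measurable_fun_ltr (past_measurable_coord im) (past_measurable_coord jm).
by move=> /(_ measurableT [set true]); rewrite setTI; exact.
Qed.

Lemma past_le m i j : (i < m)%N -> (j < m)%N ->
  past V m [set w | V i w <= V j w].
Proof.
move=> im jm.
have := measurable_fun_ler (past_measurable_coord im) (past_measurable_coord jm).
by move=> /(_ measurableT [set true]); rewrite setTI; exact.
Qed.

Lemma pastI m A B : past V m A -> past V m B -> past V m (A `&` B).
Proof. exact: (@measurableI _ (g_sigma_algebraType (cylinder V m))). Qed.

(** The k trials after the i-th one do not beat it. *)
Definition stays i k := [set w | forall j, (i < j <= i + k)%N -> V j w <= V i w].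

Lemma stays0 i : stays i 0 = setT.
Proof.
apply/seteqP; split => // w _ j /=; rewrite addn0 => /andP[ij ji].
by move: (leq_trans ij ji); rewrite ltnn.
Qed.

Lemma staysS i k :
  stays i k.+1 = stays i k `&` [set w | V (i + k.+1)%N w <= V i w].
Proof.
apply/seteqP; split => w /=.
  move=> H; split; last by apply: H; rewrite leqnn addnS ltnS leq_addr.
  by move=> j /andP[ij jk]; apply: H; rewrite ij addnS (leq_trans jk).
move=> [H1 H2] j /andP[ij]; rewrite leq_eqVlt => /orP[/eqP -> //|].
by rewrite addnS ltnS => jk; apply: H1; rewrite ij.
Qed.

Lemma past_stays i k m : (i + k < m)%N -> past V m (stays i k).
Proof.
elim: k => [|k IH] ikm.
  by rewrite stays0; exact: (@measurableT _ (g_sigma_algebraType (cylinder V m))).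
rewrite staysS; apply: pastI.
  by apply: IH; apply: ltn_trans ikm; rewrite addnS.
by apply: past_le => //; rewrite (leq_ltn_trans _ ikm)// leq_addr.
Qed.

Lemma measurable_coord i : measurable_fun setT (V i).
Proof. exact: measurable_funP. Qed.

(** By induction on k: integrating out the last trial, which must fall below V i, produces one
    factor [clip (V i)]. *)
Lemma integral_stays A i k (g : R -> R) : past V i.+1 A ->
  measurable_fun setT g -> (forall x, 0 <= g x) ->
  (\int[Q]_(w in A `&` stays i k) (g (V i w))%:E =
   \int[Q]_(w in A) (clip (V i w) ^+ k * g (V i w))%:E)%E.
Proof.
move=> pA; elim: k g => [|k IH] g mg g0.
  by rewrite stays0 setIT; under [RHS]eq_integral do rewrite expr0 mul1r.
have mclip := measurable_clip.
have pB : past V (i + k.+1) (A `&` stays i k).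
  apply: pastI; last by apply: past_stays; rewrite addnS.
  by apply: past_mono pA; rewrite addnS ltnS leq_addr.
have mB := past_measurable pB.
rewrite staysS setIA.
pose C : set (R * R) := [set z | z.2 <= z.1].
have mC : measurable C.
  have := measurable_fun_ler (@measurable_snd _ _ R R) (@measurable_fst _ _ R R).
  by move=> /(_ measurableT [set true]); rewrite setTI; exact.
pose h (z : R * R) : \bar R := (g z.1 * \1_C z)%:E.
have mh : measurable_fun setT h.
  apply/measurable_EFinP; apply: measurable_funM; first exact: measurableT_comp.
  exact: measurable_indic.
transitivity (\int[Q]_(w in A `&` stays i k) h (V i w, V (i + k.+1)%N w))%E.
  rewrite integral_mkcondr; apply: eq_integral => w _.
  by rewrite epatch_indic/= -EFinM /h !indicE; congr (_ * (nat_of_bool _)%:R)%:E; apply/idP/idP; rewrite !inE.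
rewrite (past_Fubini hV)//; first last.
- by move=> z; rewrite lee_fin mulr_ge0.
- by rewrite addnS ltnS leq_addr.
transitivity (\int[Q]_(w in A `&` stays i k) (clip (V i w) * g (V i w))%:E)%E.
  apply: eq_integral => w _.
  transitivity (\int[distribution Q (V (i + k.+1)%N)]_y ((g (V i w))%:E * (\1_(`]-oo, V i w]%classic) y)%:E))%E.
    apply: eq_integral => y _; rewrite /h -EFinM !indicE.
    by congr (_ * (nat_of_bool _)%:R)%:E; apply/idP/idP; rewrite !inE/= in_itv/=.
  rewrite ge0_integralZl//; last 2 first.
    exact/measurable_EFinP.
    by rewrite lee_fin.
  rewrite integral_indic// setIT [X in (_ * X)%E](uniform_law hV)//.
  by rewrite uniform_le -EFinM mulrC.
rewrite (IH (fun x => clip x * g x)).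
- by apply: eq_integral => w _; rewrite exprSr mulrA.
- exact: measurable_funM.
- by move=> x; rewrite mulr_ge0//; case/andP: (clip01 x).
Qed.

(** Trial i+k+1 beats trial i and exceeds the level x. *)
Definition jump i k (x : R) :=
  [set w | V i w < V (i + k.+1)%N w /\ x < V (i + k.+1)%N w].

Lemma past_jump i k x m : (i + k.+1 < m)%N -> past V m (jump i k x).
Proof.
move=> ikm; apply: pastI.
  by apply: past_lt => //; rewrite (leq_ltn_trans _ ikm)// leq_addr.
have /(_ `]x, +oo[%classic (measurable_itv _)) := @past_coord R d Om Q V m _ _ ikm.
by congr (past V m); apply/seteqP; split => w /=; rewrite in_itv/= andbT.
Qed.

Lemma prob_stays_jump A i k (x : R) : past V i.+1 A ->
  (Q (A `&` (stays i k `&` jump i k x)) =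
   \int[Q]_(w in A)
     (clip (V i w) ^+ k * (1 - clip (Num.max (V i w) x)))%:E)%E.
Proof.
move=> pA; have mclip := measurable_clip.
have pB : past V (i + k.+1) (A `&` stays i k).
  apply: pastI; last by apply: past_stays; rewrite addnS.
  by apply: past_mono pA; rewrite addnS ltnS leq_addr.
have mB := past_measurable pB.
have mJ : measurable (jump i k x) by exact: (past_measurable (@past_jump i k x _ (ltnSn _))).
pose C : set (R * R) := [set z | z.1 < z.2 /\ x < z.2].
have mC : measurable C.
  apply: measurableI.
    have := measurable_fun_ltr (@measurable_fst _ _ R R) (@measurable_snd _ _ R R).
    by move=> /(_ measurableT [set true]); rewrite setTI; exact.
  have := measurable_fun_ltr (@measurable_cst _ _ (R * R)%type R setT x) (@measurable_snd _ _ R R).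
  by move=> /(_ measurableT [set true]); rewrite setTI; exact.
pose h (z : R * R) : \bar R := (\1_C z)%:E.
have mh : measurable_fun setT h by apply/measurable_EFinP; exact: measurable_indic.
rewrite setIA setIC -integral_indic//.
transitivity (\int[Q]_(w in A `&` stays i k) h (V i w, V (i + k.+1)%N w))%E.
  by apply: eq_integral => w _.
rewrite (past_Fubini hV)//; first last.
- by move=> z; rewrite lee_fin.
- by rewrite addnS ltnS leq_addr.
pose g (y : R) := 1 - clip (Num.max y x).
rewrite -(@integral_stays A i k g)//.
- apply: eq_integral => w _.
  transitivity (\int[distribution Q (V (i + k.+1)%N)]_y
      (\1_(`]Num.max (V i w) x, +oo[%classic) y)%:E)%E.
    apply: eq_integral => y _; rewrite /h !indicE.
    by congr ((nat_of_bool _)%:R)%:E; apply/idP/idP; rewrite !inE/= in_itv/= andbT gt_max => /andP.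
  rewrite integral_indic// setIT [LHS](uniform_law hV)//.
  exact: uniform_gt.
- apply: measurable_funB => //; apply: measurableT_comp => //.
  exact: measurable_maxr.
- by move=> y; rewrite subr_ge0; case/andP: (clip01 (Num.max y x)).
Qed.

(** The probability that the record following a record at height y exceeds x: sum over the
    number k of trials not above y before the first one above y. *)
Definition next_tail (x y : R) : \bar R :=
  (\sum_(0 <= k <oo) (clip y ^+ k * (1 - clip (Num.max y x)))%:E)%E.

Let term_ge0 x y k : 0 <= clip y ^+ k * (1 - clip (Num.max y x)).
Proof.
rewrite mulr_ge0//; first by rewrite exprn_ge0//; case/andP: (clip01 y).
by rewrite subr_ge0; case/andP: (clip01 (Num.max y x)).
Qed.

(** A geometric series: given that it exceeds y, the next record is uniform on (y, 1). *)
Lemma next_tailE x y : 0 <= y < 1 ->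
  next_tail x y = ((1 - clip (Num.max y x)) / (1 - y))%:E.
Proof.
move=> /andP[y0 y1]; rewrite /next_tail.
have := @cvg_geometric_series R (1 - clip (Num.max y x)) y.
rewrite ger0_norm// => /(_ y1) cv.
transitivity (limn (EFin \o series (geometric (1 - clip (Num.max y x)) y))).
  apply: congr_lim; apply/funext => n /=; rewrite /series/= -sumEFin.
  apply: eq_bigr => k _; rewrite clip_id ?y0 ?(ltW y1)//.
  by rewrite /geometric/= mulrC.
by rewrite EFin_lim; [congr EFin; exact/cvg_lim | apply/cvg_ex; eexists; exact: cv].
Qed.

Lemma measurable_next_tail x : measurable_fun setT (next_tail x).
Proof.
apply: ge0_emeasurable_sum => [k y _ _|k _]; first by rewrite lee_fin.
have mclip := measurable_clip.
apply/measurable_EFinP; apply: measurable_funM; first exact: measurable_funX.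
apply: measurable_funB => //; apply: measurableT_comp => //.
exact: measurable_maxr.
Qed.

Lemma next_tail_ge0 x y : (0 <= next_tail x y)%E.
Proof. by apply: nneseries_ge0 => k _ _; rewrite lee_fin. Qed.

(** Given that trial i is a record, the next record occurs and exceeds x. *)
Definition exceed i (x : R) := \bigcup_k (stays i k `&` jump i k x).

Lemma measurable_stays_jump i k x : measurable (stays i k `&` jump i k x).
Proof.
apply: (@past_measurable _ _ _ _ V (i + k.+1).+1).
apply: pastI; last exact: past_jump.
by apply: past_stays; rewrite addnS ltnS ltnW.
Qed.

(** Disjoint union over the time of the first trial above V i. *)
Lemma prob_exceed A i x : past V i.+1 A ->
  (Q (A `&` exceed i x) = \int[Q]_(w in A) next_tail x (V i w))%E.
Proof.
move=> pA; have mA := past_measurable pA; have mclip := measurable_clip.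
have mSJ k : measurable (A `&` (stays i k `&` jump i k x)).
  by apply: measurableI => //; exact: measurable_stays_jump.
rewrite /exceed setI_bigcupr measure_semi_bigcup//; last 2 first.
- apply: ltn_trivIset => k2 k1 k12.
  apply/seteqP; split => // w /= [[_ [_ [+ _]]] [_ [/(_ (i + k1.+1)%N) + _]]].
  rewrite addnS ltnS leq_addr/= ltn_add2l => + /(_ k12).
  by move=> /lt_le_trans /[apply]; rewrite ltxx.
- exact: bigcup_measurable.
transitivity (\sum_(0 <= k <oo) \int[Q]_(w in A)
    (clip (V i w) ^+ k * (1 - clip (Num.max (V i w) x)))%:E)%E.
  by apply: eq_eseriesr => k _; exact: prob_stays_jump.
rewrite -integral_nneseries//; last by move=> k w _; rewrite lee_fin.
move=> k; apply/measurable_EFinP; apply: measurable_funTS; apply: measurable_funM.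
  by apply: measurable_funX; exact: measurableT_comp.
apply: measurable_funB => //; apply: measurableT_comp => //.
by apply: measurable_maxr => //; exact: measurable_coord.
Qed.

End records_law.

(** * The law of the record values *)

Section records_expectation.
Context (R : realType) d (Om : measurableType d)
  (Q : probability Om R) (V : nat -> {RV Q >-> R}).
Local Notation path w := (fun i => V i w).
Implicit Types (A : set Om) (i j k m n : nat).

(** The n-th record occurs at time m. The event is needed because a record time equal to 0 may
    also be the default value for a missing record. *)
Fixpoint record_at n m : set Om :=
  if n is n'.+1 then
    \bigcup_(i in [set i | (i < m)%N])
      (record_at n' i `&` (stays V i (m - i.+1) `&` [set w | V i w < V m w]))
  else if m is 0 then setT else set0.

Lemma record_at_time n m w : record_at n m w -> record_time (path w) n = m.
Proof.
elim: n m => [|n IH] m /=; first by case: m.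
move=> [i /= im [Ei [Si Vim]]]; apply: (record_time_next (IH _ Ei) im Vim).
by move=> j /andP[ij jm]; apply: Si; lia.
Qed.

Lemma past_record_at n m : past V m.+1 (record_at n m).
Proof.
have past0 k : past V k set0.
  exact: (@measurable0 _ (g_sigma_algebraType (cylinder V k))).
have pastT k : past V k setT.
  exact: (@measurableT _ (g_sigma_algebraType (cylinder V k))).
elim: n m => [|n IH] m /=; first by case: m.
apply: (@fin_bigcup_measurable _ (g_sigma_algebraType (cylinder V m.+1))).
  exact: finite_II.
move=> i /= im; apply: pastI; first by apply: past_mono (IH i); rewrite ltnS ltnW.
apply: pastI; last by apply: past_lt; lia.
by apply: past_stays; lia.
Qed.

Lemma measurable_record_at n m : measurable (record_at n m).
Proof. exact: (past_measurable (@past_record_at n m)). Qed.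

Lemma trivIset_record_at n : trivIset setT (record_at n).
Proof.
move=> i j _ _ [w [/record_at_time Ei /record_at_time Ej]].
by rewrite -Ei -Ej.
Qed.

(** Positive record times are described by finitely many trials; the value 0 is the complement. *)
Lemma measurable_record_time n m :
  measurable [set w | record_time (path w) n = m].
Proof.
elim: n m => [|n IH] m.
  have [->|m0] := eqVneq m 0%N.
    by rewrite (_ : [set _ | _] = setT)//; apply/seteqP; split.
  rewrite (_ : [set _ | _] = set0)//; apply/seteqP; split => // w /= m0'.
  by rewrite -m0' eqxx in m0.
have mS k : measurable [set w | record_time (path w) n.+1 = k.+1].
  rewrite (_ : [set _ | _] = \bigcup_(i in [set i | (i < k.+1)%N])
      ([set w | record_time (path w) n = i] `&`
       (stays V i (k - i) `&` [set w | V i w < V k.+1 w]))).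
    apply: fin_bigcup_measurable; first exact: finite_II.
    move=> i /= ik; apply: measurableI => //; apply: measurableI.
      by apply: (@past_measurable _ _ _ _ V k.+1); apply: past_stays; lia.
    by apply: (@past_measurable _ _ _ _ V k.+2); apply: past_lt; lia.
  apply/seteqP; split => w.
    move=> /record_time_prev[ik vik vj].
    exists (record_time (path w) n) => //; split => //; split => //.
    by move=> j /andP[ij jk]; apply: vj; lia.
  move=> [i /= ik [ti [Si Vi]]]; apply: (record_time_next ti ik Vi).
  by move=> j /andP[ij jk]; apply: Si; lia.
case: m => [|m]; last exact: mS.
rewrite (_ : [set _ | _] = ~` \bigcup_k [set w | record_time (path w) n.+1 = k.+1]).
  by apply: measurableC; exact: bigcup_measurable.
apply/seteqP; split => w.
  by move=> t0 [k _ /=]; move: t0 => /= ->.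
move=> /= H; case E : (record_time (path w) n.+1) => [|k]; first exact: E.
by exfalso; apply: H; exists k.
Qed.

Definition recval n (w : Om) : R := record_value (path w) n.

Lemma measurable_recval n : measurable_fun setT (recval n).
Proof.
move=> _ B mB; rewrite setTI.
rewrite (_ : recval n @^-1` B = \bigcup_m
  ([set w | record_time (path w) n = m] `&` V m @^-1` B)).
  apply: bigcup_measurable => m _; apply: measurableI.
    exact: measurable_record_time.
  exact: measurable_RV_preimage.
apply/seteqP; split => w /=.
  by move=> Bw; exists (record_time (path w) n).
by move=> [m _ [/= tm Bm]]; rewrite /recval /record_value tm.
Qed.

HB.instance Definition _ n := isMeasurableFun.Build _ _ _ _ (recval n)
  (measurable_recval n).

Lemma recval_at n m w : record_at n m w -> recval n w = V m w.
Proof. by move=> /record_at_time E; rewrite /recval /record_value E. Qed.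

Definition has_record n := \bigcup_m record_at n m.

Lemma measurable_has_record n : measurable (has_record n).
Proof. by apply: bigcup_measurable => m _; exact: measurable_record_at. Qed.

(** The n-th and the next record exist, and the latter exceeds x. *)
Definition next_event n (x : R) := \bigcup_i (record_at n i `&` exceed V i x).

Lemma measurable_exceed i x : measurable (exceed V i x).
Proof. by apply: bigcup_measurable => k _; exact: measurable_stays_jump. Qed.

Lemma measurable_next_event n x : measurable (next_event n x).
Proof.
apply: bigcup_measurable => i _; apply: measurableI.
  exact: measurable_record_at.
exact: measurable_exceed.
Qed.

(** Unfolds the event together with its consequence for the next record. *)
Lemma next_eventP n x w : next_event n x w <->
  exists i k, [/\ record_at n i w, stays V i k w, jump V i k x w,
    record_at n.+1 (i + k.+1)%N w & recval n.+1 w = V (i + k.+1)%N w].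
Proof.
split=> [[i _ [Ei [k _ [Si Ji]]]]|[i [k [Ei Si Ji _ _]]]]; last first.
  by exists i => //; split => //; exists k.
exists i, k.
have En : record_at n.+1 (i + k.+1)%N w.
  exists i => /=; first by rewrite addnS ltnS leq_addr.
  split => //; split; last by case: Ji.
  by rewrite (_ : (i + k.+1 - i.+1)%N = k)//; lia.
by split => //; exact: recval_at.
Qed.

Hypothesis hV : iid_uniform V.

(** The events [record_at n i] are disjoint and cover almost everything; each one depends on the
    past only, so the probability of exceeding x is [next_tail]. *)
Lemma prob_next_event n x : Q (has_record n) = 1%E ->
  (Q (next_event n x) = \int[Q]_w next_tail x (recval n w))%E.
Proof.
move=> Qn; rewrite /next_event measure_semi_bigcup//; last 3 first.
- by move=> i; apply: measurableI; [exact: measurable_record_at|exact: measurable_exceed].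
- by apply: trivIset_setIr; exact: trivIset_record_at.
- exact: measurable_next_event.
have mnt := @measurable_next_tail R x.
transitivity (\sum_(0 <= i <oo) \int[Q]_(w in record_at n i) next_tail x (recval n w))%E.
  apply: eq_eseriesr => i _; rewrite [LHS](prob_exceed hV x (@past_record_at n i)).
  by apply: eq_integral => w; rewrite inE => /recval_at ->.
have mf : measurable_fun setT (fun w => next_tail x (recval n w)).
  by apply: measurableT_comp => //; exact: measurable_recval.
rewrite -ge0_integral_bigcup//; last 4 first.
- by move=> i; exact: measurable_record_at.
- exact: measurable_funTS.
- by move=> w _; exact: next_tail_ge0.
- exact: trivIset_record_at.
rewrite [RHS](@ge0_negligible_integral _ _ _ _ _ (~` has_record n))//.
- by rewrite setTD setCK.
- by apply: measurableC; exact: measurable_has_record.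
- by move=> w _; exact: next_tail_ge0.
- rewrite [LHS]probability_setC; last exact: measurable_has_record.
  by rewrite Qn subee.
Qed.

End records_expectation.

Section gamma_law.
Context (R : realType).
Local Notation leb := (@lebesgue_measure R).
Implicit Types (n : nat) (x y z : R).

(** Distribution function of the standard exponential law, the inverse of [L]. *)
Definition uexp y : R := 1 - expR (- y).

Lemma measurable_uexp : measurable_fun setT uexp.
Proof.
by apply: measurable_funB => //; exact: measurableT_comp.
Qed.

Lemma uexp_lt y z : (uexp y < uexp z) = (y < z).
Proof. by rewrite /uexp ltrD2l ltrN2 ltr_expR ltrN2. Qed.

Lemma uexp_ge0 y : 0 <= y -> 0 <= uexp y.
Proof. by move=> y0; rewrite subr_ge0 -[leRHS]expR0 ler_expR oppr_le0. Qed.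

Lemma uexp_lt1 y : uexp y < 1.
Proof. by rewrite ltrBlDr ltrDl expR_gt0. Qed.

Lemma uexp_L (u : R) : u < 1 -> uexp (L u) = u.
Proof. by move=> u1; rewrite /uexp /L opprK lnK ?posrE ?subr_gt0// subKr. Qed.

Lemma L_uexp y : L (uexp y) = y.
Proof. by rewrite /uexp /L subKr expRK opprK. Qed.

Lemma L_ge0 (u : R) : 0 <= u < 1 -> 0 <= L u.
Proof.
move=> /andP[u0 u1]; rewrite leNgt; apply/negP => Lu.
by move: Lu; rewrite -uexp_lt uexp_L// /uexp oppr0 expR0 subrr ltNge u0.
Qed.

Lemma uexp0 : uexp 0 = 0 :> R.
Proof. by rewrite /uexp oppr0 expR0 subrr. Qed.

(** Tails at the levels 1 - e^-z determine all tails: there is no mass above 1, since the gamma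
    tail vanishes at infinity, and no mass below 0, since the total mass is 1. *)
Lemma gamma_tails n (m : {measure set R -> \bar R}) : (m setT = 1)%E ->
  (forall z, 0 <= z -> m `]uexp z, +oo[%classic = (gtail n z)%:E) ->
  forall x, m `]x, +oo[%classic =
    (if x < 0 then 1 else if x < 1 then gtail n (L x) else 0)%:E.
Proof.
move=> m1 mt x.
have mono a b : a <= b -> (m `]b, +oo[%classic <= m `]a, +oo[%classic)%E.
  move=> ab; apply: le_measure; rewrite ?inE//.
  by apply: subset_itvr; rewrite bnd_simp.
case: ifPn => [x0|]; last rewrite -leNgt => x0.
  apply/eqP; rewrite eq_le; apply/andP; split.
    by rewrite -m1; apply: le_measure; rewrite ?inE.
  by rewrite -(gtailn0 R n) -mt// mono// uexp0 ltW.
case: ifPn => [x1|]; last rewrite -leNgt => x1.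
  by rewrite -[in LHS](uexp_L x1) mt// L_ge0// x0.
apply/eqP; rewrite eq_le measure_ge0 andbT.
have mle z : 0 <= z -> (m `]x, +oo[%classic <= (gtail n z)%:E)%E.
  by move=> z0; rewrite -mt// mono// (le_trans (ltW (uexp_lt1 z))).
have mfin : m `]x, +oo[%classic \is a fin_num.
  by rewrite ge0_fin_numE// (le_lt_trans (mle 0 (lexx _))) ?ltry.
rewrite -(fineK mfin) lee_fin.
have := @cvgr_to_ge _ _ _ _ _ _ (fine (m `]x, +oo[%classic)) (@cvg_gtail R n).
apply; near=> z; rewrite -lee_fin fineK//; apply: mle.
by near: z; exact: nbhs_pinfty_ge.
Unshelve. all: by end_near. Qed.

Lemma integral_gamma_law n (m : {measure set R -> \bar R}) (f : R -> \bar R) :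
  (m setT = 1)%E ->
  (forall z, 0 <= z -> m `]uexp z, +oo[%classic = (gtail n z)%:E) ->
  measurable_fun setT f -> (forall x, 0 <= f x)%E ->
  (\int[m]_u f u = \int[leb]_y (f (uexp y) * (gam n y)%:E))%E.
Proof.
move=> m1 mt mf f0.
pose g : {measure set _ -> \bar R} := mdens leb (@measurable_gam R n) (@gam_ge0 R n).
pose p' : {measure set R -> \bar R} := pushforward g uexp.
pose p := p' measurable_uexp.
have p1 : (p setT = 1)%E.
  by rewrite /p /p' /= /pushforward preimage_setT /g /= /mdens integral_gam.
have pt z : 0 <= z -> p `]uexp z, +oo[%classic = (gtail n z)%:E.
  move=> z0; rewrite -integral_gam_tail//= /pushforward /g/= /mdens.
  by congr integral; apply/seteqP; split => y /=; rewrite !in_itv/= !andbT uexp_lt.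
have mp A : measurable A -> m A = p A.
  apply: eq_measure_tails; first by rewrite m1 ltry.
  by move=> x; rewrite (gamma_tails m1 mt) (gamma_tails p1 pt).
rewrite (eq_measure_integral p); last by move=> A mA _; exact: mp.
rewrite ge0_integral_pushforward//; last exact: measurable_uexp.
have mfu : measurable_fun setT (f \o uexp).
  exact: (measurableT_comp mf measurable_uexp).
rewrite preimage_setT ge0_integral_mdens//.
by move=> y; exact: f0.
Qed.

(** The gamma laws are the iterates of this kernel: below z the kernel multiplies the density
    by e^(y-z), leaving a pure power to integrate, and above z it equals 1. *)
Lemma integral_next_tail n z : 0 <= z ->
  (\int[leb]_y (next_tail (uexp z) (uexp y) * (gam n y)%:E) =
   (gtail n.+1 z)%:E)%E.
Proof.
move=> z0.
pose f y := expR (- z) * (y ^+ n / n`!%:R).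
have fgam y : 0 < y -> y <= z ->
    (next_tail (uexp z) (uexp y) * (gam n y)%:E = (f y)%:E)%E.
  move=> y0 yz; rewrite next_tailE ?uexp_ge0 ?uexp_lt1 ?(ltW y0)//.
  rewrite (max_idPr _); last by rewrite leNgt uexp_lt -leNgt.
  rewrite clip_id ?uexp_ge0 ?(ltW (uexp_lt1 _))// /gam y0 -EFinM /uexp !subKr.
  congr EFin; rewrite /f -!mulrA; congr (_ * _).
  by rewrite mulrC -mulrA -mulrA divff ?mulr1// gt_eqF ?expR_gt0.
have ggam y : z < y ->
    (next_tail (uexp z) (uexp y) * (gam n y)%:E = (gam n y)%:E)%E.
  move=> zy; have y0 := le_lt_trans z0 zy.
  rewrite next_tailE ?uexp_ge0 ?uexp_lt1 ?(ltW y0)//.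
  rewrite (max_idPl _); last by rewrite ltW// uexp_lt.
  rewrite clip_id ?uexp_ge0 ?(ltW (uexp_lt1 _)) ?(ltW y0)// divff ?mul1e//.
  by rewrite /uexp subKr gt_eqF ?expR_gt0.
have mint : measurable_fun setT (fun y => next_tail (uexp z) (uexp y) * (gam n y)%:E)%E.
  apply: emeasurable_funM.
    by apply: measurableT_comp; [exact: measurable_next_tail|exact: measurable_uexp].
  by apply/measurable_EFinP; exact: measurable_gam.
have int0 y : (0 <= next_tail (uexp z) (uexp y) * (gam n y)%:E)%E.
  by rewrite mule_ge0 ?next_tail_ge0// lee_fin gam_ge0.
transitivity (\int[leb]_(y in `]0%R, z] `|` `]z, +oo[)
    (next_tail (uexp z) (uexp y) * (gam n y)%:E))%E.
  rewrite [RHS]integral_mkcond; apply: eq_integral => y _; rewrite patchE.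
  case: ifPn => //; rewrite notin_setE/= !in_itv/= andbT => H.
  have y0 : y <= 0 by rewrite leNgt; apply/negP => y0; apply: H; case: (leP y z) => yz; [left; rewrite y0|right].
  by rewrite /gam ltNge y0/= mule0.
rewrite ge0_integral_setU//=; last 2 first.
- exact: measurable_funTS.
- apply/disj_setPLR => y /=; rewrite !in_itv/= andbT => /andP[_ yz].
  by apply/negP; rewrite -leNgt.
rewrite [X in (_ + X)%E](_ : _ = (gtail n z)%:E); last first.
  rewrite -integral_gam_tail//; apply: eq_integral => y.
  by rewrite inE/= in_itv/= andbT; exact: ggam.
rewrite [X in (X + _)%E](_ : _ = \int[leb]_(y in `]0%R, z]) (f y)%:E)%E; last first.
  by apply: eq_integral => y; rewrite inE/= in_itv/= => /andP[]; exact: fgam.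
rewrite gtailS addrC EFinD; congr (_ + _)%E.
have cf : continuous f.
  move=> y; apply: cvgM; first exact: cvg_cst.
  by apply: cvgM; [exact: exprn_continuous|exact: cvg_cst].
rewrite integral_itv_obnd_cbnd; last first.
  by apply/measurable_EFinP/measurable_funTS; exact: continuous_measurable_fun.
pose F y := expR (- z) * (y ^+ n.+1 / n.+1`!%:R).
have dF y : is_derive y 1 F (f y).
  rewrite (_ : F = (expR (- z) / n.+1`!%:R) *: (fun x : R => x ^+ n.+1)); last first.
    by apply/funext => x; rewrite /F/= [RHS]mulrAC -mulrA.
  apply: (is_derive_eq (is_deriveZ _ (is_derive_exprn n y))).
  rewrite [LHS](_ : _ = expR (- z) / n.+1`!%:R * (n.+1%:R * y ^+ n))// /f.
  rewrite -mulrA; congr (_ * _).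
  by rewrite factS natrM invfM mulrACA mulVf ?pnatr_eq0// mul1r mulrC.
rewrite (integral_deriv z0 (fun y _ => dF y) (fun y _ => cf y)).
by rewrite /F expr0n/= mul0r mulr0 subr0 mulrC.
Qed.

End gamma_law.

Section record_law.
Context (R : realType) d (Om : measurableType d)
  (Q : probability Om R) (V : nat -> {RV Q >-> R}).
Hypothesis hV : iid_uniform V.
Local Notation leb := (@lebesgue_measure R).

(** By induction on n. Existence of the n-th record is carried along, because the transition
    formula holds on that event only; the level -1 makes exceeding automatic and yields
    existence of the next record. *)
Lemma record_law_tail n :
  Q (has_record V n) = 1%E /\
  forall z, 0 <= z -> Q (recval V n @^-1` `]uexp z, +oo[) = (gtail n z)%:E.
Proof.
elim: n => [|n [IH1 IH2]].
  split.
    rewrite (_ : has_record V 0 = setT) ?probability_setT//.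
    by apply/seteqP; split => // w _; exists 0%N.
  move=> z z0; rewrite (_ : recval V 0 = V 0%N)//.
  rewrite (uniform_law hV)// uniform_gt clip_id ?uexp_ge0 ?(ltW (uexp_lt1 _))//.
  by rewrite /gtail big_ord1 expr0 fact0 divr1 mulr1 /uexp subKr.
have law f := @integral_gamma_law R n (distribution Q (recval V n)) f (probability_setT _) IH2.
have Qnext x : Q (next_event V n x) =
    (\int[leb]_y (next_tail x (uexp y) * (gam n y)%:E))%E.
  rewrite (prob_next_event hV)// -law ?ge0_integral_distribution//.
  - exact: measurable_next_tail.
  - exact: next_tail_ge0.
  - exact: measurable_next_tail.
  - exact: next_tail_ge0.
(* every record exceeds -1, so this is the existence of the next record *)
have Qnext1 : Q (next_event V n (- 1)) = 1%E.
  rewrite Qnext -(integral_gam R n); apply: eq_integral => y _.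
  have [y0|y0] := ltP 0 y; last by rewrite /gam ltNge y0/= mule0.
  rewrite next_tailE ?uexp_ge0 ?uexp_lt1 ?(ltW y0)// (max_idPl _); last first.
    by rewrite (le_trans _ (uexp_ge0 (ltW y0))).
  rewrite clip_id ?uexp_ge0 ?(ltW (uexp_lt1 _)) ?(ltW y0)// divff ?mul1e//.
  by rewrite /uexp subKr gt_eqF ?expR_gt0.
split.
  apply/eqP; rewrite eq_le probability_le1/=; last exact: measurable_has_record.
  rewrite -Qnext1 le_measure ?inE//; first exact: measurable_next_event.
    exact: measurable_has_record.
  by move=> w /next_eventP[i [k [_ _ _ E _]]]; exists (i + k.+1)%N.
move=> z z0; rewrite -integral_next_tail// -Qnext.
have mnext x : measurable (next_event V n x) by exact: measurable_next_event.
have mU : measurable (recval V n.+1 @^-1` `]uexp z, +oo[).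
  by apply: measurable_RV_preimage.
apply/eqP; rewrite eq_le; apply/andP; split; last first.
  apply: le_measure; rewrite ?inE//.
  move=> w /next_eventP[i [k [_ _ [_ J] _ rE]]] /=.
  by rewrite in_itv/= andbT rE.
have Q0 : Q (~` next_event V n (- 1)) = 0%E.
  by rewrite probability_setC// Qnext1 subee.
rewrite -[leRHS]adde0 -Q0.
apply: le_trans (measureU2 _ _ _) => //; last exact: measurableC.
apply: le_measure; rewrite ?inE//.
  by apply: measurableU => //; exact: measurableC.
move=> w /= Uw; have [W|W] := pselect (next_event V n (- 1) w); last by right.
left; move/next_eventP: W => [i [k [Ei Si [J1 _] En rE]]].
apply/next_eventP; exists i, k; split => //; split => //.
by move: Uw; rewrite in_itv/= andbT rE.
Qed.

Theorem integral_record n (f : R -> \bar R) :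
  measurable_fun setT f -> (forall x, 0 <= f x)%E ->
  (\int[Q]_w f (recval V n w) = \int[leb]_y (f (uexp y) * (gam n y)%:E))%E.
Proof.
move=> mf f0.
rewrite -(@integral_gamma_law _ n (distribution Q (recval V n)))//.
- by rewrite ge0_integral_distribution.
- exact: probability_setT.
- exact: (record_law_tail n).2.
Qed.
End record_law.

(** * Quantile functions *)

Section quantile.
Context (R : realType) d (Om : measurableType d)
  (P : probability Om R) (X : {RV P >-> R}).
Local Notation F := (cdfR X).
Local Notation q := (quantile X).
Implicit Types (u x y : R).

Lemma cdfRE x : (F x)%:E = cdf X x.
Proof. by rewrite /cdfR fineK// fin_num_measure. Qed.

Lemma cdfR01 x : 0 <= F x <= 1.
Proof. by rewrite -!lee_fin cdfRE cdf_ge0 cdf_le1. Qed.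

Lemma cdfR_nondecreasing : nondecreasing F.
Proof. by move=> x y xy; rewrite -lee_fin !cdfRE; exact: cdf_nondecreasing. Qed.

Lemma measurable_cdfR : measurable_fun setT F.
Proof. by apply: nondecreasing_measurable => // x y xy; exact: cdfR_nondecreasing. Qed.

Lemma cvg_cdfR_right x : F z @[z --> x^'+] --> F x.
Proof.
apply: fine_cvg; rewrite cdfRE; exact: cdf_right_continuous.
Qed.

Lemma cdfR_near1 u : u < 1 -> exists x, u <= F x.
Proof.
move=> u1; have cF : F x @[x --> +oo] --> (1 : R) by exact/fine_cvg/cvg_cdfy1.
have : \forall x \near +oo, u < F x by exact: (cvgr_gt 1).
by move=> /pinfty_ex_gt0[x _ ux]; exists x; exact: ltW.
Qed.

Lemma cdfR_near0 u : 0 < u -> exists x, F x < u.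
Proof.
move=> u0; have cF : F x @[x --> -oo] --> (0 : R) by exact/fine_cvg/cvg_cdfNy0.
have : \forall x \near -oo, F x < u by exact: (cvgr_lt 0).
move=> [M [_ H]]; exists (M - 1); apply: H; lra.
Qed.

(** Galois connection of the left-continuous inverse; the infimum is attained because F is
    right-continuous. *)
Lemma quantile_le u x : 0 < u < 1 -> (q u <= x) = (u <= F x).
Proof.
move=> /andP[u0 u1]; rewrite /quantile; set S := [set x | u <= F x].
have [s Ss] : S !=set0 by have [s] := cdfR_near1 u1; exists s.
have lbS : has_lbound S.
  have [z zu] := cdfR_near0 u0; exists z => y Sy; rewrite leNgt; apply/negP => yz.
  by have := le_trans Sy (cdfR_nondecreasing (ltW yz)); rewrite leNgt zu.
apply/idP/idP => [qx|Fx]; last exact: (ge_inf lbS).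
have H y : x < y -> u <= F y.
  move=> xy; have S0 : S !=set0 by exists s.
  have [z Sz zy] := inf_lt S0 (le_lt_trans qx xy).
  exact: le_trans Sz (cdfR_nondecreasing (ltW zy)).
apply: (cvgr_to_ge (@cvg_cdfR_right x)).
by near=> y; apply: H; near: y; exact: nbhs_right_gt.
Unshelve. all: by end_near. Qed.

Lemma quantile_gt u x : 0 < u < 1 -> (x < q u) = (F x < u).
Proof. by move=> u01; rewrite !ltNge quantile_le. Qed.

Lemma quantile_nondecreasing u v : 0 < u -> u <= v -> v < 1 -> q u <= q v.
Proof.
move=> u0 uv v1; have u1 := le_lt_trans uv v1; have v0 := lt_le_trans u0 uv.
rewrite quantile_le ?u0//; apply: le_trans uv _.
by rewrite -quantile_le ?v0.
Qed.

(** Inside (0, 1) by the Galois connection; the infimum is constant below 0 and above 1. *)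
Lemma measurable_quantile : measurable_fun setT q.
Proof.
have -> : [set: R] = `]-oo, 0] `|` (`]0, 1[ `|` ([set 1] `|` `]1, +oo[)).
  apply/seteqP; split => // x _ /=; rewrite !in_itv/= andbT.
  have [x0|x0] := leP x 0; first by left.
  have [x1|x1|x1] := ltgtP x 1; right.
  - by left.
  - by right; right.
  - by right; left.
apply/measurable_funU => //; first by do 2 apply: measurableU => //.
split.
  apply: (eq_measurable_fun (cst (inf [set: R]))) => // u.
  rewrite inE/= in_itv/= => u0; rewrite /quantile; congr inf.
  apply/seteqP; split => // x _ /=; apply: le_trans u0 _.
  by case/andP: (cdfR01 x).
apply/measurable_funU => //; first exact: measurableU.
split.
  apply: (measurability (@RGenOInfty.G R)) => [|/= _ [_] [x] -> <-].
    exact: RGenOInfty.measurableE.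
  rewrite (_ : _ `&` _ = `]0, 1[ `&` `]F x, +oo[); first exact: measurableI.
  apply/seteqP; split => u /=; rewrite !in_itv/= !andbT => -[u01].
    by rewrite quantile_gt.
  by move=> Fu; rewrite quantile_gt.
apply/measurable_funU => //; split; first exact: measurable_fun_set1.
apply: (eq_measurable_fun (cst (inf set0))) => // u.
rewrite inE/= in_itv/= andbT => u1; rewrite /quantile; congr inf.
apply/seteqP; split => // x /=; rewrite leNgt (le_lt_trans _ u1)//.
by case/andP: (cdfR01 x).
Qed.

(** The quantile function on the exponential scale: the function H of the definition of the
    class H^*. *)
Definition Hq y : R := q (uexp y).

Lemma uexp01 y : 0 < y -> 0 < uexp y < 1.
Proof. by move=> y0; rewrite uexp_lt1 andbT -uexp0 uexp_lt. Qed.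

Lemma Hq_gt x y : 0 < y -> (x < Hq y) = (F x < uexp y).
Proof. by move=> y0; rewrite /Hq quantile_gt// uexp01. Qed.

Lemma Hq_nondecreasing x y : 0 < x -> x <= y -> Hq x <= Hq y.
Proof.
move=> x0 xy; rewrite /Hq quantile_nondecreasing ?uexp_lt1//.
  by case/andP: (uexp01 x0).
by rewrite leNgt uexp_lt -leNgt.
Qed.

Lemma measurable_Hq : measurable_fun setT Hq.
Proof. exact: (measurableT_comp measurable_quantile (@measurable_uexp R)). Qed.

Lemma Hq_left_continuous y : 0 < y -> Hq x @[x --> y^'-] --> Hq y.
Proof.
move=> y0; apply/cvgrPdist_lt => e e0.
have : Hq y - e < Hq y by rewrite ltrBlDr ltrDl.
rewrite Hq_gt// => Fy.
have F1 : F (Hq y - e) < 1 by rewrite (lt_trans Fy)// uexp_lt1.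
have Ly : L (F (Hq y - e)) < y by rewrite -uexp_lt uexp_L.
near=> x.
have x0 : 0 < x by near: x; exact: nbhs_left_gt.
have xy : x < y by near: x; exact: nbhs_left_lt.
have Lx : L (F (Hq y - e)) < x by near: x; exact: nbhs_left_gt.
have H1 : Hq x <= Hq y by rewrite Hq_nondecreasing// ltW.
have : Hq y - e < Hq x by rewrite Hq_gt// -(uexp_L F1) uexp_lt.
rewrite ger0_norm ?subr_ge0//; lra.
Unshelve. all: by end_near. Qed.

Lemma quantile_HqL u : 0 < u < 1 -> q u = Hq (L u).
Proof. by move=> /andP[_ u1]; rewrite /Hq uexp_L. Qed.

End quantile.

(** * Expected records *)

Section record_means.
Context (R : realType)
  dX (OmX : measurableType dX) (P : probability OmX R)
  (X : {RV P >-> R})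
  dV (OmV : measurableType dV) (Q : probability OmV R)
  (V : nat -> {RV Q >-> R}).
Local Notation F := (cdfR X).
Local Notation H := (Hq X).
Local Notation leb := (@lebesgue_measure R).
Local Notation rec := (recR X V).
Implicit Types (n : nat) (x y : R).

Lemma measurable_recR n : measurable_fun setT (rec n).
Proof. exact: (measurableT_comp (measurable_quantile X) (measurable_recval V n)). Qed.

HB.instance Definition _ n := isMeasurableFun.Build _ _ _ _ (rec n)
  (measurable_recR n).

(** On [F x < 1], R_n > x means that the underlying gamma variable exceeds [lvl x]. *)
Definition lvl x : R := L (F x).

(** The tail P(R_n > x), see [prob_recR_gt]. *)
Definition rtail n x : R := if F x < 1 then gtail n (lvl x) else 0.

(** The increment P(R_(n+1) > x) - P(R_n > x); for n = 0 it is (1 - F x) L (F x). *)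
Definition rincr n x : R :=
  if F x < 1 then lvl x ^+ n.+1 / n.+1`!%:R * expR (- lvl x) else 0.

Lemma lvl_ge0 x : F x < 1 -> 0 <= lvl x.
Proof. by move=> F1; apply: L_ge0; rewrite F1 andbT; case/andP: (cdfR01 X x). Qed.

Lemma rtailS n x : rtail n.+1 x = rtail n x + rincr n x.
Proof. by rewrite /rtail /rincr; case: ifP => // _; rewrite ?gtailS ?addr0. Qed.

Lemma rincr_ge0 n x : 0 <= rincr n x.
Proof.
rewrite /rincr; case: ifPn => // F1.
by rewrite mulr_ge0 ?expR_ge0// divr_ge0// exprn_ge0// lvl_ge0.
Qed.

Lemma measurable_L : measurable_fun setT (@L R).
Proof.
apply: measurableT_comp => //; apply: measurableT_comp => //.
exact: measurable_funB.
Qed.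

Lemma measurable_lvl : measurable_fun setT lvl.
Proof. exact: (measurableT_comp measurable_L (measurable_cdfR X)). Qed.

Lemma measurable_rincr n : measurable_fun setT (rincr n).
Proof.
apply: measurable_fun_if => //.
- by apply: measurable_fun_ltr => //; exact: measurable_cdfR.
- apply: measurable_funTS; apply: measurable_funM.
    by apply: measurable_funM => //; apply: measurable_funX; exact: measurable_lvl.
  by apply: measurableT_comp => //; apply: measurableT_comp => //; exact: measurable_lvl.
Qed.

Lemma measurable_rtail n : measurable_fun setT (rtail n).
Proof.
apply: measurable_fun_if => //.
- by apply: measurable_fun_ltr => //; exact: measurable_cdfR.
- apply: measurable_funTS; apply: measurable_funM.
    by apply: measurableT_comp => //; apply: measurableT_comp => //; exact: measurable_lvl.
  apply: measurable_sum => k; apply: measurable_funM => //.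
  by apply: measurable_funX; exact: measurable_lvl.
Qed.

Hypothesis hV : iid_uniform V.

Lemma integral_recR n (f : R -> \bar R) :
  measurable_fun setT f -> (forall x, 0 <= f x)%E ->
  (\int[Q]_w f (rec n w) =
   \int[leb]_(y in `]0%R, +oo[) (f (H y) * (y ^+ n / n`!%:R * expR (- y))%:E))%E.
Proof.
move=> mf f0.
rewrite (integral_record hV n (f := f \o quantile X)); last 2 first.
- exact: (measurableT_comp mf (measurable_quantile X)).
- by move=> x; exact: f0.
rewrite [RHS]integral_mkcond; apply: eq_integral => y _; rewrite patchE /gam.
case: ifPn => [y0|y0]; first by rewrite mem_set//= in_itv/= y0.
by rewrite memNset ?mule0//= in_itv/= andbT; exact/negP.
Qed.

Lemma prob_recR_gt n x : Q (rec n @^-1` `]x, +oo[) = (rtail n x)%:E.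
Proof.
rewrite -[X in Q X]setIT -integral_indic//; last exact: measurable_RV_preimage.
transitivity (\int[Q]_w (\1_(`]x, +oo[%classic) (rec n w))%:E)%E.
  by apply: eq_integral => w _; rewrite !indicE.
rewrite (@integral_recR n (fun r => (\1_(`]x, +oo[%classic) r)%:E))//; last by apply/measurable_EFinP; exact: measurable_indic.
rewrite /rtail; case: ifPn => [F1|].
  rewrite -integral_gam_tail ?lvl_ge0// [LHS]integral_mkcond [RHS]integral_mkcond.
  apply: eq_integral => y _; rewrite !patchE.
  have [ly|ly] := ltP (lvl x) y.
    have y0 : 0 < y by rewrite (le_lt_trans _ ly)// lvl_ge0.
    rewrite !mem_set/= ?in_itv/= ?y0 ?ly//.
    rewrite indicE mem_set ?mul1e /gam ?y0//=.
    by rewrite in_itv/= andbT Hq_gt// -(uexp_L F1) uexp_lt.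
  rewrite [in RHS]memNset/=; last by rewrite in_itv/= andbT ltNge ly.
  case: ifPn => //; rewrite inE/= in_itv/= andbT => y0.
  rewrite indicE memNset ?mul0e//= in_itv/= andbT Hq_gt//.
  by rewrite -(uexp_L F1) uexp_lt ltNge ly.
move=> F1; apply: integral0_eq => y; rewrite /= in_itv/= andbT => y0.
rewrite indicE memNset ?mul0e//= in_itv/= andbT Hq_gt// => Fu.
by move: F1; rewrite (lt_trans Fu)// uexp_lt1.
Qed.

Lemma rtail01 n x : 0 <= rtail n x <= 1.
Proof.
rewrite -!lee_fin -prob_recR_gt probability_le1 ?measure_ge0//.
exact: measurable_RV_preimage.
Qed.

Definition mean_pos n : \bar R := (\int[Q]_w (Num.max (rec n w) 0)%:E)%E.
Definition mean_neg n : \bar R := (\int[Q]_w (Num.max (- rec n w) 0)%:E)%E.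

Lemma mean_pos_ge0 n : (0 <= mean_pos n)%E.
Proof. by apply: integral_ge0 => w _; rewrite lee_fin le_max lexx orbT. Qed.

Lemma mean_neg_ge0 n : (0 <= mean_neg n)%E.
Proof. by apply: integral_ge0 => w _; rewrite lee_fin le_max lexx orbT. Qed.

Lemma mean_posE n :
  mean_pos n = (\int[leb]_(x in `[0%R, +oo[) (rtail n x)%:E)%E.
Proof.
have mf : measurable_fun setT (fun w => Num.max (rec n w) 0).
  by apply: measurable_maxr => //; exact: measurable_recR.
pose Z : {RV Q >-> R} := HB.pack (fun w => Num.max (rec n w) 0)
  (isMeasurableFun.Build _ _ _ _ _ mf).
have := @ge0_expectation_ccdf _ _ _ Q Z.
rewrite unlock -[mean_pos n]/(\int[Q]_w (Z w)%:E)%E => -> /=; last first.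
  by move=> w; rewrite le_max lexx orbT.
apply: eq_integral => x; rewrite inE/= in_itv/= andbT => x0.
rewrite -prob_recR_gt; congr (Q _); apply/seteqP; split => w /=.
  by rewrite !in_itv/= !andbT lt_max (ltNge x 0) x0 orbF.
by rewrite !in_itv/= !andbT lt_max => ->.
Qed.

Lemma mean_negE n :
  mean_neg n = (\int[leb]_(x in `]-oo, 0%R[) (1 - rtail n x)%:E)%E.
Proof.
have mf : measurable_fun setT (fun w => Num.min (rec n w) 0).
  by apply: measurable_minr => //; exact: measurable_recR.
pose Z : {RV Q >-> R} := HB.pack (fun w => Num.min (rec n w) 0)
  (isMeasurableFun.Build _ _ _ _ _ mf).
have := @le0_expectation_cdf _ _ _ Q Z.
rewrite unlock => /(_ _)/= E.
rewrite /mean_neg -[LHS]oppeK.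
transitivity (- \int[Q]_w (Num.min (rec n w) 0)%:E)%E.
  congr (- _)%E; rewrite -integral_ge0N.
    apply: eq_integral => w _; rewrite -EFinN; congr EFin.
    by rewrite oppr_max opprK oppr0.
  by move=> w _; rewrite lee_fin le_max lexx orbT.
rewrite E ?oppeK; last by move=> w; rewrite ge_min lexx orbT.
apply: eq_integral => x; rewrite inE/= in_itv/= => x0.
rewrite EFinB -prob_recR_gt -probability_setC; last exact: measurable_RV_preimage.
congr (Q _); apply/seteqP; split => w /=.
  rewrite !in_itv/= andbT ge_min [0 <= x]leNgt x0 orbF => rx.
  by apply/negP; rewrite -leNgt.
by rewrite !in_itv/= andbT ge_min => /negP; rewrite -leNgt => ->.
Qed.

Lemma mean_posS n :
  mean_pos n.+1 = (mean_pos n + \int[leb]_(x in `[0%R, +oo[) (rincr n x)%:E)%E.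
Proof.
rewrite !mean_posE -ge0_integralD//.
- by apply: eq_integral => x _; rewrite rtailS EFinD.
- by move=> x _; rewrite lee_fin; case/andP: (rtail01 n x).
- by apply/measurable_EFinP/measurable_funTS; exact: measurable_rtail.
- by move=> x _; rewrite lee_fin rincr_ge0.
- by apply/measurable_EFinP/measurable_funTS; exact: measurable_rincr.
Qed.

(** The records increase with n, so negative parts decrease; in this form the identity needs no
    finiteness. *)
Lemma mean_negS n :
  mean_neg n = (mean_neg n.+1 + \int[leb]_(x in `]-oo, 0%R[) (rincr n x)%:E)%E.
Proof.
rewrite !mean_negE -ge0_integralD//.
- by apply: eq_integral => x _; rewrite rtailS -EFinD; congr EFin; ring.
- by move=> x _; rewrite lee_fin subr_ge0; case/andP: (rtail01 n.+1 x).
- apply/measurable_EFinP/measurable_funTS; apply: measurable_funB => //.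
  exact: measurable_rtail.
- by move=> x _; rewrite lee_fin rincr_ge0.
- by apply/measurable_EFinP/measurable_funTS; exact: measurable_rincr.
Qed.

Lemma rho_absE n : rho_abs X V n = (mean_pos n + mean_neg n)%E.
Proof.
rewrite /rho_abs unlock -ge0_integralD//.
- apply: eq_integral => w _; rewrite -EFinD; congr EFin.
  by have [r0|r0] := leP 0 (rec n w); [rewrite (max_idPr _) ?oppr_le0// ger0_norm// addr0
    |rewrite ltr0_norm// (max_idPl _) ?add0r// oppr_ge0 ltW].
- by move=> w _; rewrite lee_fin le_max lexx orbT.
- apply/measurable_EFinP; apply: measurable_maxr => //; exact: measurable_recR.
- by move=> w _; rewrite lee_fin le_max lexx orbT.
- apply/measurable_EFinP; apply: measurable_maxr => //.
  by apply: measurableT_comp => //; exact: measurable_recR.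
Qed.

Lemma integral_rincr n :
  (\int[leb]_x (rincr n x)%:E = \int[leb]_(x in `]-oo, 0%R[) (rincr n x)%:E +
    \int[leb]_(x in `[0%R, +oo[) (rincr n x)%:E)%E.
Proof.
rewrite -[X in integral leb X](setUv `]-oo, 0%R[%classic) setCitvl ge0_integral_setU//.
- by rewrite -setCitvl setUv; apply/measurable_EFinP/measurable_funTS; exact: measurable_rincr.
- by move=> x _; rewrite lee_fin rincr_ge0.
- by rewrite -setCitvl; apply/disj_setPS; rewrite setICr.
Qed.

(** Finiteness propagates upwards: the positive part grows by an integral of the increment and
    the negative part shrinks. *)
Lemma rho_abs_ltyS n : (rho_abs X V n < +oo)%E ->
  (\int[leb]_x (rincr n x)%:E < +oo)%E -> (rho_abs X V n.+1 < +oo)%E.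
Proof.
rewrite !rho_absE integral_rincr.
have p0 := mean_pos_ge0; have m0 := mean_neg_ge0.
have i0 D : (0 <= \int[leb]_(x in D) (rincr n x)%:E)%E.
  by apply: integral_ge0 => w _; rewrite lee_fin rincr_ge0.
have lef (a b : \bar R) : (0 <= a -> 0 <= b -> a + b < +oo -> a < +oo /\ b < +oo)%E.
  by move=> a0 b0 ab; split; apply: le_lt_trans ab; rewrite (leeDl, leeDr).
move=> /(lef _ _ (p0 _) (m0 _))[pn mn] /(lef _ _ (i0 _) (i0 _))[_ iP].
rewrite mean_posS; apply: lte_add_pinfty; first exact: lte_add_pinfty.
by apply: le_lt_trans mn; rewrite [leRHS]mean_negS leeDl.
Qed.

Hypothesis finX : forall n, (rho_abs X V n < +oo)%E.

Lemma mean_fin n : mean_pos n \is a fin_num /\ mean_neg n \is a fin_num.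
Proof.
have p0 := mean_pos_ge0; have m0 := mean_neg_ge0.
have := finX n; rewrite rho_absE => f.
by rewrite !ge0_fin_numE//; split; apply: le_lt_trans f; rewrite (leeDl, leeDr).
Qed.

Lemma rhoE n : rho X V n = fine (mean_pos n) - fine (mean_neg n).
Proof.
have [pf mf] := mean_fin n.
rewrite /rho unlock -fineB//; congr fine.
rewrite integralE; congr (_ - _)%E; apply: eq_integral => w _.
  by rewrite funeposE EFin_max.
by rewrite funenegE EFin_max EFinN.
Qed.

(** Layer-cake formulas for the positive and negative parts of R_n, whose tails increase by
    [rincr n] from n to n+1. *)
Lemma rho_diff n : (\int[leb]_x (rincr n x)%:E = (rho X V n.+1 - rho X V n)%:E)%E.
Proof.
have [pf mf] := mean_fin n; have [pf1 mf1] := mean_fin n.+1.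
have := mean_posS n; have := mean_negS n; rewrite !rhoE integral_rincr.
set i := (\int[leb]_(x in `]-oo, 0%R[) (rincr n x)%:E)%E.
set j := (\int[leb]_(x in `[0%R, +oo[) (rincr n x)%:E)%E.
move=> Em Ep.
have i0 : (0 <= i)%E by apply: integral_ge0 => x _; rewrite lee_fin rincr_ge0.
have j0 : (0 <= j)%E by apply: integral_ge0 => x _; rewrite lee_fin rincr_ge0.
have fi : i \is a fin_num.
  have m0 := mean_neg_ge0 n.+1.
  move: mf; rewrite Em !ge0_fin_numE ?(adde_ge0 m0 i0)//.
  by apply: le_lt_trans; rewrite leeDr.
have fj : j \is a fin_num.
  have p0 := mean_pos_ge0 n.
  move: pf1; rewrite Ep !ge0_fin_numE ?(adde_ge0 p0 j0)//.
  by apply: le_lt_trans; rewrite leeDr.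
transitivity ((fine i + fine j)%:E); first by rewrite EFinD !fineK.
have e1 : fine (mean_neg n) = fine (mean_neg n.+1) + fine i.
  by rewrite Em (fineD mf1 fi).
have e2 : fine (mean_pos n.+1) = fine (mean_pos n) + fine j.
  by rewrite Ep (fineD pf fj).
apply: (congr1 EFin); rewrite e1 e2.
by generalize (fine i) (fine j) (fine (mean_pos n)) (fine (mean_neg n.+1)) => a b c e; ring.
Qed.

End record_means.

(** * Power series *)

Section pseries_extra.
Context (R : realType).
Implicit Types (a b c : nat -> R) (K z e : R).

Lemma natmul_pow_le n (x y : R) : 0 <= x -> 0 <= y ->
  n.+1%:R * x ^+ n * y <= (x + y) ^+ n.+1.
Proof.
move=> x0 y0; elim: n => [|n IH].
  by rewrite expr0 mulr1 mul1r expr1 lerDr.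
rewrite [leRHS]exprSr [leRHS]mulrDr.
have H1 : n.+1%:R * x ^+ n * y * x <= (x + y) ^+ n.+1 * x by rewrite ler_wpM2r.
have H2 : x ^+ n.+1 * y <= (x + y) ^+ n.+1 * y.
  by rewrite ler_wpM2r// lerXn2r ?nnegrE ?addr_ge0// lerDl.
apply: le_trans (lerD H1 H2).
by rewrite le_eqVlt -[n.+2%:R]natr1 exprSr; apply/orP; left; apply/eqP; ring.
Qed.

(** Differentiation keeps the radius of convergence: the factor n+1 is absorbed by a slightly
    larger ratio. *)
Lemma is_cvg_pseries_diffs c K z :
  cvgn (pseries c K) -> `|z| < `|K| -> cvgn (pseries (pseries_diffs c) z).
Proof.
move=> cK zK; pose r := (`|z| + `|K|) / 2; pose e := r - `|z|.
have zr : `|z| < r by rewrite midf_lt.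
have rK : r < `|K| by rewrite midf_lt.
have r0 : 0 <= r by rewrite (le_trans _ (ltW zr)).
have e0 : 0 < e by rewrite subr_gt0.
have cr : cvgn (pseries (fun i => `|c i|) r).
  by apply: is_cvg_pseries_inside_norm cK _; rewrite ger0_norm.
apply: normed_cvg.
apply: (@series_le_cvg _ _ (fun n => e^-1 * (`|c n.+1| * r ^+ n.+1))).
- by move=> n /=.
- by move=> n; rewrite mulr_ge0 ?invr_ge0 ?(ltW e0)// mulr_ge0// exprn_ge0.
- move=> n /=; rewrite /pseries_diffs !normrM normrX (ger0_norm (ler0n _ _)).
  rewrite ler_pdivlMl//.
  have := natmul_pow_le n (normr_ge0 z) (ltW e0).
  rewrite [_ + e]addrC subrK => /(ler_wpM2l (normr_ge0 (c n.+1))).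
  by apply: le_trans; rewrite le_eqVlt; apply/orP; left; apply/eqP; ring.
- apply: is_cvg_seriesZ.
  rewrite (_ : series _ = (fun n => pseries (fun i => `|c i|) r n.+1 -
      `|c 0%N| * r ^+ 0)); last first.
    by apply/funext => n; rewrite /pseries /series/= big_nat_recl// addrAC subrr add0r.
  apply: is_cvgB; last exact: is_cvg_cst.
  by move: cr => /cvg_ex[l crl]; apply/cvg_ex; exists l; rewrite cvg_shiftS.
Qed.

Lemma is_derive_pseries c e z :
  (forall t, `|t| < e -> cvgn (pseries c t)) -> `|z| < e ->
  is_derive z 1 (fun x => limn (pseries c x)) (limn (pseries (pseries_diffs c) z)).
Proof.
move=> cc ze; pose K1 := (`|z| + e) / 2.
have zK1 : `|z| < K1 by rewrite midf_lt.
have K1e : K1 < e by rewrite midf_lt.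
pose K2 := (K1 + e) / 2; have K12 : K1 < K2 by rewrite midf_lt.
have K2e : K2 < e by rewrite midf_lt.
pose K3 := (K2 + e) / 2; have K23 : K2 < K3 by rewrite midf_lt.
have K3e : K3 < e by rewrite midf_lt.
have K10 : 0 <= K1 by rewrite (le_trans _ (ltW zK1)).
have K20 : 0 <= K2 by rewrite (le_trans _ (ltW K12)).
have K30 : 0 <= K3 by rewrite (le_trans _ (ltW K23)).
have c3 : cvgn (pseries c K3) by apply: cc; rewrite ger0_norm.
have d2 : cvgn (pseries (pseries_diffs c) K2).
  by apply: is_cvg_pseries_diffs c3 _; rewrite !ger0_norm.
apply: (@pseries_snd_diffs _ c K1).
- by apply: cc; rewrite ger0_norm.
- by apply: is_cvg_pseries_diffs c3 _; rewrite !ger0_norm// (lt_trans K12).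
- by apply: is_cvg_pseries_diffs d2 _; rewrite !ger0_norm.
- by rewrite [ltRHS]ger0_norm.
Qed.

Lemma limn_pseries0 c : limn (pseries c 0) = c 0%N.
Proof.
apply/cvg_lim => //; apply: cvg_near_cst; exists 1%N => // n /= n0.
rewrite /pseries /series/= (big_ltn n0) expr0 mulr1 big_nat_cond big1 ?addr0//.
by move=> i /andP[/andP[i0 _] _]; rewrite expr0n; case: i i0 => //= i _; rewrite mulr0.
Qed.

(** Compare the values at 0, then differentiate: the claim for n+1 is the claim for n on the
    derived series. *)
Lemma pseries_unique a b e : 0 < e ->
  (forall t, `|t| < e -> cvgn (pseries a t)) ->
  (forall t, `|t| < e -> cvgn (pseries b t)) ->
  (forall t, `|t| < e -> limn (pseries a t) = limn (pseries b t)) ->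
  forall n, a n = b n.
Proof.
move=> e0 + + + n; elim: n a b => [|n IH] a b ca cb ab.
  by have := ab 0; rewrite normr0 !limn_pseries0; exact.
have inner c : (forall t, `|t| < e -> cvgn (pseries c t)) ->
    forall t, `|t| < e -> cvgn (pseries (pseries_diffs c) t).
  move=> cc t te; apply: (@is_cvg_pseries_diffs c ((`|t| + e) / 2)).
    by apply: cc; rewrite ger0_norm ?midf_lt// divr_ge0// addr_ge0// ltW.
  by rewrite [ltRHS]ger0_norm ?midf_lt// divr_ge0// addr_ge0// ltW.
have : pseries_diffs a n = pseries_diffs b n.
  apply: IH; [exact: inner|exact: inner|] => t te.
  have da := is_derive_pseries ca te; have db := is_derive_pseries cb te.
  rewrite -(@derive_val _ _ _ _ _ _ _ da) -(@derive_val _ _ _ _ _ _ _ db).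
  apply: near_eq_derive.
  near=> x; apply: ab; near: x.
  exact: (@cvgr_norm_lt _ _ _ _ _ id t).
by rewrite /pseries_diffs => /mulfI; apply; rewrite pnatr_eq0.
Unshelve. all: by end_near. Qed.
End pseries_extra.

Section series_facts.
Context (R : realType).
Implicit Types (u c : nat -> R) (r t : R).

Lemma nneseries_lty_cvg u : (forall n, 0 <= u n) ->
  (\sum_(0 <= n <oo) (u n)%:E < +oo)%E <-> cvgn (series u).
Proof.
move=> u0.
have eE : (fun n => \sum_(0 <= k < n) (u k)%:E)%E = EFin \o series u.
  by apply/funext => n; rewrite /= /series/= -sumEFin.
split=> [fin|cu]; last by rewrite eE EFin_lim// ltry.
apply: nondecreasing_is_cvgn.
  by apply: nondecreasing_series => n _ _; exact: u0.
have tot : (\sum_(0 <= n <oo) (u n)%:E)%E \is a fin_num.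
  by rewrite ge0_fin_numE//; apply: nneseries_ge0 => n _ _; rewrite lee_fin.
exists (fine (\sum_(0 <= n <oo) (u n)%:E)%E) => _ [n _ <-].
rewrite -lee_fin fineK// -[leLHS]/((EFin \o series u) n) -eE.
by apply: nneseries_lim_ge => k _ _; rewrite lee_fin.
Qed.

Lemma is_cvg_pseries_bounded c r M t : (forall n, `|c n| * r ^+ n <= M) ->
  `|t| < r -> cvgn (pseries c t).
Proof.
move=> cM tr; have r0 : 0 < r by rewrite (le_lt_trans _ tr).
apply: normed_cvg.
apply: (@series_le_cvg _ _ (fun n => M * (`|t| / r) ^+ n)).
- by move=> n /=.
- move=> n; rewrite mulr_ge0 ?exprn_ge0 ?divr_ge0 ?(ltW r0)//.
  by apply: le_trans (cM 0%N); rewrite expr0 mulr1.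
- move=> n /=; rewrite normrM normrX expr_div_n mulrA ler_pdivlMr ?exprn_gt0//.
  by rewrite mulrAC ler_wpM2r ?exprn_ge0.
- apply: (@is_cvg_geometric_series R M (`|t| / r)).
  by rewrite ger0_norm ?divr_ge0 ?(ltW r0)// ltr_pdivrMr// mul1r.
Qed.

Lemma integral_expRN r : 0 < r ->
  (\int[lebesgue_measure]_(y in `]0%R, +oo[) (expR (- (r * y)))%:E < +oo)%E.
Proof.
move=> r0; pose G : R -> R := fun y => - r^-1 * expR (- (r * y)).
have dG (y : R) : is_derive y 1 G (expR (- (r * y))).
  have d1 : is_derive y 1 (fun y : R => expR (- (r * y))) (- r * expR (- (r * y))).
    have dl : is_derive y 1 (fun y : R => - (r * y)) (- r).
      rewrite (_ : (fun _ => _) = (- r) *: (@id R)); last first.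
        by apply/funext => x; rewrite /= -mulNr.
      by apply: is_derive_eq; rewrite [LHS]mulr1.
    by apply: (is_derive_eq (is_derive1_comp _ dl)); rewrite mulrC.
  rewrite (_ : G = (- r^-1) *: (fun y : R => expR (- (r * y)))); last by [].
  apply: (is_derive_eq (is_deriveZ _ d1)).
  rewrite [LHS](_ : _ = - r^-1 * (- r * expR (- (r * y))))//.
  by rewrite mulNr mulNr mulrN opprK mulKf// gt_eqF.
have cg (y : R) : {for y, continuous (fun y : R => expR (- (r * y)))}.
  apply: continuous_comp; last exact: continuous_expR.
  by apply: cvgN; apply: cvgMr; exact: cvg_id.
have cv : G y @[y --> +oo] --> (0 : R).
  rewrite -[X in _ --> X](mulr0 (- r^-1)); apply: cvgMr.
  apply: (cvg_comp _ _ _ (@cvgr_expR R)).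
  apply/cvgryPge => A; near=> y.
  rewrite -ler_pdivrMl//; near: y; exact: nbhs_pinfty_ge.
rewrite (integral_derivy dG cg _ cv) ?ltry// => y _; exact: expR_ge0.
Unshelve. all: by end_near. Qed.

End series_facts.

(** * Laws determined by their moment generating functions *)

Section moments.
Context d (Om : measurableType d) (R : realType)
  (P : {finite_measure set Om -> \bar R}) (T : Om -> R).
Hypotheses (mT : measurable_fun setT T) (T0 : forall w, 0 <= T w).
Implicit Types (k n : nat) (u h b : R).

(** Moments after an exponential change of measure by e^(uT). *)
Definition moment k u : R := \int[P]_w (T w ^+ k * expR (u * T w)).

Lemma expR_ge_pow n (x : R) : 0 <= x -> x ^+ n / n`!%:R <= expR x.
Proof.
move=> x0; case: n => [|n].
  by rewrite expr0 fact0 divr1 -[leLHS]expR0 ler_expR.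
by apply: le_trans (expR_ge1Dxn n x0); rewrite lerDr.
Qed.

Lemma measurable_moment_fun k u :
  measurable_fun setT (fun w => T w ^+ k * expR (u * T w)).
Proof.
apply: measurable_funM; first exact: measurable_funX.
by apply: measurableT_comp => //; exact: measurable_funM.
Qed.

(** A power is dominated by an exponential of arbitrarily small rate. *)
Lemma integrable_moment b u k :
  P.-integrable setT (EFin \o (fun w => expR (b * T w))) -> u < b ->
  P.-integrable setT (EFin \o (fun w => T w ^+ k * expR (u * T w))).
Proof.
move=> ib ub; have bu0 : 0 < b - u by rewrite subr_gt0.
pose c := k`!%:R / (b - u) ^+ k.
have c0 : 0 <= c by rewrite divr_ge0// exprn_ge0// ltW.
apply: (@le_integrable _ _ _ _ _ _ _ (fun w => c%:E * (expR (b * T w))%:E)%E) => //.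
- by apply/measurable_EFinP; exact: measurable_moment_fun.
- move=> w _ /=; rewrite lee_fin.
  rewrite [leRHS]ger0_norm ?(mulr_ge0 c0) ?expR_ge0//.
  rewrite ger0_norm ?mulr_ge0 ?expR_ge0 ?exprn_ge0//.
  rewrite (_ : b * T w = (b - u) * T w + u * T w); last by rewrite -mulrDl subrK.
  rewrite expRD mulrA ler_wpM2r ?expR_ge0//.
  have := expR_ge_pow k (mulr_ge0 (ltW bu0) (T0 w)).
  rewrite exprMn ler_pdivrMr ?ltr0n ?fact_gt0// => H.
  rewrite /c mulrAC ler_pdivlMr ?exprn_gt0//.
  by rewrite mulrC [leRHS]mulrC.
- exact: integrableZl.
Qed.

Lemma Rintegral_lincomb n (c : nat -> R) (F : nat -> Om -> R) :
  (forall j, P.-integrable setT (EFin \o F j)) ->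
  \int[P]_w (\sum_(0 <= j < n) c j * F j w) =
  \sum_(0 <= j < n) c j * \int[P]_w F j w.
Proof.
move=> iF; elim: n => [|n IH].
  rewrite big_geq//; under eq_Rintegral do rewrite big_geq//.
  by rewrite Rintegral_cst// mul0r.
rewrite big_nat_recr//= -IH -RintegralZl//.
rewrite -RintegralD//.
- by apply: eq_Rintegral => w _; rewrite big_nat_recr.
- have := @integrable_sum _ _ _ P setT measurableT nat (index_iota 0 n) xpredT
    (fun j w => (c j)%:E * (F j w)%:E)%E.
  move=> /(_ (fun j _ => integrableZl measurableT (c j) (iF j))).
  by apply: eq_integrable => // w _ /=; rewrite -sumEFin.
- exact: (integrableZl measurableT (c n) (iF n)).
Qed.

(** Expand e^(hT) under the integral; dominated convergence with e^((u+|h|)T). *)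
Lemma moment_series b u h k :
  P.-integrable setT (EFin \o (fun w => expR (b * T w))) -> u + `|h| < b ->
  (fun n => \sum_(0 <= j < n) h ^+ j / j`!%:R * moment (k + j) u) @ \oo -->
  moment k (u + h).
Proof.
move=> ib uhb.
have ub : u < b by rewrite (le_lt_trans _ uhb)// lerDl.
pose F j w := T w ^+ (k + j) * expR (u * T w).
have iF j : P.-integrable setT (EFin \o F j) by exact: integrable_moment ib ub.
pose f n w := \sum_(0 <= j < n) h ^+ j / j`!%:R * F j w.
have fE n w : f n w = T w ^+ k * expR (u * T w) * series (exp_coeff (h * T w)) n.
  rewrite /f /series/= mulr_sumr; apply: eq_bigr => j _.
  rewrite exp_coeffE/= /F exprD exprMn; ring.
rewrite (_ : (fun n => _) = (fun n => \int[P]_w f n w)); last first.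
  by apply/funext => n; rewrite Rintegral_lincomb.
have := @dominated_convergence _ _ _ P setT measurableT
  (fun n => EFin \o f n) (EFin \o (fun w => T w ^+ k * expR ((u + h) * T w)))
  (EFin \o (fun w => T w ^+ k * expR ((u + `|h|) * T w))).
case.
- move=> n; apply/measurable_EFinP; apply: measurable_sum => j.
  by apply: measurable_funM => //; exact: measurable_moment_fun.
- by apply/measurable_EFinP; exact: measurable_moment_fun.
- apply: aeW => w _ /=.
  apply: cvg_EFin; first exact: nearW.
  rewrite (_ : _ \o _ = (fun n => T w ^+ k * expR (u * T w) *
    series (exp_coeff (h * T w)) n)); last by apply/funext => n /=; exact: fE.
  rewrite mulrDl expRD mulrA; apply: cvgMr; exact: is_cvg_series_exp_coeff.
- exact: integrable_moment ib uhb.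
- apply: aeW => w n _ /=; rewrite lee_fin fE normrM.
  rewrite mulrDl expRD mulrA ger0_norm ?mulr_ge0 ?expR_ge0 ?exprn_ge0//.
  rewrite ler_wpM2l ?mulr_ge0 ?expR_ge0 ?exprn_ge0//.
  have -> : `|h| * T w = `|h * T w| by rewrite normrM (ger0_norm (T0 w)).
  apply: (@le_trans _ _ (series (exp_coeff `|h * T w|) n)).
    rewrite -normed_series_exp_coeff /series/=; exact: ler_norm_sum.
  apply: nondecreasing_cvgn_le; last exact: is_cvg_series_exp_coeff.
  by apply: nondecreasing_series => j _ _; exact: exp_coeff_ge0.
move=> i1 _ cv; apply: fine_cvg; rewrite /moment fineK//.
exact: integrable_fin_num i1.
Qed.

End moments.

Section tail_polynomials.
Context (R : realType).
Implicit Types (x h c t : R) (N M : nat).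

Lemma bernoulli_ge x M : 0 <= x <= 1 -> 1 - M%:R * x <= (1 - x) ^+ M.
Proof.
move=> /andP[x0 x1]; elim: M => [|M IH]; first by rewrite mul0r subr0 expr0.
rewrite exprS; apply: (@le_trans _ _ ((1 - x) * (1 - M%:R * x))); last first.
  by rewrite ler_wpM2l// subr_ge0.
rewrite -natr1 mulrDl mul1r mulrBl mul1r mulrBr mulr1.
have : 0 <= M%:R * x * x by rewrite !mulr_ge0.
lra.
Qed.

Lemma bernoulli_le x M : 0 <= x <= 1 -> (1 - x) ^+ M * (1 + M%:R * x) <= 1.
Proof.
move=> /andP[x0 x1]; elim: M => [|M IH]; first by rewrite expr0 mul0r addr0 mulr1.
apply: le_trans IH; rewrite exprSr -mulrA ler_wpM2l ?exprn_ge0 ?subr_ge0//.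
rewrite -natr1.
have : 0 <= M%:R * x * x by rewrite !mulr_ge0.
have : 0 <= x * x by rewrite mulr_ge0.
nra.
Qed.

(** At x = e^(-ht) this is (1 - x^N)^M with M close to e^(Nhc). Since M x^N is about
    e^(Nh(c-t)), the value tends to 1 for t > c and to 0 for t < c. *)
Definition tail_poly h c N : {poly R} :=
  (1 - 'X^N) ^+ Num.truncn (expR (N%:R * (h * c))).

Lemma tail_polyE h c N t : (tail_poly h c N).[expR (- (h * t))] =
  (1 - expR (- (N%:R * (h * t)))) ^+ Num.truncn (expR (N%:R * (h * c))).
Proof.
rewrite /tail_poly horner_exp !hornerE -expRM_natl; congr ((1 - expR _) ^+ _).
by rewrite mulrN mulrA.
Qed.

Lemma tail_poly01 h c N t : 0 <= h -> 0 <= t ->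
  0 <= (tail_poly h c N).[expR (- (h * t))] <= 1.
Proof.
move=> h0 t0; rewrite tail_polyE.
have e1 : expR (- (N%:R * (h * t))) <= 1.
  by rewrite -[leRHS]expR0 ler_expR oppr_le0 !mulr_ge0.
by rewrite exprn_ge0 ?subr_ge0//= exprn_ile1 ?subr_ge0// ?lerBlDr ?lerDl ?expR_ge0.
Qed.

Let cvg_expRN (k : R) : 0 < k -> (fun N => expR (- (N%:R * k))) @ \oo --> (0 : R).
Proof.
move=> k0; under eq_fun do rewrite -mulrN expRM_natl.
by apply: cvg_expr; rewrite ger0_norm ?expR_ge0// -[ltRHS]expR0 ltr_expR oppr_lt0.
Qed.

Lemma tail_poly_cvg1 h c t : 0 < h -> 0 <= c -> c < t ->
  (fun N => (tail_poly h c N).[expR (- (h * t))]) @ \oo --> (1 : R).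
Proof.
move=> h0 c0 ct; have t0 : 0 <= t by rewrite (le_trans c0)// ltW.
pose k := h * (t - c); have k0 : 0 < k by rewrite mulr_gt0// subr_gt0.
apply: (@squeeze_cvgr _ _ _ _ (fun N => 1 - expR (- (N%:R * k))) (cst 1)).
- apply: nearW => N; rewrite /cst.
  have /andP[_ ->] := tail_poly01 c N (ltW h0) t0; rewrite andbT tail_polyE.
  apply: le_trans (bernoulli_ge _ _); last first.
    by rewrite expR_ge0/= -[leRHS]expR0 ler_expR oppr_le0 !mulr_ge0// ltW.
  rewrite lerD2l lerN2 /k mulrBr mulrBr opprB [leRHS]expRD.
  by rewrite ler_wpM2r ?expR_ge0// truncn_le ?expR_ge0.
- rewrite -[X in _ --> X]subr0; apply: cvgB; first exact: cvg_cst.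
  exact: cvg_expRN.
- exact: cvg_cst.
Qed.

Lemma tail_poly_cvg0 h c t : 0 < h -> 0 <= t -> t < c ->
  (fun N => (tail_poly h c N).[expR (- (h * t))]) @ \oo --> (0 : R).
Proof.
move=> h0 t0 tc.
pose k := h * (c - t); have k0 : 0 < k by rewrite mulr_gt0// subr_gt0.
apply: (@squeeze_cvgr _ _ _ _ (cst 0) (fun N => expR (- (N%:R * k)))).
- apply: nearW => N; rewrite /cst.
  have /andP[-> _] /= := tail_poly01 c N (ltW h0) t0; rewrite tail_polyE.
  set x := expR (- _); set M := Num.truncn _.
  have x01 : 0 <= x <= 1.
    by rewrite expR_ge0/= -[leRHS]expR0 ler_expR oppr_le0 !mulr_ge0// ltW.
  rewrite expRN -[leRHS]mul1r ler_pdivlMr ?expR_gt0//.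
  apply: le_trans (bernoulli_le M x01).
  apply: ler_wpM2l; first by rewrite exprn_ge0// subr_ge0; case/andP: x01.
  have : expR (N%:R * (h * c)) <= M%:R + 1.
    by rewrite natr1 ltW// truncnS_gt.
  move=> /(ler_wpM2r (expR_ge0 (- (N%:R * (h * t))))); rewrite -/x mulrDl mul1r.
  rewrite /x -expRD -/x => H.
  have -> : N%:R * k = N%:R * (h * c) - N%:R * (h * t) by rewrite /k mulrBr mulrBr.
  case/andP: x01 => _ x1; lra.
- exact: cvg_cst.
- exact: cvg_expRN.
Qed.

End tail_polynomials.

Section one_sided.
Context (R : realType)
  d1 (Om1 : measurableType d1) (P1 : probability Om1 R) (T1 : Om1 -> R)
  d2 (Om2 : measurableType d2) (P2 : probability Om2 R) (T2 : Om2 -> R).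
Hypotheses (mT1 : measurable_fun setT T1) (mT2 : measurable_fun setT T2)
  (T10 : forall w, 0 <= T1 w) (T20 : forall w, 0 <= T2 w).
Variable h : R.
Hypotheses (h0 : 0 < h)
  (polyE : forall p : {poly R}, (\int[P1]_w (p.[expR (- (h * T1 w))])%:E =
                                 \int[P2]_w (p.[expR (- (h * T2 w))])%:E)%E).

Let mpoly d (Om : measurableType d) (T : Om -> R) (p : {poly R}) (D : set Om) :
  measurable_fun setT T ->
  measurable_fun D (fun w => (p.[expR (- (h * T w))])%:E).
Proof.
move=> mT; apply/measurable_EFinP/measurable_funTS.
under eq_fun do rewrite horner_coef.
apply: measurable_sum => i; apply: measurable_funM => //.
apply: measurable_funX; apply: measurableT_comp => //.
by apply: measurableT_comp => //; exact: measurable_funM.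
Qed.

Let mlevel d (Om : measurableType d) (T : Om -> R) (B : set R) :
  measurable_fun setT T -> measurable B -> measurable (T @^-1` B).
Proof. by move=> mT mB; rewrite -[X in measurable X]setTI; exact: mT. Qed.

(** Integrate [tail_poly]: it tends to 1 beyond c and to 0 before c, and on the level t = c it is
    at most 1, which costs the closed half-line on the right. *)
Lemma tail_le_closed c : 0 <= c ->
  (P1 (T1 @^-1` `]c, +oo[) <= P2 (T2 @^-1` `[c, +oo[))%E.
Proof.
move=> c0; pose q := tail_poly h c.
pose D1 := T1 @^-1` `]c, +oo[; pose D2 := T2 @^-1` `[c, +oo[.
pose D3 := T2 @^-1` `]-oo, c[.
have mD1 : measurable D1 by exact: mlevel.
have mD2 : measurable D2 by exact: mlevel.
have mD3 : measurable D3 by exact: mlevel.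
have q01 t N : 0 <= t -> 0 <= (q N).[expR (- (h * t))] <= 1.
  by move=> t0; exact: tail_poly01 (ltW h0) t0.
pose f N : \bar R := (\int[P1]_(w in D1) ((q N).[expR (- (h * T1 w))])%:E)%E.
pose g N : \bar R := (\int[P2]_(w in D3) ((q N).[expR (- (h * T2 w))])%:E)%E.
have iP1 d (Om : measurableType d) (P : probability Om R) (D : set Om) :
    measurable D -> P.-integrable D (EFin \o cst (1 : R)).
  move=> mD; apply: finite_measure_integrable_cst => //.
have fP1 : f @ \oo --> P1 D1.
  rewrite -[X in P1 X](setTI D1) -(integral_indic _ mD1 measurableT).
  have := @dominated_convergence _ _ _ P1 D1 mD1
    (fun N w => ((q N).[expR (- (h * T1 w))])%:E) (fun w => (\1_[set: Om1] w)%:E)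
    (EFin \o cst (1 : R)).
  case => //.
  - by move=> N; exact: mpoly.
  - by apply: measurableT_comp => //; exact: measurable_indic.
  - apply: aeW => w; rewrite /D1/= in_itv/= andbT => ct; rewrite indicT.
    by apply: cvg_EFin; [exact: nearW|exact: tail_poly_cvg1].
  - exact: iP1.
  - apply: aeW => w N _ /=; have /andP[q0 q1] := q01 (T1 w) N (T10 w).
    by rewrite lee_fin ger0_norm.
have g0 : g @ \oo --> 0%E.
  rewrite -(integral0 P2 D3).
  have := @dominated_convergence _ _ _ P2 D3 mD3
    (fun N w => ((q N).[expR (- (h * T2 w))])%:E) (cst 0%E)
    (EFin \o cst (1 : R)).
  case => //.
  - by move=> N; exact: mpoly.
  - apply: aeW => w; rewrite /D3/= in_itv/= => ct.
    by apply: cvg_EFin; [exact: nearW|exact: tail_poly_cvg0].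
  - exact: iP1.
  - apply: aeW => w N _ /=; have /andP[q0 q1] := q01 (T2 w) N (T20 w).
    by rewrite lee_fin ger0_norm.
have fg N : (f N <= P2 D2 + g N)%E.
  apply: (@le_trans _ _ (\int[P1]_w ((q N).[expR (- (h * T1 w))])%:E)%E).
    apply: ge0_subset_integral => //; first exact: mpoly.
    by move=> w _; rewrite lee_fin; case/andP: (q01 (T1 w) N (T10 w)).
  rewrite polyE.
  have -> : [set: Om2] = D2 `|` D3.
    by rewrite /D2 /D3 -preimage_setU -(setCitvl (BLeft c)) setUC setUv preimage_setT.
  rewrite ge0_integral_setU//=; last 3 first.
  - exact: mpoly.
  - by move=> w _; rewrite lee_fin; case/andP: (q01 (T2 w) N (T20 w)).
  - apply/disj_setPLR => w; rewrite /D2 /D3/= !in_itv/= andbT => cw.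
    by apply/negP; rewrite -leNgt.
  rewrite leeD2r// -[X in P2 X](setTI D2) -(integral_indic _ mD2 measurableT).
  apply: ge0_le_integral => //.
  - by move=> w _; rewrite lee_fin; case/andP: (q01 (T2 w) N (T20 w)).
  - exact: mpoly.
  - by apply: measurableT_comp => //; exact: measurable_indic.
  - by move=> w _; rewrite indicT lee_fin; case/andP: (q01 (T2 w) N (T20 w)).
have cv : (fun N => P2 D2 + g N)%E @ \oo --> (P2 D2 + 0)%E.
  apply: cvgeD => //; last exact: cvg_cst.
  by rewrite fin_num_adde_defl.
rewrite -[leRHS]adde0.
by apply: (lee_cvg_to fP1 cv); exact: nearW.
Qed.

End one_sided.

Section law_of_polys.
Context (R : realType)
  d1 (Om1 : measurableType d1) (P1 : probability Om1 R) (T1 : Om1 -> R)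
  d2 (Om2 : measurableType d2) (P2 : probability Om2 R) (T2 : Om2 -> R).

(** Apply the closed version at c + 1/(n+1) and let n grow. *)
Lemma tail_le (h : R) : measurable_fun setT T1 -> measurable_fun setT T2 ->
  (forall w, 0 <= T1 w) -> (forall w, 0 <= T2 w) -> 0 < h ->
  (forall p : {poly R}, (\int[P1]_w (p.[expR (- (h * T1 w))])%:E =
                         \int[P2]_w (p.[expR (- (h * T2 w))])%:E)%E) ->
  forall c, 0 <= c -> (P1 (T1 @^-1` `]c, +oo[) <= P2 (T2 @^-1` `]c, +oo[))%E.
Proof.
move=> mT1 mT2 T10 T20 h0 polyE c c0.
have m1 B : measurable B -> measurable (T1 @^-1` B).
  by move=> mB; rewrite -[X in measurable X]setTI; exact: mT1.
have m2 B : measurable B -> measurable (T2 @^-1` B).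
  by move=> mB; rewrite -[X in measurable X]setTI; exact: mT2.
pose F n := T1 @^-1` `]c + n.+1%:R^-1, +oo[.
have FE : T1 @^-1` `]c, +oo[ = \bigcup_n F n.
  apply/seteqP; split => w /=.
    rewrite in_itv/= andbT -subr_gt0 => cT.
    exists (Num.truncn (T1 w - c)^-1) => //.
    rewrite /F/= in_itv/= andbT -ltrBrDl invf_plt ?posrE//.
    exact: truncnS_gt.
  move=> [n _]; rewrite /F/= !in_itv/= !andbT; apply: le_lt_trans.
  by rewrite lerDl invr_ge0.
have cv : (P1 \o F) @ \oo --> P1 (\bigcup_n F n).
  apply: nondecreasing_cvg_mu.
  - by move=> n; exact: m1.
  - by apply: bigcup_measurable => n _; exact: m1.
  - move=> m n mn; apply/subsetPset => w; rewrite /F/= !in_itv/= !andbT.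
    by apply: le_lt_trans; rewrite lerD2l lef_pV2 ?posrE// ler_nat.
rewrite FE; apply: (cvge_to_le cv); apply: nearW => n /=.
have cn : c < c + n.+1%:R^-1 by rewrite ltrDl invr_gt0.
apply: le_trans (tail_le_closed mT1 mT2 T10 T20 h0 polyE _) _.
  exact: (le_trans c0 (ltW cn)).
apply: le_measure; rewrite ?inE; [exact: m2|exact: m2|].
move=> w /=; rewrite !in_itv/= !andbT; exact: lt_le_trans.
Qed.
End law_of_polys.

Section mgf_uniqueness.
Context (R : realType)
  d1 (Om1 : measurableType d1) (P1 : probability Om1 R) (T1 : Om1 -> R)
  d2 (Om2 : measurableType d2) (P2 : probability Om2 R) (T2 : Om2 -> R).
Hypotheses (mT1 : measurable_fun setT T1) (mT2 : measurable_fun setT T2)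
  (T10 : forall w, 0 <= T1 w) (T20 : forall w, 0 <= T2 w).
Variable b : R.
Hypotheses (b0 : 0 < b)
  (i1 : P1.-integrable setT (EFin \o (fun w => expR (b * T1 w))))
  (i2 : P2.-integrable setT (EFin \o (fun w => expR (b * T2 w)))).

(** The radius of convergence is at least b around every point to the left of 0, so equality of
    all moments propagates by steps of length b/2. *)
Lemma eq_moments_shift : (forall k, moment P1 T1 k 0 = moment P2 T2 k 0) ->
  forall n k, moment P1 T1 k (- (n%:R * (b / 2))) = moment P2 T2 k (- (n%:R * (b / 2))).
Proof.
move=> eq0; elim=> [|n IH] k; first by rewrite mul0r oppr0.
have b20 : 0 < b / 2 by rewrite divr_gt0.
have Hb : - (n%:R * (b / 2)) + `|- (b / 2)| < b.
  rewrite normrN ger0_norm ?(ltW b20)//.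
  have : 0 <= n%:R * (b / 2) by rewrite mulr_ge0// ltW.
  by lra.
have -> : - (n.+1%:R * (b / 2)) = - (n%:R * (b / 2)) + - (b / 2).
  by rewrite -natr1 mulrDl mul1r opprD.
pose f d (Om : measurableType d) (P : probability Om R) (T : Om -> R) :=
  fun m => \sum_(0 <= j < m)
    (- (b / 2)) ^+ j / j`!%:R * moment P T (k + j) (- (n%:R * (b / 2))).
have c1 : f _ _ P1 T1 @ \oo --> _ := @moment_series _ _ _ P1 T1 mT1 T10 _ _ _ k i1 Hb.
have c2 : f _ _ P2 T2 @ \oo --> _ := @moment_series _ _ _ P2 T2 mT2 T20 _ _ _ k i2 Hb.
have E : f _ _ P1 T1 = f _ _ P2 T2.
  by apply/funext => m; apply: eq_bigr => j _; rewrite IH.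
by move: c1; rewrite E => c1; exact: (cvg_unique _ c1 c2).
Qed.

Lemma integral_exp_poly d (Om : measurableType d) (P : probability Om R)
    (T : Om -> R) (h : R) (p : {poly R}) :
  measurable_fun setT T -> (forall w, 0 <= T w) ->
  P.-integrable setT (EFin \o (fun w => expR (b * T w))) -> 0 <= h ->
  (\int[P]_w (p.[expR (- (h * T w))])%:E =
   (\sum_(0 <= i < size p) p`_i * moment P T 0 (- (i%:R * h)))%:E)%E.
Proof.
move=> mT T0 iT h0.
pose F i w := T w ^+ 0 * expR (- (i%:R * h) * T w).
have iF i : P.-integrable setT (EFin \o F i).
  apply: (@integrable_moment _ _ _ P T mT T0 b _ 0 iT).
  by rewrite (le_lt_trans _ b0)// oppr_le0 mulr_ge0.
rewrite -Rintegral_lincomb//.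
have ip : P.-integrable setT (fun w => (p.[expR (- (h * T w))])%:E).
  have := @integrable_sum _ _ _ P setT measurableT nat (index_iota 0 (size p)) xpredT
    (fun j w => (p`_j)%:E * (F j w)%:E)%E.
  move=> /(_ (fun j _ => integrableZl measurableT p`_j (iF j))).
  apply: eq_integrable => // w _ /=; rewrite sumEFin horner_coef big_mkord.
  congr EFin; apply: eq_bigr => i _; rewrite /F expr0 mul1r -expRM_natl.
  by congr (_ * expR _); ring.
have hE w : p.[expR (- (h * T w))] = \sum_(0 <= i < size p) p`_i * F i w.
  rewrite horner_coef big_mkord; apply: eq_bigr => i _.
  by rewrite /F expr0 mul1r -expRM_natl; congr (_ * expR _); ring.
rewrite /Rintegral fineK; first by apply: eq_integral => w _; rewrite hE.
apply: integrable_fin_num => //; apply: eq_integrable ip => // w _.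
by rewrite hE.
Qed.

(** Equal shifted moments give equal expectations of polynomials in e^(-bT/2), hence equal tails. *)
Lemma eq_law_of_moments : (forall k, moment P1 T1 k 0 = moment P2 T2 k 0) ->
  forall A, measurable A -> P1 (T1 @^-1` A) = P2 (T2 @^-1` A).
Proof.
move=> eq0.
have b20 : 0 < b / 2 by rewrite divr_gt0.
have pE (p : {poly R}) : (\int[P1]_w (p.[expR (- (b / 2 * T1 w))])%:E =
                         \int[P2]_w (p.[expR (- (b / 2 * T2 w))])%:E)%E.
  rewrite !integral_exp_poly ?(ltW b20)//; congr EFin.
  by apply: eq_bigr => i _; rewrite eq_moments_shift.
pose m1' : {measure set R -> \bar R} := pushforward P1 T1.
pose m2' : {measure set R -> \bar R} := pushforward P2 T2.
pose m1 := m1' mT1; pose m2 := m2' mT2.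
move=> A mA; rewrite -[LHS]/(m1 A) -[RHS]/(m2 A).
apply: eq_measure_tails => //.
  by rewrite /m1 /m1' /= /pushforward preimage_setT probability_setT ltry.
move=> x; rewrite /m1 /m2 /m1' /m2' /= /pushforward.
have [x0|x0] := leP 0 x.
  apply/eqP; rewrite eq_le; apply/andP; split; apply: (tail_le _ _ _ _ b20) => //.
have full d (Om : measurableType d) (T : Om -> R) : (forall w, 0 <= T w) ->
    T @^-1` `]x, +oo[ = setT.
  move=> T0; apply/seteqP; split => // w _ /=.
  by rewrite in_itv/= andbT (lt_le_trans x0).
by rewrite !full// !probability_setT.
Qed.

Lemma eq_moments_of_mgf :
  (forall t, `|t| < b -> moment P1 T1 0 t = moment P2 T2 0 t) ->
  forall k, moment P1 T1 k 0 = moment P2 T2 k 0.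
Proof.
move=> eqM k.
have ser d (Om : measurableType d) (P : probability Om R) (T : Om -> R) t :
    measurable_fun setT T -> (forall w, 0 <= T w) ->
    P.-integrable setT (EFin \o (fun w => expR (b * T w))) -> `|t| < b ->
    pseries (fun j => moment P T j 0 / j`!%:R) t @ \oo --> moment P T 0 t.
  move=> mT T0 iT tb.
  have := @moment_series _ _ _ P T mT T0 b 0 t 0 iT; rewrite !add0r => /(_ tb).
  rewrite (_ : pseries _ t = (fun n => \sum_(0 <= j < n)
    t ^+ j / j`!%:R * moment P T (0 + j) 0))//; apply/funext => n.
  by apply: eq_bigr => j _ /=; rewrite add0n [LHS]mulrC -[RHS]mulrA [X in _ = _ * X]mulrC.
have := @pseries_unique R (fun j => moment P1 T1 j 0 / j`!%:R)
  (fun j => moment P2 T2 j 0 / j`!%:R) b b0.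
move=> /(_ _ _ _ k) => /(_ _ _ _)/mulIf; apply.
- by rewrite invr_eq0 pnatr_eq0 -lt0n fact_gt0.
- by move=> t tb; apply/cvg_ex; eexists; apply: ser tb.
- by move=> t tb; apply/cvg_ex; eexists; apply: ser tb.
- move=> t tb; have c1 := ser _ _ P1 T1 t mT1 T10 i1 tb.
  have c2 := ser _ _ P2 T2 t mT2 T20 i2 tb.
  by rewrite (cvg_lim (@Rhausdorff R) c1) (cvg_lim (@Rhausdorff R) c2) eqM.
Qed.

End mgf_uniqueness.

Section law_of_mgf.
Context (R : realType)
  d1 (Om1 : measurableType d1) (P1 : probability Om1 R) (T1 : {RV P1 >-> R})
  d2 (Om2 : measurableType d2) (P2 : probability Om2 R) (T2 : {RV P2 >-> R}).

Lemma integral_gt0_norm d (Om : measurableType d) (P : probability Om R)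
    (T : {RV P >-> R}) (f : R -> \bar R) :
  P [set w | 0 < T w] = 1%E -> measurable_fun setT f -> (forall x, 0 <= f x)%E ->
  (\int[P]_w f (T w) = \int[P]_w f `|T w|%R)%E.
Proof.
move=> PT mf f0; have mT : measurable_fun setT T by exact: measurable_funP.
have mpos : measurable [set w | 0 < T w].
  by have := measurable_RV_preimage T (measurable_itv `]0, +oo[);
    congr measurable; apply/seteqP; split => w /=; rewrite in_itv/= andbT.
apply: ge0_ae_eq_integral => //.
- exact: (measurableT_comp mf mT).
- by apply: (measurableT_comp mf); exact: measurableT_comp.
- exists (~` [set w | 0 < T w]); split => //.
  + exact: measurableC.
  + by apply: (etrans (probability_setC P mpos)); rewrite PT subee.
  + by apply: subsetC => w /= w0 _; rewrite gtr0_norm.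
Qed.

Lemma mgf_abs d (Om : measurableType d) (P : probability Om R) (T : {RV P >-> R}) t :
  P [set w | 0 < T w] = 1%E ->
  'M_P T t = (\int[P]_w (expR (t * `|T w|))%:E)%E.
Proof.
move=> PT; rewrite /mmt_gen_fun unlock.
rewrite -(integral_gt0_norm (f := fun x => (expR (t * x))%:E))//.
- by apply: eq_integral => w _ /=; rewrite mulrC.
- by apply/measurable_EFinP; apply: measurableT_comp => //; exact: measurable_funM.
Qed.

(** Almost sure positivity allows T to be replaced by its absolute value, which is nonnegative
    everywhere. *)
Theorem same_law_of_mgf e : 0 < e ->
  P1 [set w | 0 < T1 w] = 1%E -> P2 [set w | 0 < T2 w] = 1%E ->
  (forall t, `|t| < e -> ('M_P1 T1 t < +oo)%E) ->
  (forall t, `|t| < e -> 'M_P1 T1 t = 'M_P2 T2 t) ->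
  same_law P1 P2 T1 T2.
Proof.
move=> e0 P1T P2T fin eqM.
pose S1 : Om1 -> R := fun w => `|T1 w|; pose S2 : Om2 -> R := fun w => `|T2 w|.
have mS1 : measurable_fun setT S1 by exact: measurableT_comp.
have mS2 : measurable_fun setT S2 by exact: measurableT_comp.
have S10 w : 0 <= S1 w by exact: normr_ge0.
have S20 w : 0 <= S2 w by exact: normr_ge0.
pose b := e / 2; have b0 : 0 < b by rewrite divr_gt0.
have be : b < e by rewrite ltr_pdivrMr// ltr_pMr// ltr1n.
have integ d (Om : measurableType d) (P : probability Om R) (T : {RV P >-> R}) :
    P [set w | 0 < T w] = 1%E -> ('M_P T b < +oo)%E ->
    P.-integrable setT (EFin \o (fun w => expR (b * `|T w|))).
  move=> PT MT; apply/integrableP; split.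
    apply/measurable_EFinP; apply: measurableT_comp => //.
    by apply: measurable_funM => //; exact: measurableT_comp.
  move: MT; rewrite mgf_abs//; congr (_ < _)%E; apply: eq_integral => w _.
  by apply/esym; rewrite gee0_abs// lee_fin expR_ge0.
have bb : `|b| < e by rewrite gtr0_norm.
have i1 := integ _ _ _ T1 P1T (fin _ bb).
have i2 : P2.-integrable setT (EFin \o (fun w => expR (b * `|T2 w|))).
  by apply: integ => //; rewrite -eqM// fin.
have eqmom : forall k, moment P1 S1 k 0 = moment P2 S2 k 0.
  apply: (eq_moments_of_mgf mS1 mS2 S10 S20 b0 i1 i2) => t tb.
  have te := lt_trans tb be.
  rewrite /moment /Rintegral; have := eqM t te; rewrite !mgf_abs// => eqt.
  under [in LHS]eq_integral do rewrite expr0 mul1r.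
  under [in RHS]eq_integral do rewrite expr0 mul1r.
  by rewrite eqt.
have eqS := eq_law_of_moments mS1 mS2 S10 S20 b0 i1 i2 eqmom.
have abs d (Om : measurableType d) (P : probability Om R) (T : {RV P >-> R}) A :
    P [set w | 0 < T w] = 1%E -> measurable A ->
    P (T @^-1` A) = P ((fun w => `|T w|) @^-1` A).
  move=> PT mA; have mTA : measurable (T @^-1` A) by exact: measurable_RV_preimage.
  have mSA : measurable ((fun w => `|T w|) @^-1` A).
    by rewrite -[X in measurable X]setTI; apply: measurableT_comp.
  rewrite -[X in P X = _]setIT -[X in _ = P X]setIT -!integral_indic//.
  apply: (integral_gt0_norm (f := fun x => (\1_A x : R)%:E)) => //.
  by apply/measurable_EFinP; exact: measurable_indic.
by move=> A mA; rewrite abs// eqS// -abs.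
Qed.
End law_of_mgf.

(** * The law phi(X) *)

Lemma expR_nneseries (R : realType) (x : R) : 0 <= x ->
  (\sum_(0 <= n <oo) (x ^+ n / n`!%:R)%:E = (expR x)%:E)%E.
Proof.
move=> x0; transitivity (limn (EFin \o series (exp_coeff x))).
  apply: congr_lim; apply/funext => n /=; rewrite /series/= -sumEFin.
  by apply: eq_bigr => k _; rewrite exp_coeffE mulrC.
by rewrite EFin_lim//; exact: is_cvg_series_exp_coeff.
Qed.

Section phi_law.
Context (R : realType)
  dX (OmX : measurableType dX) (P : probability OmX R)
  (X : {RV P >-> R})
  dV (OmV : measurableType dV) (Q : probability OmV R)
  (V : nat -> {RV Q >-> R}).
Hypothesis hV : iid_uniform V.
Local Notation F := (cdfR X).
Local Notation leb := (@lebesgue_measure R).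
Implicit Types (n : nat) (x y : R).

Lemma lvl_full_ge0 x : 0 <= lvl X x.
Proof.
have [F1|F1] := ltP (F x) 1; first exact: lvl_ge0.
have -> : lvl X x = 0; last by [].
have /andP[_ F1'] := cdfR01 X x.
have FE : F x = 1 by apply/eqP; rewrite eq_le F1 F1'.
by rewrite /lvl FE /L subrr ln0 ?oppr0.
Qed.

Lemma phi_weightE x : phi_weight X x = rincr X 0 x.
Proof.
rewrite /phi_weight /rincr -/(lvl X x); case: ifPn => [F1|F1].
  rewrite expr1 divr1 mulrC; congr (_ * _).
  by rewrite -[X in 1 - X](uexp_L F1) /uexp subKr.
have /andP[_ F1'] := cdfR01 X x.
have -> : F x = 1 by apply/eqP; rewrite eq_le F1' leNgt F1.
by rewrite subrr mul0r.
Qed.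

Lemma rincr_lvl n x : lvl X x ^+ n * rincr X 0 x = n.+1`!%:R * rincr X n x.
Proof.
rewrite /rincr; case: ifP => _; rewrite ?mulr0// expr1 divr1 exprSr.
have f0 : n.+1`!%:R != 0 :> R by rewrite pnatr_eq0 -lt0n fact_gt0.
by rewrite [RHS]mulrA [n.+1`!%:R * _]mulrC divfK// mulrA.
Qed.

Hypothesis finX : forall n, (rho_abs X V n < +oo)%E.
Local Notation D := (rho X V 1 - rho X V 0).

Lemma rho_nondecreasing n : rho X V n <= rho X V n.+1.
Proof.
rewrite -subr_ge0 -lee_fin -(rho_diff hV finX).
by apply: integral_ge0 => x _; rewrite lee_fin rincr_ge0.
Qed.

Lemma phi_densityE x : phi_density X x = rincr X 0 x / D.
Proof.
rewrite /phi_density phi_weightE; congr (_ / _).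
transitivity (fine (\int[leb]_x (rincr X 0 x)%:E)%E); last by rewrite (rho_diff hV finX).
by congr fine; apply: eq_integral => y _; rewrite phi_weightE.
Qed.

Hypothesis D0 : 0 < D.

Lemma phi_density_ge0 x : 0 <= phi_density X x.
Proof. by rewrite phi_densityE divr_ge0 ?rincr_ge0// ltW. Qed.

Lemma measurable_phi_density : measurable_fun setT (phi_density X).
Proof.
rewrite (_ : phi_density X = fun x => rincr X 0 x / D); last first.
  by apply/funext => x; exact: phi_densityE.
by apply: measurable_funM => //; exact: measurable_rincr.
Qed.

Context dT (OmT : measurableType dT) (PT : probability OmT R)
  (T : {RV PT >-> R}).
Hypothesis hT : is_phi X T.

(** Integrals against the law of phi(X), with the density written through [rincr 0]. *)
Lemma integral_phi (k : R -> \bar R) :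
  measurable_fun setT k -> (forall x, 0 <= k x)%E ->
  (\int[PT]_w k (T w) = \int[leb]_x (k (lvl X x) * (rincr X 0 x / D)%:E))%E.
Proof.
move=> mk k0; have mlvl := measurable_lvl X.
have [dW [OmW [PW [W [lawW lawT]]]]] := hT.
pose g : {measure set _ -> \bar R} := mdens leb measurable_phi_density phi_density_ge0.
pose p' : {measure set R -> \bar R} := pushforward g (lvl X).
pose p := p' mlvl.
have E A : measurable A -> distribution PT T A = p A.
  move=> mA; rewrite [LHS](lawT A mA) /p /p' /= /pushforward /g/= /mdens.
  have mlA : measurable (lvl X @^-1` A).
    by have := mlvl measurableT A mA; rewrite setTI.
  by rewrite -(lawW _ mlA).
transitivity (\int[distribution PT T]_x k x)%E.
  by rewrite ge0_integral_distribution.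
rewrite (eq_measure_integral p); last by move=> A mA _; exact: E.
rewrite ge0_integral_pushforward//.
have mkl : measurable_fun setT (k \o lvl X) by exact: (measurableT_comp mk mlvl).
rewrite preimage_setT ge0_integral_mdens//; last by move=> y; exact: k0.
by apply: eq_integral => x _; rewrite phi_densityE.
Qed.

(** Since lvl^n rincr 0 = (n+1)! rincr n, the moments of phi(X) are the increments of the
    expected records. *)
Lemma moment_phi n :
  (\int[PT]_w (`|T w| ^+ n)%:E =
   (n.+1`!%:R * (rho X V n.+1 - rho X V n) / D)%:E)%E.
Proof.
rewrite (@integral_phi (fun y => (`|y| ^+ n)%:E)); last 2 first.
- by apply/measurable_EFinP; apply: measurable_funX; exact: normr_measurable.
- by move=> x; rewrite lee_fin.
transitivity (\int[leb]_x ((n.+1`!%:R / D)%:E * (rincr X n x)%:E))%E.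
  apply: eq_integral => x _; rewrite -!EFinM; congr EFin.
  by rewrite ger0_norm ?lvl_full_ge0// mulrA rincr_lvl mulrAC.
rewrite ge0_integralZl//.
- by rewrite (rho_diff hV finX) -EFinM; congr EFin; rewrite mulrAC.
- by apply/measurable_EFinP; exact: measurable_rincr.
- by move=> x _; rewrite lee_fin rincr_ge0.
- by rewrite lee_fin divr_ge0// ltW.
Qed.

(** The density vanishes where the level does. *)
Lemma phi_gt0 : PT [set w | 0 < T w] = 1%E.
Proof.
pose I0 : set R := `]0%R, +oo[%classic.
have mI0 : measurable I0 by exact: measurable_itv.
have mI : measurable_fun setT (fun y : R => (\1_I0 y : R)%:E).
  by apply/measurable_EFinP; exact: measurable_indic.
transitivity (\int[PT]_w (\1_I0 (T w) : R)%:E)%E.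
  rewrite (_ : [set w | 0 < T w] = T @^-1` I0); last first.
    by apply/seteqP; split => w; rewrite /I0/= in_itv/= andbT.
  rewrite -[X in PT X]setIT -integral_indic//; last exact: measurable_RV_preimage.
rewrite (@integral_phi (fun y => (\1_I0 y : R)%:E))//.
transitivity (\int[leb]_x ((D^-1)%:E * (rincr X 0 x)%:E))%E.
  apply: eq_integral => x _; rewrite -!EFinM; congr EFin.
  rewrite indicE.
  have := lvl_full_ge0 x; rewrite le_eqVlt => /orP[/eqP l0|l0].
    by rewrite /rincr -l0; case: ifP => _; rewrite ?expr1 ?mul0r ?mulr0.
  by rewrite mem_set ?mul1r 1?mulrC// /I0/= in_itv/= l0.
rewrite ge0_integralZl//.
- by rewrite (rho_diff hV finX) -EFinM mulVf// gt_eqF.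
- by apply/measurable_EFinP; exact: measurable_rincr.
- by move=> x _; rewrite lee_fin rincr_ge0.
- by rewrite lee_fin invr_ge0 ltW.
Qed.

(** For a nonnegative argument the exponential series has nonnegative terms, so this holds even
    when both sides are infinite. *)
Lemma mgf_phi a : 0 <= a -> 'M_PT T a =
  (\sum_(0 <= n <oo) (n.+1%:R * (rho X V n.+1 - rho X V n) * a ^+ n / D)%:E)%E.
Proof.
move=> a0; rewrite mgf_abs; last exact: phi_gt0.
transitivity (\int[PT]_w (\sum_(0 <= n <oo) ((a ^+ n / n`!%:R)%:E * (`|T w| ^+ n)%:E)))%E.
  apply: eq_integral => w _; rewrite -expR_nneseries ?mulr_ge0//.
  apply: eq_eseriesr => n _; rewrite -EFinM exprMn; congr EFin; ring.
have mT : measurable_fun setT (fun w => `|T w|) by exact: measurableT_comp.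
rewrite integral_nneseries//; last 2 first.
- move=> n; apply/measurable_EFinP; apply: measurable_funM => //.
  exact: measurable_funX.
- by move=> n w _; rewrite lee_fin !mulr_ge0// ?invr_ge0 exprn_ge0.
apply: eq_eseriesr => n _; rewrite ge0_integralZl//; last 2 first.
- by apply/measurable_EFinP; exact: measurable_funX.
- by rewrite lee_fin divr_ge0// exprn_ge0.
rewrite moment_phi -EFinM; congr EFin; rewrite factS natrM.
have f0 : n`!%:R != 0 :> R by rewrite pnatr_eq0 -lt0n fact_gt0.
rewrite [n.+1%:R * n`!%:R]mulrC -!mulrA mulKf// mulrCA; congr (_ * _).
by rewrite mulrCA.
Qed.

End phi_law.

Section level_slices.
Context (R : realType)
  dX (OmX : measurableType dX) (P : probability OmX R)
  (X : {RV P >-> R}).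
Local Notation F := (cdfR X).
Local Notation H := (Hq X).
Local Notation leb := (@lebesgue_measure R).
Implicit Types (n : nat) (x y z : R).

(** The Galois connection for both end points. *)
Lemma lvl_slice a b z : 0 < a -> 0 < b ->
  (H a <= z < H b) = (F z < 1) && (a <= lvl X z < b).
Proof.
move=> a0 b0; rewrite leNgt !Hq_gt//.
have [F1|F1] := ltP (F z) 1; last first.
  by rewrite [F z < uexp b]ltNge (le_trans (ltW (uexp_lt1 b)) F1)//= andbF.
by rewrite -(uexp_L F1) !uexp_lt -leNgt.
Qed.

(** A lower bound that makes the increment positive on a nondegenerate slice. *)
Lemma rincr_slice_ge a b z : 0 < a -> 0 < b -> H a <= z < H b ->
  a * expR (- b) <= rincr X 0 z.
Proof.
move=> a0 b0; rewrite lvl_slice// => /andP[F1 /andP[az zb]].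
rewrite /rincr F1 expr1 divr1 ler_pM ?expR_ge0 ?(ltW a0)//.
by rewrite ler_expR lerN2 ltW.
Qed.

Lemma integral_rincr_gt0 a b : 0 < a -> 0 < b -> H a < H b ->
  (0 < \int[leb]_x (rincr X 0 x)%:E)%E.
Proof.
move=> a0 b0 ab; pose S : set R := `[H a, H b[%classic.
have mS : measurable S by exact: measurable_itv.
have m0 : measurable_fun setT (fun x => (rincr X 0 x)%:E).
  by apply/measurable_EFinP; exact: measurable_rincr.
apply: (@lt_le_trans _ _ (\int[leb]_(x in S) (a * expR (- b))%:E)%E).
  have lS : leb S = (H b - H a)%:E by rewrite /S lebesgue_measure_itv/= lte_fin ab EFinB.
  rewrite integral_cst//= lS -EFinM lte_fin.
  by rewrite !mulr_gt0 ?expR_gt0// subr_gt0.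
apply: (@le_trans _ _ (\int[leb]_(x in S) (rincr X 0 x)%:E)%E).
  apply: ge0_le_integral => //.
  - by move=> x _; rewrite lee_fin mulr_ge0 ?expR_ge0// ltW.
  - exact: measurable_funTS.
  - by move=> x; rewrite /S/= in_itv/= => xS; rewrite lee_fin (rincr_slice_ge _ b0).
apply: ge0_subset_integral => //.
by move=> x _; rewrite lee_fin rincr_ge0.
Qed.

Lemma in_HstarE H1 : (forall u, 0 < u < 1 -> quantile X u = H1 (L u)) ->
  forall y, 0 < y -> H y = H1 y.
Proof. by move=> E y y0; rewrite /Hq E ?uexp01// L_uexp. Qed.

Context dV (OmV : measurableType dV) (Q : probability OmV R)
  (V : nat -> {RV Q >-> R}).
Hypothesis hV : iid_uniform V.

Lemma rho_abs_integral n : rho_abs X V n =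
  ((n`!%:R^-1)%:E * \int[leb]_(y in `]0%R, +oo[) (y ^+ n * expR (- y) * `|H y|)%:E)%E.
Proof.
rewrite /rho_abs unlock (integral_recR X hV n (f := fun r => `|r|%:E))//; last first.
  by apply/measurable_EFinP; exact: normr_measurable.
have f0 : 0 < n`!%:R^-1 :> R by rewrite invr_gt0 ltr0n fact_gt0.
have mg : measurable_fun setT (fun y => (y ^+ n * expR (- y) * `|H y|)%:E).
  apply/measurable_EFinP.
  apply: measurable_funM; last exact: (measurableT_comp (@normr_measurable _ _) (measurable_Hq X)).
  apply: measurable_funM => //.
  by apply: measurableT_comp => //; apply: measurableT_comp.
rewrite -ge0_integralZl//.
- by apply: eq_integral => y _; rewrite -!EFinM; congr EFin; ring.
- exact: measurable_funTS.
- move=> y; rewrite /= in_itv/= andbT => y0.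
  by rewrite lee_fin !mulr_ge0 ?expR_ge0// exprn_ge0// ltW.
Qed.

Lemma rho_abs_lty n : (rho_abs X V n < +oo)%E <->
  (\int[leb]_(y in `]0%R, +oo[) (y ^+ n * expR (- y) * `|H y|)%:E < +oo)%E.
Proof.
have f0 : n`!%:R != 0 :> R by rewrite pnatr_eq0 -lt0n fact_gt0.
split=> fin; last by rewrite rho_abs_integral; apply: lte_mul_pinfty.
rewrite [ltLHS](_ : _ = (n`!%:R)%:E * rho_abs X V n)%E; first exact: lte_mul_pinfty.
by rewrite rho_abs_integral muleA -EFinM mulfV// mul1e.
Qed.

Hypothesis hX : in_Hstar X.

Lemma Hstar_nonconst : exists a b, [/\ 0 < a, 0 < b & H a < H b].
Proof.
have [H1 [[x [y [x0 y0 xy]]] H1nd _ _] E] := hX.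
have HE := in_HstarE E.
have : H x != H y by rewrite !HE.
by rewrite neq_lt => /orP[?|?]; [exists x, y|exists y, x].
Qed.

Lemma Hstar_rho_abs n : (rho_abs X V n < +oo)%E.
Proof.
have [H1 [_ _ _ H1fin] E] := hX.
apply/rho_abs_lty; rewrite (_ : integral _ _ _ =
  \int[leb]_(y in `]0%R, +oo[) (y ^+ n * expR (- y) * `|H1 y|)%:E)%E//.
by apply: eq_integral => y; rewrite inE/= in_itv/= andbT => y0; rewrite (in_HstarE E).
Qed.

(** A non-constant H jumps over some interval, on which the increment is bounded below. *)
Lemma Hstar_rho_diff_gt0 : 0 < rho X V 1 - rho X V 0.
Proof.
have [a [b [a0 b0 ab]]] := Hstar_nonconst.
rewrite -lte_fin -(rho_diff hV Hstar_rho_abs).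
exact: integral_rincr_gt0 ab.
Qed.

End level_slices.

(** * Generating functions of the records *)

Section record_generating_functions.
Context (R : realType)
  dX (OmX : measurableType dX) (P : probability OmX R)
  (X : {RV P >-> R})
  dV (OmV : measurableType dV) (Q : probability OmV R)
  (V : nat -> {RV Q >-> R}).
Hypothesis hV : iid_uniform V.
Local Notation F := (cdfR X).
Local Notation H := (Hq X).
Local Notation leb := (@lebesgue_measure R).
Implicit Types (n : nat) (x y z t : R).

Lemma RV_tail x : distribution P X `]x, +oo[%classic = (1 - F x)%:E.
Proof.
have := cdf_ccdf_1 X x; rewrite -cdfRE /ccdf => E.
by rewrite EFinB -E addeAC subee ?add0e.
Qed.

(** The first record is the first observation, so X has the law of R_0. *)
Lemma integral_quantile (f : R -> \bar R) :
  measurable_fun setT f -> (forall x, 0 <= f x)%E ->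
  (\int[P]_w f (X w) = \int[leb]_(y in `]0%R, +oo[) (f (H y) * (expR (- y))%:E))%E.
Proof.
move=> mf f0; have mr := measurable_recR X V 0.
pose Z : {RV Q >-> R} := HB.pack (recR X V 0) (isMeasurableFun.Build _ _ _ _ _ mr).
transitivity (\int[Q]_w f (Z w))%E; last first.
  rewrite (integral_recR X hV 0)//; apply: eq_integral => y _.
  by rewrite expr0 fact0 divr1 mul1r.
transitivity (\int[distribution P X]_x f x)%E.
  by rewrite ge0_integral_distribution.
transitivity (\int[distribution Q Z]_x f x)%E; last first.
  by rewrite ge0_integral_distribution.
apply: eq_measure_integral => A mA _.
apply: (@eq_measure_tails R (distribution P X) (distribution Q Z)) => //.
  by rewrite ltey_eq fin_num_measure.
move=> x; rewrite [RHS](prob_recR_gt X hV 0 x) [LHS]RV_tail /rtail /gtail.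
case: ifPn => [F1|F1].
  rewrite big_ord_recl big_ord0 expr0 fact0 divr1 addr0 mulr1.
  by rewrite -[X in 1 - X](uexp_L F1) /uexp subKr.
have /andP[_ F1'] := cdfR01 X x.
by have -> : F x = 1 by [apply/eqP; rewrite eq_le F1' leNgt F1]; rewrite subrr.
Qed.

(** Summing t^n y^n/n! under the integral replaces e^-y by e^(-(1-t)y). *)
Lemma G_wE t : 0 <= t ->
  G_w X V t = (\int[leb]_(y in `]0%R, +oo[) (`|H y| * expR (- ((1 - t) * y)))%:E)%E.
Proof.
move=> t0; pose I0 : set R := `]0%R, +oo[%classic.
have mH : measurable_fun setT (fun y => `|H y|).
  exact: (measurableT_comp (@normr_measurable _ _) (measurable_Hq X)).
have me : measurable_fun setT (fun y : R => expR (- y)).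
  by apply: measurableT_comp => //; apply: measurableT_comp.
have mI0 : measurable I0 by exact: measurable_itv.
rewrite -[X in integral _ X]/I0.
transitivity (\sum_(0 <= n <oo) \int[leb]_(y in I0)
    ((`|H y| * expR (- y))%:E * ((t * y) ^+ n / n`!%:R)%:E))%E.
  apply: eq_eseriesr => n _.
  rewrite /rho_abs unlock (integral_recR X hV n (f := fun r => `|r|%:E))//; last first.
    by apply/measurable_EFinP; exact: normr_measurable.
  rewrite -/I0 -ge0_integralZr//.
  - by apply: eq_integral => y _; rewrite -!EFinM exprMn; congr EFin; ring.
  - apply: measurable_funTS; apply/measurable_EFinP; apply: measurable_funM => //.
    by apply: measurable_funM => //; apply: measurable_funM.
  - move=> y; rewrite /I0/= in_itv/= andbT => y0.
    by rewrite -EFinM lee_fin !mulr_ge0 ?expR_ge0 ?invr_ge0// exprn_ge0// ltW.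
  - by rewrite lee_fin exprn_ge0.
rewrite -integral_nneseries//.
- apply: eq_integral => y; rewrite inE /I0/= in_itv/= andbT => y0.
  rewrite nneseriesZl; last first.
    by move=> n _; rewrite lee_fin divr_ge0// exprn_ge0// mulr_ge0// ltW.
  rewrite expR_nneseries ?mulr_ge0 ?(ltW y0)// -EFinM -mulrA -expRD.
  by congr (_ * expR _)%:E; ring.
- move=> n; apply: measurable_funTS; apply/measurable_EFinP.
  apply: measurable_funM; first exact: measurable_funM.
  by apply: measurable_funM => //; apply: measurable_funX; exact: measurable_funM.
- move=> n y; rewrite /I0/= in_itv/= andbT => y0.
  by rewrite -EFinM lee_fin !mulr_ge0 ?expR_ge0 ?invr_ge0// exprn_ge0// mulr_ge0// ltW.
Qed.

Lemma G_w_le s t : 0 <= s -> s <= t -> (G_w X V s <= G_w X V t)%E.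
Proof.
move=> s0 st; apply: lee_nneseries => [n _ _|n _].
  rewrite mule_ge0 ?lee_fin ?exprn_ge0// /rho_abs unlock.
  by apply: integral_ge0 => w _; rewrite lee_fin.
rewrite lee_wpmul2l ?lee_fin ?lerXn2r//; last by rewrite nnegrE (le_trans s0).
by rewrite /rho_abs unlock; apply: integral_ge0 => w _; rewrite lee_fin.
Qed.

End record_generating_functions.

Section power_moment.
Context (R : realType)
  dX (OmX : measurableType dX) (P : probability OmX R)
  (X : {RV P >-> R})
  dV (OmV : measurableType dV) (Q : probability OmV R)
  (V : nat -> {RV Q >-> R}).
Hypothesis hV : iid_uniform V.
Local Notation H := (Hq X).
Local Notation leb := (@lebesgue_measure R).
Implicit Types (n : nat) (x y z t : R).

Let I0 : set R := `]0%R, +oo[%classic.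
Let mI0 : measurable I0. Proof. exact: measurable_itv. Qed.

Let mexpN r : measurable_fun setT (fun y : R => expR (- (r * y))).
Proof.
by apply: measurableT_comp => //; apply: measurableT_comp => //.
Qed.

Let mabsH : measurable_fun setT (fun y => `|H y|).
Proof. exact: (measurableT_comp (@normr_measurable _ _) (measurable_Hq X)). Qed.

Let mHe r (D : set R) : measurable_fun D (fun y => (`|H y| * expR (- (r * y)))%:E).
Proof.
apply: measurable_funTS; apply/measurable_EFinP.
apply: measurable_funM; [exact: mabsH|exact: mexpN].
Qed.

Let mE r (D : set R) : measurable_fun D (fun y => (expR (- (r * y)))%:E).
Proof. by apply: measurable_funTS; apply/measurable_EFinP; exact: mexpN. Qed.

Let mpow p (f : R -> R) : measurable_fun setT f ->
  measurable_fun setT (fun y => Num.max (f y) 0 `^ p).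
Proof.
move=> mf; have mg : measurable_fun setT (fun y => Num.max (f y) 0).
  exact: measurable_maxr.
exact: (measurableT_comp (measurable_powR p) mg).
Qed.

Lemma expectation_pos_powR p :
  ('E_P[fun w => (Num.max (X w) 0 `^ p)%R] =
   \int[leb]_(y in I0) (Num.max (H y) 0 `^ p * expR (- (1 * y)))%:E)%E.
Proof.
rewrite unlock (integral_quantile X hV (f := fun r => (Num.max r 0 `^ p)%:E)).
- by apply: eq_integral => y _; rewrite -EFinM mul1r.
- by apply/measurable_EFinP; exact: mpow.
- by move=> x; rewrite lee_fin powR_ge0.
Qed.

(** Split the integrand |H y| e^(ty) e^-y. Where 0 <= H y, either H y exceeds e^(y/(2p)), and then
    e^(ty) = (e^(y/(2p)))^(p-1) is at most (H y)^(p-1), or the integrand is at most e^(-y/2).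
    Where H y < 0, monotonicity bounds |H y| by |H 1| beyond 1, and e^(ty) <= e before 1. *)
Lemma power_moment_G_w p : 1 < p -> (rho_abs X V 0 < +oo)%E ->
  ('E_P[fun w => (Num.max (X w) 0 `^ p)%R] < +oo)%E ->
  (G_w X V ((p - 1) / (2 * p)) < +oo)%E.
Proof.
move=> p1 w0; rewrite expectation_pos_powR => Ep.
have p0 : 0 < p by rewrite (lt_trans _ p1).
(* chosen so that t = (p - 1) / (2 p) and t + 1 / (2 p) = 1 / 2 *)
set t := (p - 1) / (2 * p).
have t0 : 0 < t by rewrite divr_gt0 ?subr_gt0// mulr_gt0.
have t2 : t < 1/2.
  rewrite ltr_pdivrMr ?mulr_gt0// mulrA divfK ?pnatr_eq0// mul1r.
  by rewrite ltrBlDr ltrDl.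
have tE : t + (2 * p)^-1 = 2^-1.
  by rewrite /t; field; rewrite gt_eqF.
have halfE (y : R) : (2^-1 - t) * y - (1 - t) * y = - (2^-1 * y).
  by rewrite -mulrBl -[RHS]mulNr; congr (_ * _); move: (t) => u; lra.
rewrite (G_wE _ hV (ltW t0)) -/I0.
have : (\int[leb]_(y in I0) (`|H y| * expR (- (1 * y)))%:E < +oo)%E.
  move: w0; rewrite /rho_abs unlock (integral_recR X hV 0 (f := fun r => `|r|%:E))//.
    rewrite (_ : integral _ _ _ =
      \int[leb]_(y in I0) (`|H y| * expR (- (1 * y)))%:E)%E//.
    apply: eq_integral => y _.
    by rewrite -EFinM expr0 fact0 divr1 !mul1r.
  by apply/measurable_EFinP; exact: normr_measurable.
move=> Eabs.
pose g1 y : \bar R := ((1 + `|H 1|) * expR (- (2^-1 * y)))%:E.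
pose g2 y : \bar R := (Num.max (H y) 0 `^ p * expR (- (1 * y)))%:E.
pose g3 y : \bar R := (expR 1 * (`|H y| * expR (- (1 * y))))%:E.
have mg1 : measurable_fun I0 g1.
  by apply: measurable_funTS; apply/measurable_EFinP; apply: measurable_funM.
have mg2 : measurable_fun I0 g2.
  apply: measurable_funTS; apply/measurable_EFinP; apply: measurable_funM => //.
  by apply: mpow; exact: measurable_Hq.
have mg3 : measurable_fun I0 g3.
  apply: measurable_funTS; apply/measurable_EFinP; apply: measurable_funM => //.
  exact: measurable_funM.
have g10 y : (0 <= g1 y)%E by rewrite lee_fin mulr_ge0 ?expR_ge0 ?addr_ge0.
have g20 y : (0 <= g2 y)%E by rewrite lee_fin mulr_ge0 ?expR_ge0 ?powR_ge0.
have g30 y : (0 <= g3 y)%E by rewrite lee_fin !mulr_ge0 ?expR_ge0.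
apply: (@le_lt_trans _ _ (\int[leb]_(y in I0) (g1 y + (g2 y + g3 y)))%E).
  apply: ge0_le_integral => //.
  - exact: mHe.
  - by apply: emeasurable_funD => //; apply: emeasurable_funD.
  move=> y; rewrite /I0/= in_itv/= andbT => y0.
  rewrite /g1 /g2 /g3 -!EFinD lee_fin.
  have [h0|h0] := leP 0 (H y).
    rewrite ger0_norm//.
    have [hE|hE] := leP (expR ((2 * p)^-1 * y)) (H y).
      rewrite addrCA; apply: (@le_trans _ _ (H y `^ p * expR (- (1 * y)))).
        rewrite (_ : - ((1 - t) * y) = t * y + - (1 * y)); last by ring.
        rewrite expRD mulrA ler_wpM2r ?expR_ge0//.
        rewrite (_ : H y `^ p = H y * H y `^ (p - 1)); last first.
          rewrite -[X in X * _](@powRr1 R) -?powRD; last 2 first.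
          - by rewrite subrKC gt_eqF.
          - by [].
          - by rewrite subrKC.
        rewrite ler_wpM2l//.
        rewrite (_ : expR (t * y) = expR ((2 * p)^-1 * y) `^ (p - 1)).
          by rewrite ge0_ler_powR ?nnegrE ?expR_ge0// subr_ge0 ltW.
        rewrite /powR gt_eqF ?expR_gt0// expRK; congr expR.
        by rewrite /t; ring.
      by rewrite lerDl addr_ge0 ?mulr_ge0 ?expR_ge0 ?addr_ge0.
    apply: (@le_trans _ _ (expR (- (2^-1 * y)))).
      apply: (@le_trans _ _ (expR ((2 * p)^-1 * y) * expR (- ((1 - t) * y)))).
        by rewrite ler_wpM2r ?expR_ge0// ltW.
      have e : (2 * p)^-1 = 2^-1 - t by rewrite -tE addrAC subrr add0r.
      by rewrite -expRD ler_expR e halfE.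
    rewrite mulrDl mul1r -addrA lerDl.
    by rewrite !addr_ge0 ?mulr_ge0 ?expR_ge0 ?powR_ge0.
  have [y1|y1] := leP y 1.
    apply: (@le_trans _ _ (expR 1 * (`|H y| * expR (- (1 * y))))).
      rewrite mulrCA ler_wpM2l// -expRD ler_expR -lerBlDr opprK.
      have : t * y <= 1 * 1 by rewrite ler_pM// ltW// (lt_trans t2)//; lra.
      by lra.
    by rewrite addrA lerDr addr_ge0 ?mulr_ge0 ?expR_ge0 ?powR_ge0 ?addr_ge0.
  apply: (@le_trans _ _ (`|H 1| * expR (- (2^-1 * y)))).
    have H1y : H 1 <= H y by rewrite Hq_nondecreasing// ltW.
    rewrite ler_pM ?expR_ge0//.
      by rewrite (ltr0_norm h0) (ltr0_norm (le_lt_trans H1y h0)) lerN2.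
    by rewrite ler_expR lerN2 ler_wpM2r ?(ltW y0)//; move: (t) t2 => u; lra.
  rewrite mulrDl mul1r addrAC lerDr.
  by rewrite !addr_ge0 ?mulr_ge0 ?expR_ge0 ?powR_ge0.
rewrite ge0_integralD//; last 2 first.
- by move=> y _; rewrite adde_ge0.
- exact: emeasurable_funD.
rewrite ge0_integralD//; apply: lte_add_pinfty; last apply: lte_add_pinfty => //.
- rewrite /g1; under eq_integral do rewrite EFinM.
  rewrite ge0_integralZl//; last exact: mE.
  by apply: lte_mul_pinfty => //; apply: integral_expRN; rewrite invr_gt0.
- rewrite /g3; under eq_integral do rewrite EFinM.
  rewrite ge0_integralZl//; last exact: mHe.
  by apply: lte_mul_pinfty => //.
Qed.

(** Monotonicity of H turns the integral bound into H x <= C e^((1-t)(x+1)); raising this to the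
    power t leaves (H x)^(1+t) e^-x below a multiple of H x e^(-(1-t)x). *)
Lemma G_w_power_moment t : 0 < t <= 1 -> (G_w X V t < +oo)%E ->
  ('E_P[fun w => (Num.max (X w) 0 `^ (1 + t))%R] < +oo)%E.
Proof.
move=> /andP[t0 t1]; rewrite expectation_pos_powR (G_wE _ hV (ltW t0)) -/I0.
set I := integral _ _ _ => Ifin.
have I_ge0 : (0 <= I)%E by apply: integral_ge0 => y _; rewrite lee_fin mulr_ge0 ?expR_ge0.
have If : I \is a fin_num by rewrite ge0_fin_numE.
pose C := fine I; have C0 : 0 <= C by exact: fine_ge0.
have mI : measurable_fun I0 (fun y => (`|H y| * expR (- ((1 - t) * y)))%:E).
  exact: mHe.
have bnd x : 0 < x -> 0 <= H x -> H x <= C * expR ((1 - t) * (x + 1)).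
  move=> x0 h0; pose J : set R := `]x, (x + 1)%R]%classic.
  have mJ : measurable J by exact: measurable_itv.
  have lJ : leb J = 1%E.
    by rewrite /J lebesgue_measure_itv/= lte_fin ltrDl ltr01 -EFinD addrC addKr.
  rewrite -ler_pdivrMr ?expR_gt0// -expRN -lee_fin /C fineK//.
  apply: (@le_trans _ _ (\int[leb]_(y in J) (H x * expR (- ((1 - t) * (x + 1))))%:E)%E).
    by rewrite integral_cst//= lJ mule1.
  apply: (@le_trans _ _ (\int[leb]_(y in J) (`|H y| * expR (- ((1 - t) * y)))%:E)%E).
    apply: ge0_le_integral => //.
    - by move=> y _; rewrite lee_fin mulr_ge0 ?expR_ge0.
    - exact: mHe.
    move=> y; rewrite /J/= in_itv/= => /andP[xy yx].
    rewrite lee_fin ler_pM ?expR_ge0//.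
      by rewrite (le_trans (Hq_nondecreasing X x0 (ltW xy)))// ler_norm.
    by rewrite ler_expR lerN2 ler_wpM2l// subr_ge0.
  apply: ge0_subset_integral => //.
    move=> y; rewrite /J /I0/= !in_itv/= andbT => /andP[xy _].
    exact: lt_trans xy.
apply: (@le_lt_trans _ _ (\int[leb]_(y in I0)
   ((C `^ t * expR t)%:E * (`|H y| * expR (- ((1 - t) * y)))%:E))%E); last first.
  rewrite ge0_integralZl//.
  - by apply: lte_mul_pinfty => //; rewrite lee_fin mulr_ge0 ?expR_ge0 ?powR_ge0.
  - by rewrite lee_fin mulr_ge0 ?expR_ge0 ?powR_ge0.
apply: ge0_le_integral => //.
- by move=> y _; rewrite lee_fin mulr_ge0 ?expR_ge0 ?powR_ge0.
- apply: measurable_funTS; apply/measurable_EFinP; apply: measurable_funM => //.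
    by apply: mpow; exact: measurable_Hq.
  exact: mexpN.
- exact: measurable_funeM.
move=> y; rewrite /I0/= in_itv/= andbT => y0; rewrite -EFinM lee_fin.
have [h0|h0] := leP 0 (H y); last first.
  rewrite powR0 ?gt_eqF ?addr_gt0// mul0r.
  by rewrite !mulr_ge0 ?expR_ge0 ?powR_ge0.
rewrite ger0_norm// powRD ?powRr1//; last first.
  by rewrite gt_eqF ?addr_gt0.
have e1 : H y `^ t <= C `^ t * expR (t * (y + 1)).
  apply: (@le_trans _ _ ((C * expR ((1 - t) * (y + 1))) `^ t)).
    by rewrite ge0_ler_powR ?nnegrE ?mulr_ge0 ?expR_ge0 ?bnd// ltW.
  rewrite powRM ?expR_ge0// ler_wpM2l ?powR_ge0//.
  rewrite /powR gt_eqF ?expR_gt0// expRK ler_expR ler_wpM2l ?(ltW t0)//.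
  rewrite -[leRHS]mul1r ler_wpM2r//; last by rewrite lerBlDr lerDl ltW.
  by rewrite addr_ge0// ltW.
rewrite mul1r; apply: (@le_trans _ _ (H y * (C `^ t * expR (t * (y + 1))) * expR (- y))).
  by rewrite ler_wpM2r ?expR_ge0// ler_wpM2l.
rewrite le_eqVlt; apply/orP; left; apply/eqP.
have eE : expR (t * (y + 1)) * expR (- y) = expR t * expR (- ((1 - t) * y)).
  by rewrite -!expRD; congr expR; ring.
by rewrite -[LHS]mulrA -[X in _ * X]mulrA eE; ring.
Qed.

End power_moment.

Section difference_series.
Context (R : realType).
Implicit Types (a : nat -> R) (t : R).

(** Coefficients of (1 - t) times the power series of [a]. *)
Definition diff_seq a n : R := if n is m.+1 then a n - a m else a 0%N.

Lemma pseries_diff_seqE a t n :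
  pseries (diff_seq a) t n.+1 = pseries a t n.+1 - t * pseries a t n.
Proof.
rewrite /pseries /series/= !big_mkord; elim: n => [|n IH].
  by rewrite !big_ord_recr !big_ord0/= mulr0 subr0.
rewrite [LHS]big_ord_recr/= IH [X in _ = X - _]big_ord_recr/= [X in _ = _ - t * X]big_ord_recr/=.
by rewrite exprS; ring.
Qed.

Lemma cvg_pseries_diff_seq a t : cvgn (pseries a t) ->
  pseries (diff_seq a) t @ \oo --> (1 - t) * limn (pseries a t).
Proof.
move=> ca; rewrite -cvg_shiftS/=.
rewrite (_ : (fun n => _) = fun n => pseries a t n.+1 - t * pseries a t n); last first.
  by apply/funext => n; exact: pseries_diff_seqE.
rewrite mulrBl mul1r; apply: cvgB; first by rewrite cvg_shiftS.
exact: cvgMr.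
Qed.

End difference_series.

Section record_series.
Context (R : realType)
  dX (OmX : measurableType dX) (P : probability OmX R)
  (X : {RV P >-> R})
  dV (OmV : measurableType dV) (Q : probability OmV R)
  (V : nat -> {RV Q >-> R}).
Hypothesis hV : iid_uniform V.
Hypothesis finX : forall n, (rho_abs X V n < +oo)%E.
Local Notation rho := (rho X V).
Local Notation D := (rho 1 - rho 0).
Implicit Types (n : nat) (t : R).

Let w n : R := fine (rho_abs X V n).

Let rho_abs_fin n : rho_abs X V n = (w n)%:E.
Proof.
rewrite /w fineK// ge0_fin_numE// /rho_abs unlock.
by apply: integral_ge0 => x _; rewrite lee_fin.
Qed.

Let w_ge0 n : 0 <= w n.
Proof.
by rewrite -lee_fin -rho_abs_fin /rho_abs unlock; apply: integral_ge0 => x _; rewrite lee_fin.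
Qed.

Lemma rho_le_abs n : `|rho n| <= w n.
Proof.
have m0 := mean_pos_ge0 X V n; have m1 := mean_neg_ge0 X V n.
have [f0 f1] := mean_fin finX n.
rewrite (rhoE finX) /w rho_absE [leRHS](fineD f0 f1).
by rewrite (le_trans (ler_normB _ _))// !ger0_norm// fine_ge0.
Qed.

(** Only the positive part of R_n grows, and it grows by at most the increment of the mean. *)
Lemma rho_abs_step n : w n.+1 <= w n + (rho n.+1 - rho n).
Proof.
rewrite -lee_fin EFinD -!rho_abs_fin -(rho_diff hV finX) !rho_absE.
rewrite (mean_posS X hV).
rewrite integral_rincr.
rewrite [mean_neg X V n](mean_negS X hV).
have i0 (A : set R) : (0 <= \int[lebesgue_measure]_(x in A) (rincr X n x)%:E)%E.
  by apply: integral_ge0 => x _; rewrite lee_fin rincr_ge0.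
by rewrite [leRHS]addeAC leeD ?leeDl// leeD2l// leeDr.
Qed.

Lemma G_w_cvg t : 0 <= t -> (G_w X V t < +oo)%E <-> cvgn (pseries w t).
Proof.
move=> t0; rewrite -(nneseries_lty_cvg (u := fun n => w n * t ^+ n)); last first.
  by move=> n; rewrite mulr_ge0// exprn_ge0.
by rewrite /G_w; under eq_eseriesr do rewrite rho_abs_fin -EFinM.
Qed.

Lemma G_w_cvg_rho e t : (G_w X V e < +oo)%E -> `|t| <= e -> cvgn (pseries rho t).
Proof.
move=> Ge te; have e0 : 0 <= e by rewrite (le_trans _ te).
have {}Ge := (G_w_cvg e0).1 Ge.
apply: normed_cvg; apply: (@series_le_cvg _ _ (fun n => w n * e ^+ n)) => //.
- by move=> n /=.
- by move=> n; rewrite mulr_ge0// exprn_ge0.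
- move=> n /=; rewrite normrM normrX ler_pM ?exprn_ge0 ?rho_le_abs//.
  by rewrite lerXn2r// nnegrE.
Qed.

Lemma diffs_rhoE n : pseries_diffs (diff_seq rho) n = n.+1%:R * (rho n.+1 - rho n).
Proof. by []. Qed.

Hypothesis D0 : 0 < D.
Context dT (OmT : measurableType dT) (PT : probability OmT R)
  (T : {RV PT >-> R}).
Hypothesis hT : is_phi X T.

(** The moment generating function is the derived series of (1 - t) G_rho(t), up to the factor
    rho_1 - rho_0. *)
Lemma mgf_phi_cvg a : 0 <= a ->
  ('M_PT T a < +oo)%E <-> cvgn (pseries (pseries_diffs (diff_seq rho)) a).
Proof.
move=> a0; rewrite (mgf_phi hV finX D0 hT a0).
pose u n := n.+1%:R * (rho n.+1 - rho n) * a ^+ n / D.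
have u0 n : 0 <= u n.
  rewrite /u !mulr_ge0 ?invr_ge0 ?(ltW D0) ?exprn_ge0// subr_ge0.
  exact: rho_nondecreasing.
rewrite -[X in (X < _)%E]/(\sum_(0 <= n <oo) (u n)%:E)%E (nneseries_lty_cvg u0).
have uE : series u = fun n => D^-1 * pseries (pseries_diffs (diff_seq rho)) a n.
  apply/funext => n; rewrite /pseries /series/= big_distrr/=.
  by apply: eq_bigr => k _; rewrite diffs_rhoE /u mulrC.
rewrite uE; split => [cu|]; last exact: is_cvgMr.
rewrite (_ : pseries _ _ = fun n => D * (D^-1 * pseries (pseries_diffs (diff_seq rho)) a n)).
  exact: is_cvgMr.
by apply/funext => n; rewrite mulVKf// gt_eqF.
Qed.

Lemma cvg_rho_mgf K : cvgn (pseries rho K) -> 0 < K -> ('M_PT T (K / 2) < +oo)%E.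
Proof.
move=> cK K0; apply/mgf_phi_cvg; first by rewrite divr_ge0// ltW.
apply: (@is_cvg_pseries_diffs _ _ K).
  by apply: cvgP; exact: cvg_pseries_diff_seq.
rewrite !gtr0_norm ?divr_gt0//; lra.
Qed.

(** Convergence of M_T(a) bounds the increments of rho by a multiple of a^-n, and E|R_n| grows no
    faster than their sum. *)
Lemma mgf_G_w a : 0 < a -> ('M_PT T a < +oo)%E ->
  exists2 t, 0 < t & (G_w X V t < +oo)%E.
Proof.
move=> a0 Ma; pose r := Num.min a 2^-1.
have r0 : 0 < r by rewrite lt_min a0/=; lra.
have ra : r <= a by rewrite ge_min lexx.
have r2 : r <= 2^-1 by rewrite ge_min lexx orbT.
have Mge0 : (0 <= 'M_PT T a)%E.
  by rewrite /mmt_gen_fun unlock; apply: integral_ge0 => x _; rewrite lee_fin expR_ge0.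
pose M := fine ('M_PT T a).
have ME : 'M_PT T a = M%:E by rewrite /M fineK// ge0_fin_numE.
have M0 : 0 <= M by rewrite -lee_fin -ME.
have dr n : (rho n.+1 - rho n) * r ^+ n <= M * D.
  have d0 : 0 <= rho n.+1 - rho n by rewrite subr_ge0 rho_nondecreasing.
  rewrite -ler_pdivrMr//; apply: (@le_trans _ _ (n.+1%:R * (rho n.+1 - rho n) * a ^+ n / D)).
    rewrite ler_pM2r ?invr_gt0//; apply: ler_pM => //; first by rewrite exprn_ge0// ltW.
      by rewrite ler_peMl// ler1n.
    by apply: lerXn2r => //; rewrite nnegrE ltW.
  rewrite -lee_fin -ME (mgf_phi hV finX D0 hT (ltW a0)).
  have u0 k : (0 <= (k.+1%:R * (rho k.+1 - rho k) * a ^+ k / D)%:E)%E.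
    rewrite lee_fin !mulr_ge0 ?invr_ge0 ?(ltW D0) ?exprn_ge0 ?(ltW a0)// subr_ge0.
    exact: rho_nondecreasing.
  apply: le_trans (nneseries_lim_ge n.+1 _); last by move=> k _ _; exact: u0.
  by rewrite big_nat_recr//= leeDr// sume_ge0.
(* With r <= 1/2 the bound w_n r^n <= 2 B is stable: w_(n+1) r^(n+1) <= (2 B + M D) r. *)
pose B := w 0 + M * D.
have wB n : w n * r ^+ n <= 2 * B.
  have B0 : 0 <= M * D by rewrite mulr_ge0// ltW.
  elim: n => [|n IH].
    by rewrite expr0 mulr1 /B; have := w_ge0 0; lra.
  apply: (@le_trans _ _ ((w n + (rho n.+1 - rho n)) * r ^+ n.+1)).
    by rewrite ler_wpM2r ?exprn_ge0 ?(ltW r0)// rho_abs_step.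
  rewrite exprSr mulrA mulrDl.
  apply: (@le_trans _ _ ((2 * B + M * D) * 2^-1)).
    rewrite ler_pM ?(ltW r0)// ?lerD// -mulrDl mulr_ge0 ?exprn_ge0 ?(ltW r0)//.
    by rewrite addr_ge0// subr_ge0 rho_nondecreasing.
  by rewrite /B; have := w_ge0 0; lra.
exists (r / 2); first by rewrite divr_gt0.
apply/G_w_cvg; first by rewrite divr_ge0// ltW.
apply: (is_cvg_pseries_bounded (r := r) (M := 2 * B)).
  by move=> n; rewrite ger0_norm.
by rewrite ger0_norm ?divr_ge0 ?(ltW r0)//; lra.
Qed.

End record_series.

(** * Analyticity at zero and the equivalences *)

Lemma eq_oint (R : realType) (f g : R -> R) (t : R) :
  (forall s, `|s| <= `|t| -> f s = g s) -> oint 0 t f = oint 0 t g.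
Proof.
move=> fg; rewrite /oint; case: ifPn => [t0|]; last rewrite -ltNge => t0.
  apply: eq_Rintegral => s; rewrite inE/= in_itv/= => /andP[s0 st].
  by apply: fg; rewrite !ger0_norm.
congr (- _); apply: eq_Rintegral => s; rewrite inE/= in_itv/= => /andP[ts s0].
by apply: fg; rewrite (ltr0_norm t0) ler0_norm// lerN2.
Qed.

(** Both orientations of the integral reduce to an interval around which f is continuous. *)
Lemma oint_FTC (R : realType) (f G : R -> R) (e t : R) :
  (forall s : R, `|s| < e -> is_derive s 1 G (f s)) ->
  (forall s : R, `|s| < e -> {for s, continuous f}) -> `|t| < e ->
  oint 0 t f = G t - G 0.
Proof.
move=> dG cf te.
have e0 : 0 < e by rewrite (le_lt_trans _ te).
have key a b : `|a| < e -> `|b| < e -> a <= b ->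
    \int[lebesgue_measure]_(x in `[a, b]) f x = G b - G a.
  move=> ae be ab.
  have abe s : a <= s <= b -> `|s| < e.
    move=> /andP[as_ sb]; move: ae be; rewrite !ltr_norml => /andP[ae _] /andP[_ be].
    by rewrite (lt_le_trans ae)//= (le_lt_trans sb).
  by rewrite /Rintegral (integral_deriv ab (fun s sab => dG s (abe s sab)) (fun s sab => cf s (abe s sab))).
rewrite /oint; case: ifPn => [t0|]; first by rewrite key ?normr0.
by rewrite -ltNge => t0; rewrite key ?normr0 ?opprB// ltW.
Qed.

Section analytic_part.
Context (R : realType)
  dX (OmX : measurableType dX) (P : probability OmX R)
  (X : {RV P >-> R})
  dV (OmV : measurableType dV) (Q : probability OmV R)
  (V : nat -> {RV Q >-> R}).
Hypothesis hV : iid_uniform V.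
Hypothesis finX : forall n, (rho_abs X V n < +oo)%E.
Local Notation rho := (rho X V).
Local Notation D := (rho 1 - rho 0).
Implicit Types (n : nat) (t : R).
Hypothesis D0 : 0 < D.
Context dT (OmT : measurableType dT) (PT : probability OmT R)
  (T : {RV PT >-> R}).
Hypothesis hT : is_phi X T.
Local Notation c := (diff_seq rho).
Local Notation C := (fun s => limn (pseries c s)).
Local Notation C' := (fun s => limn (pseries (pseries_diffs c) s)).

(** [mgf_phi] is limited to nonnegative arguments; for negative ones the series is obtained by
    dominated convergence. *)
Lemma mgf_series e t : ('M_PT T e < +oo)%E -> `|t| < e ->
  'M_PT T t = (D^-1 * C' t)%:E.
Proof.
move=> Me te.
have PT0 := phi_gt0 hV finX D0 hT.
have mT : measurable_fun setT (fun w => `|T w|) by exact: measurableT_comp.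
have iT (s : R) : ('M_PT T s < +oo)%E ->
    PT.-integrable setT (EFin \o (fun w => expR (s * `|T w|))).
  rewrite mgf_abs// => Ms; apply/integrableP; split.
    apply/measurable_EFinP; apply: measurableT_comp => //; exact: measurable_funM.
  rewrite (_ : integral _ _ _ = (\int[PT]_w (expR (s * `|T w|))%:E)%E)//.
  by apply: eq_integral => w _ /=; rewrite ger0_norm ?expR_ge0.
have := @moment_series _ _ _ PT (fun w => `|T w|) mT (fun w => normr_ge0 _) e 0 t 0 (iT _ Me).
rewrite !add0r => /(_ te).
have mE j : moment PT (fun w => `|T w|) (0 + j) 0 = j.+1`!%:R * (rho j.+1 - rho j) / D.
  rewrite /moment /Rintegral add0n.
  transitivity (fine (\int[PT]_w (`|T w| ^+ j)%:E)%E); last by rewrite (moment_phi hV finX D0 hT).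
  by congr fine; apply: eq_integral => w _; rewrite mul0r expR0 mulr1.
rewrite (_ : (fun n => _) = fun n => D^-1 * pseries (pseries_diffs c) t n); last first.
  apply/funext => n; rewrite /pseries /series/= big_distrr/=; apply: eq_bigr => j _.
  rewrite mE diffs_rhoE factS natrM.
  have f0 : j`!%:R != 0 :> R by rewrite pnatr_eq0 -lt0n fact_gt0.
  by field; rewrite f0 gt_eqF.
move=> cv.
have cd : cvgn (pseries (pseries_diffs c) t).
  rewrite (_ : pseries _ _ = fun n => D * (D^-1 * pseries (pseries_diffs c) t n)).
    by apply: is_cvgMr; apply: cvgP cv.
  by apply/funext => n; rewrite mulVKf// gt_eqF.
have cv' : (fun n => D^-1 * pseries (pseries_diffs c) t n) @ \oo --> D^-1 * C' t.
  exact: cvgMr.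
have <- := cvg_unique (@Rhausdorff R) cv cv'.
rewrite mgf_abs// /moment /Rintegral.
have it : (\int[PT]_w (expR (t * `|T w|))%:E)%E \is a fin_num.
  have Me' : (\int[PT]_w (expR (e * `|T w|))%:E < +oo)%E by rewrite -mgf_abs.
  rewrite ge0_fin_numE; last by apply: integral_ge0 => w _; rewrite lee_fin expR_ge0.
  apply: le_lt_trans Me'; apply: ge0_le_integral => //.
  - by apply/measurable_EFinP; apply: measurableT_comp => //; exact: measurable_funM.
  - by apply/measurable_EFinP; apply: measurableT_comp => //; exact: measurable_funM.
  - move=> w _; rewrite lee_fin ler_expR ler_wpM2r//.
    by rewrite (le_trans (ler_norm t))// ltW.
rewrite -{1}(fineK it); congr (fine _)%:E; apply: eq_integral => w _.
by rewrite expr0 mul1r.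
Qed.

(** C(t) = (1 - t) G_rho(t) is a power series with C(0) = rho_0 and C' = D M_T. *)
Lemma G_rho_mgf e : 0 < e < 1 -> (G_w X V e < +oo)%E -> ('M_PT T e < +oo)%E ->
  forall t, `|t| < e ->
  [/\ cvgn (pseries rho t), ('M_PT T t < +oo)%E,
    G_rho X V t = (1 - t)^-1 * (rho 0 + D * oint 0 t (fun s => fine ('M_PT T s))),
    derivable (fun s : R => (1 - s) * G_rho X V s) t 1 &
    'M_PT T t = (D^-1 * derive1 (fun s : R => (1 - s) * G_rho X V s) t)%:E].
Proof.
move=> /andP[e0 e1] Ge Me t te.
have cr (s : R) : `|s| < e -> cvgn (pseries rho s).
  by move=> se; apply: (G_w_cvg_rho finX Ge); exact: ltW.
have CE (s : R) : `|s| < e -> C s = (1 - s) * G_rho X V s.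
  by move=> se; apply/cvg_lim => //; apply: cvg_pseries_diff_seq; exact: cr.
have cc (s : R) : `|s| < e -> cvgn (pseries c s).
  by move=> se; apply: cvgP; apply: cvg_pseries_diff_seq; exact: cr.
have dC (s : R) : `|s| < e -> is_derive s 1 C (C' s) by exact: is_derive_pseries.
have cd (s : R) : `|s| < e -> cvgn (pseries (pseries_diffs c) s).
  move=> se; apply: (@is_cvg_pseries_diffs _ _ ((`|s| + e) / 2)).
    apply: cc; rewrite ger0_norm ?divr_ge0 ?addr_ge0 ?(ltW e0)//.
    by rewrite midf_lt.
  by rewrite [ltRHS]ger0_norm ?divr_ge0 ?addr_ge0 ?(ltW e0)// midf_lt.
have cC' (s : R) : `|s| < e -> {for s, continuous C'}.
  move=> se; apply: differentiable_continuous; apply/derivable1_diffP.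
  by have := @is_derive_pseries _ _ _ _ cd se => -[].
have ME (s : R) : `|s| < e -> 'M_PT T s = (D^-1 * C' s)%:E by exact: mgf_series.
have dN : is_derive t 1 (fun s : R => (1 - s) * G_rho X V s) (C' t).
  apply: near_eq_is_derive (dC t te).
  exists (e - `|t|); first by rewrite /= subr_gt0.
  move=> s /= ts; apply: CE.
  by rewrite -(subrKC t s) (le_lt_trans (ler_normD _ _))// -ltrBrDl distrC.
have oE : oint 0 t (fun s => fine ('M_PT T s)) = D^-1 * C t - D^-1 * C 0.
  rewrite (@eq_oint _ _ (fun s => D^-1 * C' s)); last first.
    by move=> s st; rewrite ME// (le_lt_trans st).
  apply: (@oint_FTC _ _ (fun s => D^-1 * C s) e) => // s se.
    by have := @is_deriveZ _ _ _ C D^-1 s 1 (C' s) (dC s se).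
  by apply: cvgMr; exact: cC'.
split.
- exact: cr.
- by rewrite ME// ltry.
- rewrite oE mulrBr !mulVKf ?gt_eqF// limn_pseries0 /= subrKC.
  rewrite CE// mulKf// subr_eq0 eq_sym lt_eqF//.
  exact: le_lt_trans (ler_norm _) (lt_trans te e1).
- by have := dN => -[].
- by rewrite ME// derive1E (@derive_val _ _ _ _ _ _ _ dN).
Qed.

End analytic_part.

Section equivalences.
Context (R : realType)
  dX (OmX : measurableType dX) (P : probability OmX R)
  (X : {RV P >-> R})
  dV (OmV : measurableType dV) (Q : probability OmV R)
  (V : nat -> {RV Q >-> R}).
Hypotheses (hV : iid_uniform V) (hX : in_Hstar X).
Context dT (OmT : measurableType dT) (PT : probability OmT R)
  (T : {RV PT >-> R}).
Hypothesis hT : is_phi X T.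

Let finX := Hstar_rho_abs hV hX.
Let D0 := Hstar_rho_diff_gt0 hV hX.

Lemma power_moment_G_w_lty :
  (exists2 p : R, 1 < p & ('E_P[fun x => (Num.max (X x) 0 `^ p)%R] < +oo)%E) ->
  exists2 t : R, 0 < t & (G_w X V t < +oo)%E.
Proof.
move=> [p p1 Ep]; exists ((p - 1) / (2 * p)); last exact: power_moment_G_w.
by rewrite divr_gt0 ?subr_gt0// mulr_gt0// (lt_trans _ p1).
Qed.

Lemma G_w_near_rho :
  (exists2 t : R, 0 < t & (G_w X V t < +oo)%E) ->
  \forall t \near (0 : R), cvgn (pseries (rho X V) t).
Proof.
move=> [e e0 Ge]; exists e => // t /=; rewrite sub0r normrN => te.
by apply: (G_w_cvg_rho finX Ge); exact: ltW.
Qed.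

Lemma near_rho_mgf :
  (\forall t \near (0 : R), cvgn (pseries (rho X V) t)) ->
  exists2 a : R, 0 < a & ('M_PT T a < +oo)%E.
Proof.
move=> [e /= e0 ce]; exists (e / 2 / 2); first by rewrite !divr_gt0.
apply: (cvg_rho_mgf hV finX D0 hT); last by rewrite divr_gt0.
apply: ce; rewrite /= sub0r normrN gtr0_norm ?divr_gt0//.
by rewrite ltr_pdivrMr// ltr_pMr// ltr1n.
Qed.

Lemma record_tfae :
  [<-> (exists2 p : R, 1 < p & ('E_P[fun x => (Num.max (X x) 0 `^ p)%R] < +oo)%E);
       (\forall t \near (0 : R), cvgn (pseries (rho X V) t));
       (exists2 t : R, 0 < t & (G_w X V t < +oo)%E);
       (exists2 a : R, 0 < a & ('M_PT T a < +oo)%E)].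
Proof.
have iv_iii : (exists2 a : R, 0 < a & ('M_PT T a < +oo)%E) ->
    exists2 t : R, 0 < t & (G_w X V t < +oo)%E.
  by move=> [a a0 Ma]; exact: (mgf_G_w hV finX D0 hT a0 Ma).
tfae.
- by move/power_moment_G_w_lty/G_w_near_rho.
- by move/near_rho_mgf/iv_iii.
- by move/G_w_near_rho/near_rho_mgf.
- move=> /iv_iii[t t0 Gt]; pose s := Num.min t 1.
  have s01 : 0 < s <= 1 by rewrite /s lt_min t0 ltr01 ge_min lexx orbT.
  exists (1 + s); first by rewrite ltrDl; case/andP: s01.
  apply: (G_w_power_moment hV s01); apply: le_lt_trans Gt.
  by apply: G_w_le; [case/andP: s01 => /ltW|rewrite ge_min lexx].
Qed.

End equivalences.

(** * Slices of phi'(T) *)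

Section parts.
Context (R : realType) d (Om : measurableType d)
  (P : probability Om R) (T : {RV P >-> R}).
Local Notation leb := (@lebesgue_measure R).
Local Notation F := (cdfR T).
Variables (g g' : R -> R) (a b : R).
Hypothesis ab : a < b.
Hypothesis dg : forall s : R, a <= s <= b -> is_derive s 1 g (g' s).
Hypothesis cg' : forall s : R, a <= s <= b -> {for s, continuous g'}.
Hypothesis g0 : forall s : R, a <= s <= b -> 0 <= g s.
Hypothesis g'0 : forall s : R, a <= s <= b -> 0 <= g' s.

Let Iab : set R := `[a, b]%classic.
Let mIab : measurable Iab. Proof. exact: measurable_itv. Qed.

Let cg s : a <= s <= b -> {for s, continuous g}.
Proof.
move=> sab; apply: differentiable_continuous.
by apply/derivable1_diffP; have := dg sab => -[].
Qed.

Let integral_deriv_ge0 x : a <= x <= b ->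
  (\int[leb]_(s in `[x, b]) (g' s)%:E = (g b - g x)%:E)%E.
Proof.
move=> /andP[ax xb]; have sx s : x <= s <= b -> a <= s <= b.
  by move=> /andP[xs ->]; rewrite (le_trans ax).
by apply: integral_deriv => // s /sx; [exact: dg|exact: cg'].
Qed.

Let mg : measurable_fun setT (patch (fun=> 0 : R) Iab g).
Proof.
apply/measurable_restrict => //; rewrite setTI.
apply: subspace_continuous_measurable_fun => //.
by apply: continuous_in_subspaceT => s; rewrite inE /Iab/= in_itv/=; exact: cg.
Qed.

Let mg' : measurable_fun setT (patch (fun=> 0 : R) Iab g').
Proof.
apply/measurable_restrict => //; rewrite setTI.
apply: subspace_continuous_measurable_fun => //.
by apply: continuous_in_subspaceT => s; rewrite inE /Iab/= in_itv/=; exact: cg'.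
Qed.

Let gT w : R := if a <= T w < b then g (T w) else 0.

Lemma measurable_slice : measurable_fun setT gT.
Proof.
rewrite (_ : gT = fun w => if T w < b then (patch (fun=> 0 : R) Iab g) (T w) else 0); last first.
  apply/funext => w; rewrite /gT patchE; case: ltP => Tb; rewrite ?andbT ?andbF//.
  by case: ifPn => aT; [rewrite mem_set// /Iab/= in_itv/= aT ltW|
    rewrite memNset// /Iab/= in_itv/= (negbTE aT)].
apply: measurable_fun_if => //; first exact: measurable_fun_ltr.
by apply: measurable_funTS; exact: (measurableT_comp mg).
Qed.

Let integral_pred (c : R) (p : pred Om) : 0 <= c -> measurable [set w | p w] ->
  (\int[P]_w (c * (p w)%:R)%:E = c%:E * P [set w | p w])%E.
Proof.
move=> c0 mp; under eq_integral do rewrite EFinM.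
rewrite ge0_integralZl//.
- congr (_ * _)%E; rewrite -[X in P X]setIT -integral_indic//.
  by apply: eq_integral => w _; rewrite indicE mem_setE.
- apply/measurable_EFinP.
  rewrite (_ : (fun w => _) = \1_[set w | p w]) //.
  by apply/funext => w; rewrite indicE mem_setE.
Qed.

(** Tonelli on [a, b] times the probability space: pointwise in w, the integral of g' over the s in
    [a, b] with T w <= s is g b - g (max a (T w)) when T w < b, and 0 otherwise. Positivity of g and
    g' avoids any integrability condition. *)
Lemma by_parts_ge0 :
  (\int[leb]_(s in Iab) (g' s * F s)%:E + (\int[P]_w (gT w)%:E +
    (g a)%:E * P [set w | (T w < a)%R]) = (g b)%:E * P [set w | (T w < b)%R])%E.
Proof.
have aab : a <= a <= b by rewrite lexx ltW.
have bab : a <= b <= b by rewrite lexx ltW.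
have mlt x : measurable [set w | T w < x].
  have mT : measurable (T @^-1` `]-oo, x[%classic).
    exact: measurable_RV_preimage.
  suff -> : [set w | T w < x] = T @^-1` `]-oo, x[%classic by [].
  by apply/funext => w; apply/propext; rewrite /preimage/= in_itv.
have mle x : measurable [set w | T w <= x].
  have mT : measurable (T @^-1` `]-oo, x]%classic).
    exact: measurable_RV_preimage.
  suff -> : [set w | T w <= x] = T @^-1` `]-oo, x]%classic by [].
  by apply/funext => w; apply/propext; rewrite /preimage/= in_itv.
pose h (z : R * Om) : \bar R := ((patch (fun=> 0 : R) Iab g') z.1 * (T z.2 <= z.1)%R%:R)%:E.
have h0 z : (0 <= h z)%E.
  rewrite lee_fin mulr_ge0// patchE; case: ifPn => //.
  by rewrite inE /Iab/= in_itv/=; exact: g'0.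
have mh : measurable_fun setT h.
  apply/measurable_EFinP; apply: measurable_funM.
    exact: (measurableT_comp mg').
  rewrite (_ : (fun z => _) = fun z : R * Om => if T z.2 <= z.1 then 1 else 0); last first.
    by apply/funext => z /=; case: ifP.
  apply: measurable_fun_if => //; apply: measurable_fun_ler => //.
  exact: measurableT_comp.
have -> : (\int[leb]_(s in Iab) (g' s * F s)%:E = \int[P]_w \int[leb]_s h (s, w))%E.
  rewrite -(@fubini_tonelli _ _ _ _ _ leb P h mh h0) integral_mkcond.
  apply: eq_integral => s _; rewrite patchE /h/=; case: ifPn => sI; last first.
    by rewrite integral0_eq// => w _; rewrite patchE (negbTE sI) mul0r.
  have sab : a <= s <= b by move: sI; rewrite inE /Iab/= in_itv.
  rewrite patchE sI (@integral_pred (g' s) (fun w => (T w <= s)%R) (g'0 sab) (mle s)).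
  by rewrite EFinM cdfRE.
rewrite -(@integral_pred (g a) (fun w => (T w < a)%R) (g0 aab) (mlt a)).
rewrite -(@integral_pred (g b) (fun w => (T w < b)%R) (g0 bab) (mlt b)).
have gT0 w : (0 <= (gT w)%:E)%E.
  by rewrite lee_fin /gT; case: ifPn => // /andP[aT Tb]; rewrite g0// aT ltW.
have mgT : measurable_fun setT (EFin \o gT) by apply/measurable_EFinP; exact: measurable_slice.
have ga0 w : (0 <= (g a * (T w < a)%R%:R)%:E)%E by rewrite lee_fin mulr_ge0 ?g0.
have mga : measurable_fun setT (fun w => (g a * (T w < a)%R%:R)%:E).
  apply/measurable_EFinP; apply: measurable_funM => //.
  rewrite (_ : (fun w => _) = \1_[set w | T w < a]); first exact: measurable_indic.
  by apply/funext => w; rewrite indicE mem_setE.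
have mh1 : measurable_fun setT (fun w => \int[leb]_s h (s, w))%E.
  exact: (@measurable_fun_fubini_tonelli_G _ _ _ _ _ leb h mh h0).
rewrite -ge0_integralD// -ge0_integralD//; last 3 first.
- by move=> w _; apply: integral_ge0 => s _; exact: h0.
- by move=> w _; exact: adde_ge0.
- exact: emeasurable_funD.
- apply: eq_integral => w _; rewrite /gT.
  have [Ta|Ta] := ltP (T w) a.
    rewrite (lt_trans Ta ab) !mulr1 add0e.
    rewrite [X in (X + _)%E](_ : _ = (g b - g a)%:E).
      by rewrite -EFinD subrK.
    rewrite -(@integral_deriv_ge0 a)// [RHS]integral_mkcond; apply: eq_integral => s _.
    rewrite /h/= !patchE; case: ifPn => [|_]; last by rewrite mul0r.
    by rewrite inE /Iab/= in_itv/= => /andP[as_ _]; rewrite (ltW (lt_le_trans Ta as_)) mulr1.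
  have [Tb|Tb] := ltP (T w) b; rewrite ?mulr1 !mulr0 ?adde0.
    rewrite [X in (X + _)%E](_ : _ = (g b - g (T w))%:E).
      by rewrite -EFinD subrK.
    rewrite -(@integral_deriv_ge0 (T w)); last by rewrite Ta ltW.
    rewrite [RHS]integral_mkcond; apply: eq_integral => s _.
    rewrite /h/= !patchE; case: ifPn => [|].
      rewrite inE /Iab/= in_itv/= => /andP[as_ sb].
      have [Ts|Ts] := leP (T w) s; first by rewrite mem_set ?mulr1//= in_itv/= Ts sb.
      by rewrite memNset ?mulr0//= in_itv/= leNgt Ts.
    move=> sI; rewrite mul0r memNset//= in_itv/= => /andP[Ts sb].
    by move/negP: sI; apply; rewrite inE /Iab/= in_itv/= (le_trans Ta).
  (* for T w = b the inner integrand is nonzero at the single point s = b *)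
  transitivity (\int[leb]_(s in [set b]) (g' b * (T w <= b)%R%:R)%:E)%E; last by rewrite integral_set1.
  rewrite [RHS]integral_mkcond; apply: eq_integral => s _.
  rewrite /h/= !patchE; case: ifPn => [|].
    rewrite inE /Iab/= in_itv/= => /andP[as_ sb].
    have [->|sE] := eqVneq s b; first by rewrite mem_set.
    rewrite memNset/=; last by apply/eqP.
    by rewrite leNgt (lt_le_trans _ Tb) ?mulr0// lt_neqAle sE.
  move=> sI; rewrite mul0r memNset//= => sE.
  by move/negP: sI; apply; rewrite inE /Iab/= in_itv/= sE lexx ltW.
Qed.

End parts.

(** Additivity of the oriented integral, according to the position of 1. *)
Lemma oint_sub (R : realType) (f : R -> R) (a b : R) :
  (forall x y : R, 0 < x -> x <= y ->
     lebesgue_measure.-integrable `[x, y] (EFin \o f)) ->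
  0 < a -> a <= b ->
  oint 1 b f - oint 1 a f = \int[lebesgue_measure]_(s in `[a, b]) f s.
Proof.
move=> intf a0 ab.
have chasles (x z y : R) : 0 < x -> x <= z -> z <= y ->
    \int[lebesgue_measure]_(s in `[x, y]) f s =
    \int[lebesgue_measure]_(s in `[x, z]) f s +
    \int[lebesgue_measure]_(s in `[z, y]) f s.
  move=> x0 xz zy; have xy := le_trans xz zy.
  have E := @Rintegral_itvB _ f (BLeft x) (BRight y) z (intf x y x0 xy).
  rewrite -(Rintegral_itv_obnd_cbnd (r := z)); last first.
    apply: integrableS (intf x y x0 xy) => //.
    move=> s /=; rewrite !in_itv/= => /andP[zs ->].
    by rewrite (ltW (le_lt_trans xz zs)).
  by rewrite -E ?bnd_simp// addrC subrK.
rewrite /oint.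
have [b1|b1] := leP 1 b; have [a1|a1] := leP 1 a.
- by rewrite (chasles 1 a b)// addrAC subrr add0r.
- by rewrite opprK addrC -chasles// ltW.
- by have := lt_le_trans b1 (le_trans a1 ab); rewrite ltxx.
- by rewrite opprK addrC (chasles a b 1) ?addrK// ltW.
Qed.

(** The weight e^t/t restricted to [a, b). *)
Definition slice (R : realType) (a b t : R) : R := if a <= t < b then expR t / t else 0.

Section phi'_slices.
Context (R : realType) d (Om : measurableType d)
  (P : probability Om R) (T : {RV P >-> R}).
Local Notation leb := (@lebesgue_measure R).
Local Notation F := (cdfR T).
Let q (s : R) : R := (s - 1) / s ^+ 2 * expR s.
Let g (s : R) : R := expR s / s.

Let is_derive_inv (s : R) : s != 0 -> is_derive s 1 (fun x : R => x^-1) (- s ^- 2).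
Proof.
move=> s0; have := @is_deriveV R id s 1 1 s0 (is_derive_id s 1).
by move=> /is_derive_eq; apply; rewrite [LHS]mulr1.
Qed.

Let dg (s : R) : 0 < s -> is_derive s 1 g (q s).
Proof.
move=> s0; have s1 : s != 0 by rewrite gt_eqF.
have := is_deriveM (is_derive_expR s) (is_derive_inv s1).
move=> /is_derive_eq; apply.
rewrite [LHS](_ : _ = expR s * (- s ^- 2) + s^-1 * expR s)//.
by rewrite /q; field.
Qed.

Let cq (s : R) : 0 < s -> {for s, continuous q}.
Proof.
move=> s0; have s1 : s != 0 by rewrite gt_eqF.
apply: cvgM; last exact: continuous_expR.
apply: cvgM; first by apply: cvgB => //; exact: cvg_cst.
by apply: cvgV; [rewrite expf_neq0|exact: exprn_continuous].
Qed.

Section one_slice.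
Variables (a b : R).
Hypotheses (a0 : 0 < a) (ab : a < b).
(* The derivative of e^s/s is negative for s < 1. Adding K s makes both the function
   and its derivative nonnegative on [a, b]; K s is then subtracted again. *)
Let K : R := expR b / a ^+ 2.
Let K0 : 0 <= K. Proof. by rewrite divr_ge0 ?expR_ge0// exprn_ge0// ltW. Qed.
Let Iab : set R := `[a, b]%classic.
Let mIab : measurable Iab. Proof. exact: measurable_itv. Qed.

Let pos s : a <= s <= b -> 0 < s. Proof. by move=> /andP[as_ _]; exact: lt_le_trans as_. Qed.

Let qK s : a <= s <= b -> 0 <= q s + K.
Proof.
move=> sab; have s0 := pos sab; case/andP: sab => as_ sb.
have e1 : q s = expR s / s - expR s / s ^+ 2 by rewrite /q; field; rewrite gt_eqF.
rewrite e1 -addrA addr_ge0 ?divr_ge0 ?expR_ge0 ?(ltW s0)// addrC subr_ge0 /K.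
apply: ler_pM; rewrite ?expR_ge0 ?invr_ge0 ?exprn_ge0 ?(ltW s0) ?ler_expR//.
by rewrite lef_pV2 ?posrE ?exprn_gt0// lerXn2r ?nnegrE// ltW.
Qed.

Let I1 := (\int[leb]_(s in Iab) ((q s + K) * F s)%:E)%E.
Let I2 := (\int[leb]_(s in Iab) (K * F s)%:E)%E.
Let A := (\int[P]_w (slice a b (T w))%:E)%E.
Let B := (\int[P]_w (if a <= T w < b then K * T w else 0)%:E)%E.

Let dg2 s : a <= s <= b -> is_derive s 1 (fun s => K * s) (cst K s).
Proof.
move=> _; have := @is_deriveZ _ _ _ id K s 1 1 (is_derive_id _ _).
by move=> /is_derive_eq; apply; rewrite [LHS]mulr1.
Qed.

Lemma slice_ge0 x : 0 <= slice a b x.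
Proof.
rewrite /slice; case: ifPn => // /andP[ax _].
by rewrite divr_ge0 ?expR_ge0// ltW// (lt_le_trans a0).
Qed.

Lemma measurable_sliceT : measurable_fun setT (fun w => (slice a b (T w))%:E).
Proof.
apply/measurable_EFinP.
by apply: (@measurable_slice R d Om P T g q a b) => s sab; exact: dg (pos sab).
Qed.

Let measurable_lt x : measurable [set w | (T w < x)%R].
Proof.
have mT : measurable (T @^-1` `]-oo, x[%classic) by exact: measurable_RV_preimage.
suff -> : [set w | T w < x] = T @^-1` `]-oo, x[%classic by [].
by apply/funext => w; apply/propext; rewrite /preimage/= in_itv.
Qed.

Let parts1 : (I1 + (A + B + (g a + K * a)%:E * P [set w | (T w < a)%R]) =
  (g b + K * b)%:E * P [set w | (T w < b)%R])%E.
Proof.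
have dg1 s : a <= s <= b -> is_derive s 1 (fun s => g s + K * s) (q s + K).
  move=> sab; have := is_deriveD (dg (pos sab)) (@is_deriveZ _ _ _ id K s 1 1 (is_derive_id _ _)).
  by move=> /is_derive_eq; apply; rewrite [X in _ + X]mulr1.
have cg1 s : a <= s <= b -> {for s, continuous (fun s => q s + K)}.
  by move=> sab; apply: cvgD; [exact: cq (pos sab)|exact: cvg_cst].
have g10 s : a <= s <= b -> 0 <= g s + K * s.
  move=> sab; have s0 := pos sab.
  by apply: addr_ge0; [exact: divr_ge0 (expR_ge0 _) (ltW s0)|exact: mulr_ge0 K0 (ltW s0)].
have := @by_parts_ge0 R d Om P T (fun s => g s + K * s) (fun s => q s + K) a b ab dg1 cg1 g10 qK.
move=> <-; congr (_ + (_ + _))%E; rewrite /A /B -ge0_integralD//.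
- apply: eq_integral => w _; rewrite /slice /g -EFinD; congr EFin.
  by case: ifP => // _; rewrite addr0.
- by move=> w _; rewrite lee_fin slice_ge0.
- exact: measurable_sliceT.
- move=> w _; rewrite lee_fin; case: ifPn => // Tab.
  by rewrite mulr_ge0// ltW// pos//; case/andP: Tab => -> /ltW ->.
- apply/measurable_EFinP.
  exact: (@measurable_slice R d Om P T (fun s => K * s) (cst K) a b dg2).
Qed.

Let parts2 : (I2 + (B + (K * a)%:E * P [set w | (T w < a)%R]) =
  (K * b)%:E * P [set w | (T w < b)%R])%E.
Proof.
have cg2 s : a <= s <= b -> {for s, continuous (cst K)} by move=> _; exact: cvg_cst.
have g20 s : a <= s <= b -> 0 <= K * s by move=> /pos/ltW; exact: mulr_ge0.
by have := @by_parts_ge0 R d Om P T (fun s => K * s) (cst K) a b ab dg2 cg2 g20 (fun _ _ => K0).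
Qed.

Let pa := fine (P [set w | (T w < a)%R]).
Let pb := fine (P [set w | (T w < b)%R]).

Let finite_parts : [/\ I1 \is a fin_num, I2 \is a fin_num, A \is a fin_num & B \is a fin_num].
Proof.
have A0 : (0 <= A)%E by apply: integral_ge0 => w _; rewrite lee_fin slice_ge0.
have B0 : (0 <= B)%E.
  apply: integral_ge0 => w _; rewrite lee_fin; case: ifPn => // Tab.
  by rewrite mulr_ge0// ltW// pos//; case/andP: Tab => -> /ltW ->.
have F0 s : 0 <= F s by case/andP: (cdfR01 T s).
have I10 : (0 <= I1)%E.
  by apply: integral_ge0 => s; rewrite /Iab/= in_itv/= => sab; rewrite lee_fin mulr_ge0// qK.
have I20 : (0 <= I2)%E by apply: integral_ge0 => s _; rewrite lee_fin mulr_ge0.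
have b0 : 0 < b := lt_trans a0 ab.
have P0 (c x : R) : 0 <= c -> (0 <= c%:E * P [set w | (T w < x)%R])%E by move=> c0; rewrite mule_ge0.
have ga0 : 0 <= g a + K * a 
  by apply: addr_ge0; [exact: divr_ge0 (expR_ge0 _) (ltW a0)|exact: mulr_ge0 K0 (ltW a0)].
have rhs x : (x%:E * P [set w | (T w < b)%R] < +oo)%E.
  by rewrite ltey_eq fin_numM// fin_num_measure//; exact: measurable_lt.
have := rhs (g b + K * b); have := rhs (K * b); rewrite -parts1 -parts2 => r2 r1.
have Ka0 : 0 <= K * a by rewrite mulr_ge0// ltW.
have p1 := P0 _ a ga0; have p2 := P0 _ a Ka0.
rewrite !ge0_fin_numE//; split.
- by apply: le_lt_trans r1; rewrite leeDl ?(adde_ge0 (adde_ge0 A0 B0) p1).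
- by apply: le_lt_trans r2; rewrite leeDl ?(adde_ge0 B0 p2).
- by apply: le_lt_trans r1; rewrite -addeA addeCA leeDl ?(adde_ge0 I10 (adde_ge0 B0 p1)).
- by apply: le_lt_trans r2; rewrite addeCA leeDl ?(adde_ge0 I20 p2).
Qed.

Let mq : measurable_fun Iab q.
Proof.
apply: subspace_continuous_measurable_fun => //.
by apply: continuous_in_subspaceT => s; rewrite inE /Iab/= in_itv/= => /pos; exact: cq.
Qed.

Let mF (D : set R) : measurable_fun D F.
Proof. by apply: measurable_funTS; exact: measurable_cdfR. Qed.

Let i1 : leb.-integrable Iab (EFin \o (fun s => (q s + K) * F s)).
Proof.
have [f1 _ _ _] := finite_parts; apply/integrableP; split.
  apply/measurable_EFinP; apply: measurable_funM; last exact: mF.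
  exact: measurable_funD.
rewrite (_ : integral _ _ _ = I1) ?ltey_eq ?f1//.
apply: eq_integral => s; rewrite inE /Iab/= in_itv/= => sab.
by rewrite ger0_norm// mulr_ge0 ?qK//; case/andP: (cdfR01 T s).
Qed.

Let i2 : leb.-integrable Iab (EFin \o (fun s => K * F s)).
Proof.
have [_ f2 _ _] := finite_parts; apply/integrableP; split.
  by apply/measurable_EFinP; apply: measurable_funM; last exact: mF.
rewrite (_ : integral _ _ _ = I2) ?ltey_eq ?f2//.
apply: eq_integral => s _; rewrite /= ger0_norm// mulr_ge0//.
by case/andP: (cdfR01 T s).
Qed.

Let qFE : EFin \o (fun s => q s * F s) =
  ((EFin \o (fun s => (q s + K) * F s)%R) \- (EFin \o (fun s => K * F s)%R))%E.
Proof. by apply/funext => s /=; rewrite -EFinB; congr EFin; ring. Qed.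

Lemma integrable_phi'_integrand_slice :
  leb.-integrable Iab (EFin \o (fun s => q s * F s)).
Proof. by rewrite qFE; exact: integrableB. Qed.

Lemma slice_parts : fine A = g b * pb - g a * pa -
  \int[leb]_(s in Iab) (q s * F s).
Proof.
have [f1 f2 fA fB] := finite_parts.
have fpa : P [set w | (T w < a)%R] \is a fin_num by rewrite fin_num_measure//; exact: measurable_lt.
have fpb : P [set w | (T w < b)%R] \is a fin_num by rewrite fin_num_measure//; exact: measurable_lt.
have -> : \int[leb]_(s in Iab) (q s * F s) = fine I1 - fine I2.
  rewrite /Rintegral -fineB//; congr fine.
  rewrite -[LHS]/(\int[leb]_(s in Iab) (EFin \o (fun s => q s * F s)%R) s)%E qFE.
  exact: integralB.
have := parts1; have := parts2.
rewrite -(fineK f1) -(fineK f2) -(fineK fA) -(fineK fB) -(fineK fpa) -(fineK fpb) /=.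
rewrite -!EFinM -!EFinD => -[e2] -[e1]; move: e1 e2.
rewrite -/pa -/pb; generalize (fine I1) (fine I2) (fine A) (fine B) pa pb (g a) (g b).
move=> x1 x2 al be p1 p2 y1 y2 e1 e2.
have -> : al = (x1 + (al + be + (y1 + K * a) * p1)) - (x2 + (be + K * a * p1)) - y1 * p1 - (x1 - x2) by ring.
rewrite e1 e2; ring.
Qed.

Lemma slice_fin : A \is a fin_num.
Proof. by have [] := finite_parts. Qed.

End one_slice.

Lemma integrable_phi'_integrand (x y : R) : 0 < x -> x <= y ->
  leb.-integrable `[x, y] (EFin \o (fun s => q s * F s)).
Proof.
move=> x0 xy; have xy1 : x < y + 1 by rewrite (le_lt_trans xy)// ltrDl.
apply: integrableS (integrable_phi'_integrand_slice x0 xy1) => //.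
move=> s /=; rewrite !in_itv/= => /andP[-> sy].
by rewrite (le_trans sy)// lerDl.
Qed.

(** The integrand in the definition of phi' is the derivative of e^y/y times F_T, so the increment
    of H_0 is an integration by parts of e^T/T. *)
Lemma phi'_H0_slice c (a b : R) : 0 < a -> a < b ->
  (\int[P]_w (slice a b (T w))%:E = (phi'_H0 T c b - phi'_H0 T c a)%:E)%E.
Proof.
move=> a0 ab; rewrite -[LHS]fineK; last exact: slice_fin.
congr EFin; rewrite slice_parts// -(oint_sub integrable_phi'_integrand a0 (ltW ab)).
by rewrite /phi'_H0 /g /q; ring.
Qed.

End phi'_slices.

Section slices_determine_measures.
Context (R : realType).
Implicit Types (a b x t : R).

Lemma measurable_slice_fun a b : 0 < a -> measurable_fun setT (slice a b).
Proof.
move=> a0; pose Iab : set R := `[a, b[%classic.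
have mIab : measurable Iab by exact: measurable_itv.
rewrite (_ : slice a b = patch (fun=> 0 : R) Iab (fun t => expR t / t)).
  apply/measurable_restrict => //; rewrite setTI.
  apply: subspace_continuous_measurable_fun => //.
  apply: continuous_in_subspaceT => s; rewrite inE /Iab/= in_itv/= => /andP[as_ _].
  apply: cvgM; first exact: continuous_expR.
  by apply: cvgV => //; rewrite gt_eqF// (lt_le_trans a0).
apply/funext => t; rewrite /slice patchE; case: ifPn => tab.
  by rewrite mem_set// /Iab/= in_itv.
by rewrite memNset// /Iab/= in_itv/=; exact/negP.
Qed.

Lemma eq_measure_closed_tails (m1 m2 : {measure set R -> \bar R}) :
    (m1 setT < +oo)%E ->
    (forall x : R, m1 `[x, +oo[%classic = m2 `[x, +oo[%classic) ->
  forall A : set R, measurable A -> m1 A = m2 A.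
Proof.
move=> foo m12 A mA.
apply: (@measure_unique _ R R (@RGenCInfty.G R)
  (fun n => `[- n%:R, +oo[%classic) _ _ _ _ m1 m2) => //.
- exact: RGenCInfty.measurableE.
- move=> _ _ [x ->] [y ->]; exists (Num.max x y).
  by apply/seteqP; split => z /=; rewrite !in_itv/= !andbT ge_max => /andP.
- by move=> i; exists (- i%:R).
- rewrite -subTset => x _; exists (Num.truncn `|x|).+1 => //=.
  rewrite in_itv/= andbT lerNl (le_trans (ler_norm _))// normrN.
  exact/ltW/truncnS_gt.
- by move=> _ [x ->]; exact: m12.
- move=> k; apply: le_lt_trans foo; apply: le_measure; rewrite ?inE//.
Qed.

(** The measures of density [slice a b] are finite and agree on closed half-lines, because the
    restriction of a slice to one is again a slice. Dividing by the weight recovers the measures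
    on [a, b), and these intervals exhaust the positive half-line. *)
Lemma eq_measure_slices (m1 m2 : {measure set R -> \bar R}) :
  m1 `]-oo, 0]%classic = 0%E -> m2 `]-oo, 0]%classic = 0%E ->
  (forall a b, 0 < a -> a < b ->
    (\int[m1]_t (slice a b t)%:E < +oo)%E /\
    (\int[m1]_t (slice a b t)%:E = \int[m2]_t (slice a b t)%:E)%E) ->
  forall A : set R, measurable A -> m1 A = m2 A.
Proof.
move=> m10 m20 m12 A mA.
have key a b (B : set R) : 0 < a -> a < b -> measurable B ->
    m1 (B `&` `[a, b[) = m2 (B `&` `[a, b[).
  move=> a0 ab mB; have mS := @measurable_slice_fun a b a0.
  have S0 t : 0 <= slice a b t by exact: slice_ge0.
  pose n1 : {measure set R -> \bar R} := mdens m1 mS S0.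
  pose n2 : {measure set R -> \bar R} := mdens m2 mS S0.
  have n12 C : measurable C -> n1 C = n2 C.
    apply: (@eq_measure_closed_tails n1 n2); first by have [] := m12 _ _ a0 ab.
    move=> x; rewrite /n1 /n2 /= /mdens integral_mkcond [RHS]integral_mkcond.
    have [xb|bx] := ltP x b; last first.
      have z t : ((fun t => (slice a b t)%:E) \_ `[x, +oo[) t = 0%E.
        rewrite patchE /slice; case: ifPn => //; rewrite inE/= in_itv/= andbT => xt.
        by rewrite [t < b]ltNge (le_trans bx xt) andbF.
      by rewrite !integral0_eq.
    have mx0 : 0 < Num.max x a by rewrite lt_max a0 orbT.
    have mxb : Num.max x a < b by rewrite gt_max xb ab.
    have [_ E] := m12 _ _ mx0 mxb.
    have sE t : ((fun t => (slice a b t)%:E) \_ `[x, +oo[) t = (slice (Num.max x a) b t)%:E.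
      rewrite patchE /slice ge_max; case: ifPn; first by rewrite inE/= in_itv/= andbT => ->.
      by rewrite notin_setE/= in_itv/= andbT => /negP/negbTE ->.
    by under eq_integral => t _ do rewrite sE; rewrite E;
      apply: eq_integral => t _; rewrite sE.
  (* t e^-t is the inverse of the weight e^t/t *)
  pose k t : \bar R := (\1_(B `&` `[a, b[) t * (t * expR (- t)))%:E.
  have k0 t : (0 <= k t)%E.
    rewrite /k indicE; case: (boolP (t \in _)) => [|_]; last by rewrite mul0r.
    rewrite inE/= in_itv/= => -[_ /andP[at_ _]].
    by rewrite lee_fin mul1r mulr_ge0 ?expR_ge0// (le_trans (ltW a0)).
  have mBab : measurable (B `&` `[a, b[) by exact: measurableI.
  have mk : measurable_fun setT k.
    apply/measurable_EFinP; apply: measurable_funM; first exact: measurable_indic.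
    by apply: measurable_funM => //; apply: measurableT_comp => //; apply: measurableT_comp.
  have kE (m : {measure set R -> \bar R}) :
      (m (B `&` `[a, b[) = \int[mdens m mS S0]_t k t)%E.
    rewrite ge0_integral_mdens// -[in LHS](setIT (B `&` _)) -integral_indic//.
    apply: eq_integral => t _; rewrite /k -EFinM; congr EFin; rewrite !indicE.
    case: (boolP (t \in _)) => [|_]; last by rewrite !mul0r.
    rewrite inE/= in_itv/= => -[_ tab]; rewrite /slice tab mul1r.
    have t0 : 0 < t by case/andP: tab => at_ _; exact: lt_le_trans at_.
    by rewrite expRN; field; rewrite !gt_eqF ?expR_gt0.
  by rewrite !kE; apply: eq_measure_integral => C mC _; exact: n12.
have split0 (m : {measure set R -> \bar R}) : m `]-oo, 0]%classic = 0%E ->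
    m A = m (A `&` `]0, +oo[).
  move=> m0; have E : A = (A `&` `]-oo, 0]) `|` (A `&` `]0, +oo[).
    by rewrite -setIUr -setCitvl setUv setIT.
  rewrite {1}E measureU//; last 3 first.
  - exact: measurableI.
  - exact: measurableI.
  - by rewrite setIACA -setCitvl setICr setI0.
  rewrite (subset_measure0 _ _ _ m0) ?add0e//; exact: measurableI.
rewrite (split0 _ m10) (split0 _ m20).
(* n+1 keeps the left end point positive and the interval nonempty *)
pose Fn n : set R := A `&` `[n.+1%:R^-1, n.+1%:R + 1[.
have mFn n : measurable (Fn n) by exact: measurableI.
have UFn : \bigcup_n Fn n = A `&` `]0, +oo[.
  apply/seteqP; split => t.
    move=> [n _ [At]] /=; rewrite !in_itv/= andbT => /andP[nt _]; split=> //.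
    by rewrite (lt_le_trans _ nt)// invr_gt0.
  move=> [At]; rewrite /= in_itv/= andbT => t0.
  exists (Num.truncn (t + t^-1)) => //; split=> //=; rewrite in_itv/=.
  have ti0 : 0 < t^-1 by rewrite invr_gt0.
  have tt := truncnS_gt (t + t^-1).
  rewrite -[X in _ <= X <_]invrK lef_pV2 ?posrE// ?ltr0n//.
  apply/andP; split; first by rewrite (le_trans _ (ltW tt))// lerDr ltW.
  by rewrite invrK ltr_wpDr// (lt_trans _ tt)// ltrDl.
have ndFn : nondecreasing_seq Fn.
  move=> i j ij; apply/subsetPset; apply: setIS => t /=; rewrite !in_itv/= => /andP[it ti].
  rewrite (le_trans _ it) ?lef_pV2 ?posrE ?ler_nat//=.
  by rewrite (lt_le_trans ti)// lerD2r ler_nat.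
have mU : measurable (\bigcup_n Fn n) by rewrite UFn; exact: measurableI.
rewrite -UFn.
have c1 := nondecreasing_cvg_mu (mu := m1) mFn mU ndFn.
have c2 := nondecreasing_cvg_mu (mu := m2) mFn mU ndFn.
have E : m1 \o Fn = m2 \o Fn.
  apply/funext => n; apply: key => //.
  rewrite (@le_lt_trans _ _ 1)// ?invf_le1// ?ler1n// ltrDr//.
by rewrite E in c1; exact: (cvg_unique _ c1 c2).
Qed.

End slices_determine_measures.

(** * The maps phi and phi' are inverse to each other *)

Section level_law.
Context (R : realType)
  dX (OmX : measurableType dX) (P : probability OmX R)
  (X : {RV P >-> R}).
Local Notation H := (Hq X).
Local Notation leb := (@lebesgue_measure R).
Implicit Types (n : nat) (a b x y z : R).

(** The weight e^lvl/lvl cancels [rincr 0], so the integral is the length of the set where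
    a <= lvl < b. *)
Lemma integral_slice_lvl a b : 0 < a -> a < b ->
  (\int[leb]_z ((slice a b (lvl X z))%:E * (rincr X 0 z)%:E) = (H b - H a)%:E)%E.
Proof.
move=> a0 ab; have b0 := lt_trans a0 ab.
have Hab : H a <= H b by rewrite Hq_nondecreasing// ltW.
pose S : set R := `[H a, H b[%classic.
have mS : measurable S by exact: measurable_itv.
transitivity (\int[leb]_(z in S) (cst 1 z))%E; last first.
  rewrite integral_cst//= mul1e /S lebesgue_measure_itv/= lte_fin.
  move: Hab; rewrite le_eqVlt => /orP[/eqP ->|->]; last by rewrite EFinB.
  by rewrite ltxx subrr.
rewrite [RHS]integral_mkcond; apply: eq_integral => z _; rewrite patchE.
case: ifPn => [|].
  rewrite inE /S/= in_itv/= lvl_slice// => /andP[F1 lab].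
  rewrite /slice lab /rincr F1 expr1 divr1 -EFinM; congr EFin.
  have l0 : lvl X z != 0 by rewrite gt_eqF// (lt_le_trans a0)//; case/andP: lab.
  by rewrite expRN; field; rewrite l0 gt_eqF ?expR_gt0.
rewrite notin_setE /S/= in_itv/= lvl_slice// => /negP; rewrite negb_and.
rewrite /slice /rincr => /orP[/negbTE ->|/negbTE ->]; first by rewrite mule0.
by rewrite mul0e.
Qed.

Let mrincr : measurable_fun setT (rincr X 0) := measurable_rincr X 0.

Lemma rincr0_lvl0 z : lvl X z <= 0 -> rincr X 0 z = 0.
Proof.
move=> l0; have lE : lvl X z = 0 by apply/eqP; rewrite eq_le l0 lvl_full_ge0.
by rewrite /rincr lE; case: ifP => // _; rewrite expr1 !mul0r.
Qed.

Context d (Om : measurableType d) (PT : probability Om R)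
  (T : {RV PT >-> R}).
Hypothesis T0 : PT [set w | 0 < T w] = 1%E.
Hypothesis slices : forall a b, 0 < a -> a < b ->
  (\int[PT]_w (slice a b (T w))%:E = (H b - H a)%:E)%E.

(** The law of T and the image by the level of the measure of density [rincr 0] have the same
    slices. *)
Lemma lvl_law (k : R -> \bar R) :
  measurable_fun setT k -> (forall x, 0 <= k x)%E ->
  (\int[leb]_z (k (lvl X z) * (rincr X 0 z)%:E) = \int[PT]_w k (T w))%E.
Proof.
pose p' : {measure set R -> \bar R} := pushforward (mdens leb mrincr (rincr_ge0 X 0)) (lvl X).
pose p := p' (measurable_lvl X).
pose m : {measure set R -> \bar R} := distribution PT T.
have pE (f : R -> \bar R) : measurable_fun setT f -> (forall x, 0 <= f x)%E ->
    (\int[p]_t f t = \int[leb]_z (f (lvl X z) * (rincr X 0 z)%:E))%E.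
  move=> mf f0; have mlvl := measurable_lvl X.
  have mfl : measurable_fun setT (f \o lvl X) by exact: (measurableT_comp mf mlvl).
  rewrite ge0_integral_pushforward// preimage_setT.
  by rewrite ge0_integral_mdens//; move=> y; exact: f0.
have mE (f : R -> \bar R) : measurable_fun setT f -> (forall x, 0 <= f x)%E ->
    (\int[m]_t f t = \int[PT]_w f (T w))%E.
  by move=> mf f0; rewrite ge0_integral_distribution.
have pm A : measurable A -> p A = m A.
  apply: (@eq_measure_slices R p m).
  - rewrite /p /p' /= /pushforward /mdens integral0_eq// => z /=.
    by rewrite in_itv/= => l0; rewrite rincr0_lvl0.
  - rewrite /m /= /distribution /pushforward.
    rewrite (_ : T @^-1` _ = ~` (T @^-1` `]0, +oo[)); last first.
      by rewrite preimage_setC setCitvr.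
    rewrite probability_setC; last exact: measurable_RV_preimage.
    rewrite (_ : T @^-1` _ = [set w | 0 < T w]) ?T0 ?subee//.
    by apply/seteqP; split => w /=; rewrite in_itv/= andbT.
  - move=> a b a0 ab; have ms := @measurable_slice_fun R a b a0.
    have s0 t : (0 <= (slice a b t)%:E)%E by rewrite lee_fin slice_ge0.
    have mse : measurable_fun setT (fun t => (slice a b t)%:E) by exact/measurable_EFinP.
    by rewrite pE// mE// slices// integral_slice_lvl// ltry.
move=> mk k0; rewrite -pE// -mE//.
by apply: eq_measure_integral => A mA _; exact: pm.
Qed.

Lemma integral_rincr_moment n :
  (\int[leb]_z (rincr X n z)%:E = (n.+1`!%:R^-1)%:E * \int[PT]_w (`|T w| ^+ n)%:E)%E.
Proof.
have f0 : n.+1`!%:R != 0 :> R by rewrite pnatr_eq0 -lt0n fact_gt0.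
rewrite -(@lvl_law (fun t => (`|t| ^+ n)%:E)); last 2 first.
- by apply/measurable_EFinP; apply: measurable_funX; exact: normr_measurable.
- by move=> t; rewrite lee_fin exprn_ge0.
rewrite -ge0_integralZl//.
- apply: eq_integral => z _; rewrite -!EFinM; congr EFin.
  by rewrite ger0_norm ?lvl_full_ge0// rincr_lvl mulKf.
- apply/measurable_EFinP; apply: measurable_funM; last exact: measurable_rincr.
  apply: measurable_funX.
  exact: (measurableT_comp (@normr_measurable _ _) (measurable_lvl X)).
- by move=> z _; rewrite lee_fin mulr_ge0 ?rincr_ge0 ?exprn_ge0.
Qed.

End level_law.

Section record_mean_integral.
Context (R : realType)
  dX (OmX : measurableType dX) (P : probability OmX R)
  (X : {RV P >-> R})
  dV (OmV : measurableType dV) (Q : probability OmV R)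
  (V : nat -> {RV Q >-> R}).
Hypothesis hV : iid_uniform V.
Hypothesis finX : forall n, (rho_abs X V n < +oo)%E.
Local Notation H := (Hq X).
Local Notation leb := (@lebesgue_measure R).
Implicit Types (n : nat) (a b x y z : R).

(** The signed form of [integral_recR]. *)
Lemma rho_integral n : rho X V n =
  \int[leb]_(y in `]0, +oo[) (y ^+ n / n`!%:R * expR (- y) * H y).
Proof.
have c0 y : 0 < y -> 0 <= y ^+ n / n`!%:R * expR (- y).
  by move=> y0; rewrite mulr_ge0 ?expR_ge0// divr_ge0// exprn_ge0// ltW.
have mx (u h : R) : 0 <= u -> Num.max h 0 * u = Num.max (u * h) 0.
  by move=> u0; rewrite mulrC maxr_pMr// mulr0.
rewrite (rhoE finX) /Rintegral integralE.
have mp : mean_pos X V n = (\int[leb]_(y in `]0%R, +oo[)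
    ((fun y => (y ^+ n / n`!%:R * expR (- y) * H y)%:E)^\+ y))%E.
  rewrite /mean_pos (integral_recR X hV n (f := fun r => (Num.max r 0)%:E))//.
  - apply: eq_integral => y; rewrite inE/= in_itv/= andbT => y0.
    by rewrite funeposE -EFinM mx ?c0// EFin_max.
  - by apply/measurable_EFinP; apply: measurable_maxr.
  - by move=> x; rewrite lee_fin le_max lexx orbT.
have mn : mean_neg X V n = (\int[leb]_(y in `]0%R, +oo[)
    ((fun y => (y ^+ n / n`!%:R * expR (- y) * H y)%:E)^\- y))%E.
  rewrite /mean_neg (integral_recR X hV n (f := fun r => (Num.max (- r) 0)%:E))//.
  - apply: eq_integral => y; rewrite inE/= in_itv/= andbT => y0.
    by rewrite funenegE -EFinM mx ?c0// mulrN EFin_max EFinN.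
  - by apply/measurable_EFinP; apply: measurable_maxr.
  - by move=> x; rewrite lee_fin le_max lexx orbT.
have [fp fn] := mean_fin finX n.
by rewrite -mp -mn [RHS](fineB fp fn).
Qed.

Lemma integrable_Hq : leb.-integrable `]0%R, +oo[ (fun y => (expR (- y) * H y)%:E).
Proof.
apply/integrableP; split.
  apply: measurable_funTS; apply/measurable_EFinP; apply: measurable_funM.
    by apply: measurableT_comp => //; apply: measurableT_comp.
  exact: measurable_Hq.
have := (rho_abs_lty X hV 0).1 (finX 0).
rewrite (_ : integral _ _ _ =
  (\int[leb]_(y in `]0%R, +oo[) `|(expR (- y) * H y)%:E|)%E)//.
apply: eq_integral => y _.
by rewrite expr0 mul1r abse_EFin normrM (ger0_norm (expR_ge0 _)).
Qed.

Lemma Hstar_Hq : (exists a b, [/\ 0 < a, 0 < b & H a < H b]) -> Hstar H.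
Proof.
move=> [a [b [a0 b0 ab]]]; split.
- by exists a, b; split=> //; rewrite lt_eqF.
- by move=> x y x0 xy; exact: Hq_nondecreasing.
- by move=> y y0; exact: Hq_left_continuous.
- by move=> m; exact/(rho_abs_lty X hV m).
Qed.

End record_mean_integral.

Section normalised.
Context (R : realType)
  dY (OmY : measurableType dY) (PY : probability OmY R)
  (Y : {RV PY >-> R}).
Context dT (OmT : measurableType dT) (PT : probability OmT R)
  (T : {RV PT >-> R}).
Local Notation H := (Hq Y).
Local Notation leb := (@lebesgue_measure R).
Implicit Types (n : nat) (a b x y z : R).

(** The quantile function of Y has the increments that the definition of phi' prescribes. *)
Definition same_slices :=
  forall a b, 0 < a -> a < b -> (\int[PT]_w (slice a b (T w))%:E = (H b - H a)%:E)%E.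

(** Equal increments leave one constant, which the choice of c absorbs. *)
Lemma same_slices_is_phi' : same_slices ->
  leb.-integrable `]0%R, +oo[ (fun y => (expR (- y) * H y)%:E) ->
  \int[leb]_(y in `]0, +oo[) (expR (- y) * H y) = 0 -> is_phi' T Y.
Proof.
move=> sl intH H_0; pose c := phi'_H0 T 0 1 - H 1.
have HE y : 0 < y -> phi'_H0 T c y = H y.
  move=> y0.
  have shift x : phi'_H0 T c x = phi'_H0 T 0 x - c by rewrite /phi'_H0 subr0.
  have E a b : 0 < a -> a < b -> phi'_H0 T 0 b - phi'_H0 T 0 a = H b - H a.
    by move=> a0 ab; apply: EFin_inj; rewrite -sl// (phi'_H0_slice T 0 a0 ab).
  rewrite shift /c; have [y1|y1|->] := ltgtP y 1; last by ring.
    by have := E y 1 y0 y1; lra.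
  by have := E 1 y ltr01 y1; lra.
exists c; split.
- apply: eq_integrable intH => // y.
  by rewrite inE/= in_itv/= andbT => y0; rewrite HE.
- rewrite -[RHS]H_0; apply: eq_Rintegral => y.
  by rewrite inE/= in_itv/= andbT => y0; rewrite HE.
- move=> u u01; rewrite quantile_HqL// HE//.
  by case/andP: u01 => u0 u1; rewrite -uexp_lt uexp0 uexp_L.
Qed.

Context dV (OmV : measurableType dV) (Q : probability OmV R)
  (V : nat -> {RV Q >-> R}).
Hypothesis hV : iid_uniform V.
Hypothesis hT : in_T T.

(** Finiteness at n = 0 is part of the definition of phi'; it propagates because the integral of
    the n-th increment is a moment of T. *)
Lemma is_phi'_same_slices : is_phi' T Y ->
  [/\ same_slices, forall n, (rho_abs Y V n < +oo)%E & rho Y V 0 = 0].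
Proof.
move=> [c [int zero qE]].
have HE y : 0 < y -> H y = phi'_H0 T c y.
  by move=> y0; rewrite /Hq qE ?uexp01// L_uexp.
have sl : same_slices.
  move=> a b a0 ab; rewrite (phi'_H0_slice T c a0 ab) !HE//.
  exact: lt_trans ab.
have finY n : (rho_abs Y V n < +oo)%E.
  elim: n => [|n IH].
    apply/(rho_abs_lty Y hV 0); have /integrableP[_] := int.
    rewrite (_ : integral _ _ _ =
      (\int[leb]_(y in `]0%R, +oo[) (y ^+ 0 * expR (- y) * `|H y|)%:E)%E)//.
    apply: eq_integral => y; rewrite inE/= in_itv/= andbT => y0.
    by rewrite HE// expr0 mul1r normrM (ger0_norm (expR_ge0 _)).
  apply: (rho_abs_ltyS hV IH); have [T0 Tm] := hT.
  rewrite (integral_rincr_moment T0 sl); apply: lte_mul_pinfty => //.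
  by have := Tm n; rewrite unlock.
split=> //; rewrite (rho_integral hV finY) -[RHS]zero; apply: eq_Rintegral => y.
by rewrite inE/= in_itv/= andbT => y0; rewrite HE// expr0 fact0 divr1 mul1r.
Qed.

End normalised.

Section phi_inverse.
Context (R : realType)
  dX (OmX : measurableType dX) (P : probability OmX R)
  (X : {RV P >-> R})
  dV (OmV : measurableType dV) (Q : probability OmV R)
  (V : nat -> {RV Q >-> R}).
Hypothesis hV : iid_uniform V.
Hypothesis finX : forall n, (rho_abs X V n < +oo)%E.
Local Notation D := (rho X V 1 - rho X V 0).
Hypothesis D0 : 0 < D.
Local Notation H := (Hq X).
Local Notation leb := (@lebesgue_measure R).
Implicit Types (n : nat) (a b x y z : R).

Lemma is_phi_slices dT (OmT : measurableType dT)
    (PT : probability OmT R) (T : {RV PT >-> R}) a b :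
  is_phi X T -> 0 < a -> a < b ->
  (\int[PT]_w (slice a b (T w))%:E = ((H b - H a) / D)%:E)%E.
Proof.
move=> hT a0 ab; have ms := @measurable_slice_fun R a b a0.
have s0 t : 0 <= slice a b t by exact: slice_ge0.
rewrite (integral_phi hV finX D0 hT (k := fun t => (slice a b t)%:E)).
- transitivity (\int[leb]_z ((D^-1)%:E * ((slice a b (lvl X z))%:E * (rincr X 0 z)%:E)))%E.
    by apply: eq_integral => z _; rewrite -!EFinM; congr EFin; ring.
  rewrite ge0_integralZl//.
  + by rewrite integral_slice_lvl// -EFinM mulrC.
  + apply/measurable_EFinP; apply: measurable_funM; last exact: measurable_rincr.
    exact: (measurableT_comp ms (measurable_lvl X)).
  + by move=> z _; rewrite lee_fin mulr_ge0 ?rincr_ge0.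
  + by rewrite lee_fin invr_ge0 ltW.
- exact/measurable_EFinP.
- by move=> x; rewrite lee_fin.
Qed.

Let mphi := measurable_phi_density hV finX.
Let phi0 := phi_density_ge0 hV finX D0.
Let nu : {measure set (measurableTypeR R) -> \bar R} := mdens leb mphi phi0.

Let nuT : nu setT = 1%E.
Proof.
rewrite /nu /= /mdens.
transitivity (\int[leb]_z ((D^-1)%:E * (rincr X 0 z)%:E))%E.
  by apply: eq_integral => z _; rewrite (phi_densityE hV finX) -EFinM mulrC.
rewrite ge0_integralZl//.
- by rewrite (rho_diff hV finX) -EFinM mulVf// gt_eqF.
- by apply/measurable_EFinP; exact: measurable_rincr.
- by move=> z _; rewrite lee_fin rincr_ge0.
- by rewrite lee_fin invr_ge0 ltW.
Qed.

(** The identity of the line, under the measure with density [phi_density]. *)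
Lemma exists_phi_density_RV :
  exists (PV : probability (measurableTypeR R) R) (W : {RV PV >-> R}),
    forall A : set R, measurable A ->
      distribution PV W A = (\int[leb]_(x in A) (phi_density X x)%:E)%E.
Proof.
pose PV : probability (measurableTypeR R) R :=
  HB.pack (Measure.sort nu) (Measure_isProbability.Build _ _ _ nu nuT).
have mid : measurable_fun (setT : set (measurableTypeR R)) (fun x : measurableTypeR R => x : R).
  by [].
pose W : {RV PV >-> R} := HB.pack (fun x : measurableTypeR R => x : R)
  (isMeasurableFun.Build _ _ _ _ _ mid).
by exists PV, W.
Qed.

Lemma exists_phi : exists dT (OmT : measurableType dT)
  (PT : probability OmT R) (T : {RV PT >-> R}), is_phi X T.
Proof.
have [PV [W lawW]] := exists_phi_density_RV.
have mT : measurable_fun setT (fun v => lvl X (W v)).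
  exact: (measurableT_comp (measurable_lvl X)).
pose T : {RV PV >-> R} := HB.pack (fun v => lvl X (W v))
  (isMeasurableFun.Build _ _ _ _ _ mT).
exists _, _, PV, T, _, _, PV, W; split=> //.
Qed.

(** The level of a variable with density [rincr 0] has the law of T by [lvl_law]. *)
Lemma same_slices_is_phi dT (OmT : measurableType dT)
    (PT : probability OmT R) (T : {RV PT >-> R}) :
  PT [set w | 0 < T w] = 1%E -> same_slices X T -> D = 1 -> is_phi X T.
Proof.
move=> T0 sl D1; have [PV [W lawW]] := exists_phi_density_RV.
exists _, _, PV, W; split=> // A mA.
have mlA : measurable (lvl X @^-1` A).
  by rewrite -[X in measurable X]setTI; exact: (measurable_lvl X).
have -> : PV ((fun v => L (cdfR X (W v))) @^-1` A) = distribution PV W (lvl X @^-1` A) by [].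
rewrite lawW//.
have mk : measurable_fun setT (fun t : R => (\1_A t : R)%:E).
  by apply/measurable_EFinP; exact: measurable_indic.
transitivity (\int[PT]_w (\1_A (T w) : R)%:E)%E.
  rewrite -[X in PT X]setIT -integral_indic//; last exact: measurable_RV_preimage.
rewrite -(lvl_law T0 sl (k := fun t => (\1_A t : R)%:E))//.
rewrite [RHS]integral_mkcond; apply: eq_integral => z _.
rewrite patchE (phi_densityE hV finX) D1 divr1 indicE.
have [zA|zA] := pselect (A (lvl X z)); first by rewrite !mem_set// mul1e.
by rewrite !memNset// mul0e.
Qed.

End phi_inverse.

Section phi'_is_inverse.
Context (R : realType)
  dY (OmY : measurableType dY) (PY : probability OmY R)
  (Y : {RV PY >-> R})
  dV (OmV : measurableType dV) (Q : probability OmV R)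
  (V : nat -> {RV Q >-> R}).
Hypothesis hV : iid_uniform V.
Context dT (OmT : measurableType dT) (PT : probability OmT R)
  (T : {RV PT >-> R}).
Hypothesis hT : in_T T.
Local Notation H := (Hq Y).
Local Notation leb := (@lebesgue_measure R).

Let w0 (y : R) (h : R) : y ^+ 0 / 0`!%:R * expR (- y) * h = expR (- y) * h.
Proof. by rewrite expr0 fact0 divr1 mul1r. Qed.

Let w1 (y : R) (h : R) : y ^+ 1 / 1`!%:R * expR (- y) * h = y * expR (- y) * h.
Proof. by rewrite expr1 divr1. Qed.

Lemma in_H0_is_phi' : in_H0 Y -> is_phi Y T -> is_phi' T Y.
Proof.
move=> [H1 [hH1 z0 z1] E] hphi.
have hY : in_Hstar Y by exists H1.
have finY := Hstar_rho_abs hV hY; have HE := in_HstarE E.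
have H_0 : \int[leb]_(y in `]0, +oo[) (expR (- y) * H y) = 0.
  rewrite -[RHS]z0; apply: eq_Rintegral => y.
  by rewrite inE/= in_itv/= andbT => y0; rewrite HE.
have r0 : rho Y V 0 = 0.
  rewrite (rho_integral hV finY) -[RHS]H_0; apply: eq_Rintegral => y _.
  by rewrite w0.
have r1 : rho Y V 1 = 1.
  rewrite (rho_integral hV finY) -[RHS]z1; apply: eq_Rintegral => y.
  by rewrite inE/= in_itv/= andbT => y0; rewrite w1 HE.
have D0 := Hstar_rho_diff_gt0 hV hY.
apply: same_slices_is_phi' (integrable_Hq hV finY) H_0 => a b a0 ab.
by rewrite (is_phi_slices hV finY D0 hphi a0 ab) r0 r1 subr0 divr1.
Qed.

(** The function H is not constant: otherwise the slices of Y would be empty, [rincr 0] would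
    vanish, and rho_1 - rho_0 = E T^0 = 1 would fail. *)
Lemma is_phi'_in_H0 : is_phi' T Y -> in_H0 Y /\ is_phi Y T.
Proof.
move=> /(is_phi'_same_slices hV hT)[sl finY r0]; have [T0 Tm] := hT.
have D1 : rho Y V 1 - rho Y V 0 = 1.
  apply: EFin_inj; rewrite -(rho_diff hV finY) (integral_rincr_moment T0 sl).
  under eq_integral do rewrite expr0.
  have -> : (\int[PT]_w 1 = 1)%E.
    transitivity (1%:E * PT setT)%E; first exact: integral_cst.
    by rewrite probability_setT mul1e.
  by rewrite (_ : 1`!%:R = 1 :> R)// invr1 mul1e.
have D0 : 0 < rho Y V 1 - rho Y V 0 by rewrite D1.
split; last exact: (same_slices_is_phi hV finY D0).
exists H; last by move=> u u01; exact: quantile_HqL.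
split.
- apply: (Hstar_Hq hV finY); apply: contrapT => const.
  have z : (\int[leb]_z (rincr Y 0 z)%:E = 0)%E.
    apply: integral0_eq => z _; congr EFin.
    have [l0|l0] := leP (lvl Y z) 0; first exact: rincr0_lvl0.
    have l1 : 0 < lvl Y z + 1 by rewrite addr_gt0.
    have [F1|F1] := ltP (cdfR Y z) 1; last by rewrite /rincr ltNge F1.
    (* z lies in the slice from lvl z to lvl z + 1, so H is not constant there *)
    have : H (lvl Y z) <= z < H (lvl Y z + 1) by rewrite lvl_slice// F1 lexx ltrDl ltr01.
    move=> /andP[Hz zH]; exfalso; apply: const.
    by exists (lvl Y z), (lvl Y z + 1); split=> //; exact: le_lt_trans zH.
  by move: D0; rewrite -lte_fin -(rho_diff hV finY) z ltxx.
- rewrite -[RHS]r0 (rho_integral hV finY); apply: eq_Rintegral => y _.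
  by rewrite w0.
- rewrite -[RHS]D1 r0 subr0 (rho_integral hV finY); apply: eq_Rintegral => y _.
  by rewrite w1.
Qed.

End phi'_is_inverse.

(** * Recovering X from its expected records *)

Section law_facts.
Context (R : realType).

Lemma same_law_integral d1 d2
    (O1 : measurableType d1) (P1 : probability O1 R) (T1 : {RV P1 >-> R})
    (O2 : measurableType d2) (P2 : probability O2 R) (T2 : {RV P2 >-> R})
    (k : R -> \bar R) :
  same_law P1 P2 T1 T2 -> measurable_fun setT k -> (forall x, 0 <= k x)%E ->
  (\int[P1]_w k (T1 w) = \int[P2]_w k (T2 w))%E.
Proof.
move=> T12 mk k0.
transitivity (\int[distribution P1 T1]_x k x)%E; first by rewrite ge0_integral_distribution.
transitivity (\int[distribution P2 T2]_x k x)%E; last by rewrite ge0_integral_distribution.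
by apply: eq_measure_integral => A mA _; exact: T12.
Qed.

Lemma same_law_Hq d1 d2
    (O1 : measurableType d1) (P1 : probability O1 R) (X1 : {RV P1 >-> R})
    (O2 : measurableType d2) (P2 : probability O2 R) (X2 : {RV P2 >-> R}) :
  (forall y, 0 < y -> Hq X1 y = Hq X2 y) -> same_law P1 P2 X1 X2.
Proof.
move=> H12.
have le d3 d4 (O3 : measurableType d3) (P3 : probability O3 R) (X3 : {RV P3 >-> R})
    (O4 : measurableType d4) (P4 : probability O4 R) (X4 : {RV P4 >-> R}) x :
    (forall y, 0 < y -> Hq X3 y = Hq X4 y) -> cdfR X3 x <= cdfR X4 x.
  move=> H34; rewrite leNgt; apply/negP => F43.
  have /andP[F40 _] := cdfR01 X4 x; have /andP[_ F31] := cdfR01 X3 x.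
  pose u := (cdfR X4 x + cdfR X3 x) / 2.
  have u4 : cdfR X4 x < u by rewrite midf_lt.
  have u3 : u < cdfR X3 x by rewrite midf_lt.
  have u1 : u < 1 := lt_le_trans u3 F31.
  have u0 : 0 < u := le_lt_trans F40 u4.
  have u01 : 0 < u < 1 by rewrite u0 u1.
  have L0 : 0 < L u by rewrite -uexp_lt uexp0 uexp_L.
  have : quantile X3 u <= x by rewrite quantile_le// ltW.
  by rewrite quantile_HqL// H34// -quantile_HqL// quantile_le// leNgt u4.
have F12 x : cdfR X1 x = cdfR X2 x.
  by apply/eqP; rewrite eq_le !le// => y y0; rewrite H12.
move=> A mA; apply: (@eq_measure_tails R (distribution P1 X1) (distribution P2 X2)) => //.
  by rewrite ltey_eq fin_num_measure.
by move=> x; rewrite [LHS]RV_tail [RHS]RV_tail F12.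
Qed.

(** Both sides satisfy the same Galois connection. *)
Lemma Hq_affine d (O : measurableType d) (P : probability O R)
    (X Y : {RV P >-> R}) (r D y : R) : 0 < D ->
  (forall w, Y w = (X w - r) / D) -> 0 < y -> Hq Y y = (Hq X y - r) / D.
Proof.
move=> D0 YE y0.
have FE x : cdfR Y x = cdfR X (r + D * x).
  congr fine; congr (P _); apply/funext => w; apply/propext.
  by rewrite /preimage/= !in_itv/= YE ler_pdivrMr// lerBlDl [x * D]mulrC.
have u01 := uexp01 y0.
have key x : (Hq Y y <= x) = ((Hq X y - r) / D <= x).
  rewrite /Hq quantile_le// FE -quantile_le//.
  by rewrite ler_pdivrMr// lerBlDl [x * D]mulrC.
by apply/eqP; rewrite eq_le key lexx -key lexx.
Qed.

Lemma mgf_le d (O : measurableType d) (P : probability O R)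
    (T : {RV P >-> R}) (s t : R) :
  P [set w | 0 < T w] = 1%E -> s <= t -> ('M_P T s <= 'M_P T t)%E.
Proof.
move=> T0 st; rewrite !mgf_abs//.
have mT : measurable_fun setT (fun w => `|T w|) by exact: measurableT_comp.
apply: ge0_le_integral => //.
- by apply/measurable_EFinP; apply: measurableT_comp => //; exact: measurable_funM.
- by apply/measurable_EFinP; apply: measurableT_comp => //; exact: measurable_funM.
- by move=> w _; rewrite lee_fin ler_expR ler_wpM2r.
Qed.

Lemma mgf0 d (O : measurableType d) (P : probability O R)
    (T : {RV P >-> R}) : 'M_P T 0 = 1%E.
Proof.
rewrite /mmt_gen_fun unlock.
transitivity (\int[P]_w 1)%E.
  by apply: eq_integral => w _ /=; rewrite ?(mul0r, mulr0) expR0.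
transitivity (1%:E * P setT)%E; first exact: integral_cst.
by rewrite probability_setT mul1e.
Qed.

End law_facts.

Section uniqueness.
Context (R : realType)
  dV (OmV : measurableType dV) (Q : probability OmV R)
  (V : nat -> {RV Q >-> R}).
Hypothesis hV : iid_uniform V.
Local Notation leb := (@lebesgue_measure R).

Lemma Rintegral_expRN : \int[leb]_(y in `]0, +oo[) expR (- y) = 1.
Proof.
rewrite /Rintegral; apply: EFin_inj.
have -> : (\int[leb]_(y in `]0%R, +oo[) (expR (- y))%:E = 1)%E; last by [].
rewrite -(integral_gam R 0) integral_mkcond; apply: eq_integral => y _.
rewrite patchE /gam expr0 fact0 divr1 mul1r.
have [y0|y0] := ltP 0 y; first by rewrite mem_set//= in_itv/= y0.
by rewrite memNset//= in_itv/= andbT; apply/negP; rewrite -leNgt.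
Qed.

Lemma integrable_expRN :
  leb.-integrable `]0%R, +oo[ (fun y : R => (expR (- y))%:E).
Proof.
apply/integrableP; split.
  apply: measurable_funTS; apply/measurable_EFinP.
  by apply: measurableT_comp => //; apply: measurableT_comp.
have := integral_expRN (@ltr01 R).
rewrite (_ : integral _ _ _ = \int[leb]_(y in `]0%R, +oo[) `|(expR (- y))%:E|)%E//.
by apply: eq_integral => y _; rewrite mul1r abse_EFin ger0_norm ?expR_ge0.
Qed.

Lemma integrable_cexpRN (k : R) :
  leb.-integrable `]0%R, +oo[ (fun y : R => (k * expR (- y))%:E).
Proof.
have mI : measurable (`]0%R, +oo[%classic : set (measurableTypeR R)).
  exact: measurable_itv.
by have := integrableZl mI k integrable_expRN; apply: eq_integrable.
Qed.

Lemma Rintegral_cexpRN (k : R) :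
  \int[leb]_(y in `]0, +oo[) (k * expR (- y)) = k.
Proof. by rewrite RintegralZl ?Rintegral_expRN ?mulr1//; exact: integrable_expRN. Qed.

(** Equal increments leave a constant, and equal means force it to be 0. *)
Lemma Hq_unique d1 d2
    (O1 : measurableType d1) (P1 : probability O1 R) (X1 : {RV P1 >-> R})
    (O2 : measurableType d2) (P2 : probability O2 R) (X2 : {RV P2 >-> R}) :
  (forall n, (rho_abs X1 V n < +oo)%E) -> (forall n, (rho_abs X2 V n < +oo)%E) ->
  rho X1 V 0 = rho X2 V 0 ->
  (forall a b, 0 < a -> a < b -> Hq X1 b - Hq X1 a = Hq X2 b - Hq X2 a) ->
  forall y, 0 < y -> Hq X1 y = Hq X2 y.
Proof.
move=> f1 f2 r12 H12; pose k := Hq X1 1 - Hq X2 1.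
have HE y : 0 < y -> Hq X1 y = Hq X2 y + k.
  move=> y0; rewrite /k; have [y1|y1|->] := ltgtP y 1; last by ring.
    by have := H12 y 1 y0 y1; lra.
  by have := H12 1 y ltr01 y1; lra.
suff k0 : k = 0 by move=> y y0; rewrite HE// k0 addr0.
have : rho X1 V 0 = rho X2 V 0 + k.
  rewrite (rho_integral hV f1) (rho_integral hV f2) -[X in _ = _ + X]Rintegral_cexpRN.
  rewrite -RintegralD//.
  - apply: eq_Rintegral => y; rewrite inE/= in_itv/= andbT => y0.
    by rewrite expr0 fact0 divr1 !mul1r HE// mulrDr [X in _ + X]mulrC.
  - apply: eq_integrable (integrable_Hq hV f2) => // y _.
    by rewrite /= expr0 fact0 divr1 mul1r.
  - exact: integrable_cexpRN.
rewrite r12; lra.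
Qed.

End uniqueness.

Section recovery.
Context (R : realType)
  dX (OmX : measurableType dX) (P : probability OmX R)
  (X : {RV P >-> R})
  dV (OmV : measurableType dV) (Q : probability OmV R)
  (V : nat -> {RV Q >-> R}).
Hypotheses (hV : iid_uniform V) (hX : in_Hstar X).
Local Notation rho := (rho X V).
Local Notation D := (rho 1 - rho 0).
Local Notation leb := (@lebesgue_measure R).
Let finX := Hstar_rho_abs hV hX.
Let D0 := Hstar_rho_diff_gt0 hV hX.

Lemma exists_radius dT (OmT : measurableType dT)
    (PT : probability OmT R) (T : {RV PT >-> R}) : is_phi X T ->
  (exists2 p : R, 1 < p & ('E_P[fun x => (Num.max (X x) 0 `^ p)%R] < +oo)%E) ->
  exists e0 : R, [/\ 0 < e0 < 1 & forall e : R, 0 < e <= e0 ->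
    (G_w X V e < +oo)%E /\ ('M_PT T e < +oo)%E].
Proof.
move=> hT Ep; have [e1 e10 Ge] := power_moment_G_w_lty hV hX Ep.
have [a a0 Ma] : exists2 a : R, 0 < a & ('M_PT T a < +oo)%E.
  by apply: (near_rho_mgf hV hX hT); apply: (G_w_near_rho hV hX); exists e1.
pose e0 := Num.min 2^-1 (Num.min e1 a).
have e2 : e0 <= 2^-1 by rewrite ge_min lexx.
have ee1 : e0 <= e1 by rewrite !ge_min lexx orbT.
have ea : e0 <= a by rewrite !ge_min lexx !orbT.
have e00 : 0 < e0 by rewrite !lt_min e10 a0 invr_gt0 ltr0n.
exists e0; split.
  by rewrite e00 (le_lt_trans e2)// invf_lt1// ltr1n.
move=> e /andP[ep ee]; split.
  by apply: le_lt_trans Ge; apply: G_w_le; [exact: ltW|exact: le_trans ee1].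
apply: le_lt_trans Ma; apply: mgf_le; last exact: le_trans ea.
exact: (phi_gt0 hV finX D0 hT).
Qed.

(** Y = (X - rho_0) / (rho_1 - rho_0) has the slices of T by [is_phi_slices]. *)
Lemma recover_affine dT (OmT : measurableType dT)
    (PT : probability OmT R) (T : {RV PT >-> R})
    d' (Om' : measurableType d')
    (P' : probability Om' R) (T' : {RV P' >-> R}) :
  is_phi X T -> same_law PT P' T T' ->
  exists Y : {RV P >-> R}, is_phi' T' Y /\
    same_law P P X (fun x => rho 0 + D * Y x).
Proof.
move=> hT TT'; have mY : measurable_fun setT (fun w => (X w - rho 0) / D).
  by apply: measurable_funM => //; exact: measurable_funB.
pose Y : {RV P >-> R} := HB.pack (fun w => (X w - rho 0) / D)
  (isMeasurableFun.Build _ _ _ _ _ mY).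
have YE w : Y w = (X w - rho 0) / D by [].
have HE y : 0 < y -> Hq Y y = (Hq X y - rho 0) / D by exact: Hq_affine.
exists Y; split; last first.
  move=> A mA; congr (P _); apply/funext => w; rewrite /preimage/=.
  by rewrite mulrCA mulfV ?gt_eqF// mulr1 subrKC.
have sl : same_slices Y T'.
  move=> a b a0 ab; have b0 := lt_trans a0 ab.
  rewrite -(same_law_integral (k := fun t => (slice a b t)%:E) TT').
  - rewrite (is_phi_slices hV finX D0 hT a0 ab) !HE//; congr EFin.
    by rewrite -mulrBl; congr (_ / _); ring.
  - by apply/measurable_EFinP; exact: measurable_slice_fun.
  - by move=> t; rewrite lee_fin slice_ge0.
have intX := integrable_Hq hV finX.
have intY1 : leb.-integrable `]0%R, +oo[ (fun y => (D^-1 * (expR (- y) * Hq X y))%:E).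
  have mI : measurable (`]0%R, +oo[%classic : set (measurableTypeR R)) by exact: measurable_itv.
  by have := integrableZl mI D^-1 intX; apply: eq_integrable.
have intY2 := @integrable_cexpRN R (- (rho 0 / D)).
have splitY y : 0 < y -> expR (- y) * Hq Y y =
    D^-1 * (expR (- y) * Hq X y) + - (rho 0 / D) * expR (- y).
  by move=> y0; rewrite HE//; ring.
apply: same_slices_is_phi' => //.
- have mI : measurable (`]0%R, +oo[%classic : set (measurableTypeR R)) by exact: measurable_itv.
  have := integrableD mI intY1 intY2; apply: eq_integrable => // y.
  by rewrite inE/= in_itv/= andbT => y0; rewrite splitY// EFinD.
- transitivity (\int[leb]_(y in `]0, +oo[)
      (D^-1 * (expR (- y) * Hq X y) + - (rho 0 / D) * expR (- y))).
    by apply: eq_Rintegral => y; rewrite inE/= in_itv/= andbT => y0; rewrite splitY.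
  rewrite RintegralD// Rintegral_cexpRN RintegralZl//.
  have -> : \int[leb]_(y in `]0, +oo[) (expR (- y) * Hq X y) = rho 0.
    rewrite (rho_integral hV finX); apply: eq_Rintegral => y _.
    by rewrite expr0 fact0 divr1 mul1r.
  by ring.
Qed.

End recovery.

Section determination.
Context (R : realType)
  dX (OmX : measurableType dX) (P : probability OmX R)
  (X : {RV P >-> R})
  dV (OmV : measurableType dV) (Q : probability OmV R)
  (V : nat -> {RV Q >-> R}).
Hypotheses (hV : iid_uniform V) (hX : in_Hstar X).
Let finX := Hstar_rho_abs hV hX.
Let D0 := Hstar_rho_diff_gt0 hV hX.

(** G_rho gives rho_0 as its value at 0, and rho_1 - rho_0 as the derivative of (1 - t) G_rho at 0,
    because M_T(0) = 1; then M_T near 0, the law of phi(X), its slices, and the quantile function. *)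
Lemma G_rho_determines_law d' (Om' : measurableType d')
    (P' : probability Om' R) (X' : {RV P' >-> R}) : in_Hstar X' ->
  (exists2 p : R, 1 < p & ('E_P[fun x => (Num.max (X x) 0 `^ p)%R] < +oo)%E) ->
  (exists2 p : R, 1 < p & ('E_P'[fun x => (Num.max (X' x) 0 `^ p)%R] < +oo)%E) ->
  (\forall t \near (0 : R), G_rho X' V t = G_rho X V t) ->
  same_law P P' X X'.
Proof.
move=> hX' Ep Ep' near_eq.
have finX' := Hstar_rho_abs hV hX'; have D0' := Hstar_rho_diff_gt0 hV hX'.
have [dT [OmT [PT [T hT]]]] := exists_phi hV finX D0.
have [dT' [OmT' [PT' [T' hT']]]] := exists_phi hV finX' D0'.
have [e1 [/andP[e10 e11] H1]] := exists_radius hV hX hT Ep.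
have [e2 [/andP[e20 e21] H2]] := exists_radius hV hX' hT' Ep'.
have [e3 /= e30 H3] := near_eq.
have E3 t : `|t| < e3 -> G_rho X' V t = G_rho X V t.
  by move=> te; apply: H3; rewrite /= sub0r normrN.
pose e := Num.min e3 (Num.min e1 e2).
have ee1 : e <= e1 by rewrite !ge_min lexx orbT.
have ee2 : e <= e2 by rewrite !ge_min lexx !orbT.
have ee3 : e <= e3 by rewrite ge_min lexx.
have e0 : 0 < e by rewrite !lt_min e30 e10 e20.
have e01 : 0 < e < 1 by rewrite e0 (le_lt_trans ee1).
have [G1 M1] : (G_w X V e < +oo)%E /\ ('M_PT T e < +oo)%E by apply: H1; rewrite e0.
have [G2 M2] : (G_w X' V e < +oo)%E /\ ('M_PT' T' e < +oo)%E by apply: H2; rewrite e0.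
have S1 := G_rho_mgf hV finX D0 hT e01 G1 M1.
have S2 := G_rho_mgf hV finX' D0' hT' e01 G2 M2.
have rho0E : rho X V 0 = rho X' V 0.
  have := E3 0; rewrite normr0 => /(_ e30); rewrite /G_rho !limn_pseries0.
  by move=> ->.
have dE (t : R) : `|t| < e ->
    derive1 (fun s : R => (1 - s) * G_rho X' V s) t =
    derive1 (fun s : R => (1 - s) * G_rho X V s) t.
  move=> te; rewrite !derive1E; apply: near_eq_derive.
  exists (e - `|t|); first by rewrite /= subr_gt0.
  move=> s /= ts; congr (_ * _); apply: E3; apply: lt_le_trans ee3.
  by rewrite -(subrKC t s) (le_lt_trans (ler_normD _ _))// -ltrBrDl distrC.
have DE : rho X V 1 - rho X V 0 = rho X' V 1 - rho X' V 0.
  have z0 : `|0 : R| < e by rewrite normr0.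
  have [_ _ _ _] := S1 0 z0; have [_ _ _ _] := S2 0 z0.
  rewrite !mgf0 dE// => -[E2] [E1].
  apply: invr_inj; apply: (@mulIf _ (derive1 (fun s : R => (1 - s) * G_rho X V s) 0)).
    by apply/eqP => d0; move: E1; rewrite d0 mulr0 => /eqP; rewrite oner_eq0.
  by rewrite -E1 -E2.
have TT' : same_law PT PT' T T'.
  apply: (@same_law_of_mgf _ _ _ _ T _ _ _ T' e e0).
  - exact: (phi_gt0 hV finX D0 hT).
  - exact: (phi_gt0 hV finX' D0' hT').
  - by move=> t te; have [] := S1 t te.
  - move=> t te; have [_ _ _ _ ->] := S1 t te; have [_ _ _ _ ->] := S2 t te.
    by rewrite dE// DE.
apply: same_law_Hq; apply: (Hq_unique hV finX finX' rho0E) => a b a0 ab.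
have := same_law_integral (k := fun t => (slice a b t)%:E) TT'.
move=> /(_ _ _); rewrite (is_phi_slices hV finX D0 hT a0 ab).
rewrite (is_phi_slices hV finX' D0' hT' a0 ab) -DE => E.
have ms : measurable_fun setT (fun t => (slice a b t)%:E).
  by apply/measurable_EFinP; exact: measurable_slice_fun.
have s0 (t : R) : (0 <= (slice a b t)%:E)%E by rewrite lee_fin slice_ge0.
by have E' := EFin_inj (E ms s0); move: E' => /mulIf; apply; rewrite invr_eq0 gt_eqF ?D0.
Qed.

End determination.

Theorem theorem2p4 (R : realType)
  (dX : measure_display) (OmX : measurableType dX) (P : probability OmX R)
  (X : {RV P >-> R})
  (dV : measure_display) (OmV : measurableType dV) (Q : probability OmV R)
  (V : nat -> {RV Q >-> R})
  (dT : measure_display) (OmT : measurableType dT) (PT : probability OmT R)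
  (T : {RV PT >-> R})
  (hX : in_Hstar X) (hV : iid_uniform V) (hT : is_phi X T) :
  [<-> (exists2 p : R, 1 < p & ('E_P[fun x => (Num.max (X x) 0 `^ p)%R] < +oo)%E);
       (\forall t \near (0 : R), cvgn (pseries (rho X V) t));
       (exists2 t : R, 0 < t & (G_w X V t < +oo)%E);
       (exists2 a : R, 0 < a & ('M_PT T a < +oo)%E)] /\
  ((exists2 p : R, 1 < p & ('E_P[fun x => (Num.max (X x) 0 `^ p)%R] < +oo)%E) ->
   exists2 eps0 : R, 0 < eps0 < 1 &
   [/\ (forall t : R, `|t| < eps0 ->
          [/\ cvgn (pseries (rho X V) t), ('M_PT T t < +oo)%E &
              G_rho X V t =
                (1 - t)^-1 *
                (rho X V 0 +
                 (rho X V 1 - rho X V 0) *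
                 oint 0 t (fun s => fine ('M_PT T s)))]),
       (forall t : R, `|t| < eps0 ->
          derivable (fun s : R => (1 - s) * G_rho X V s) t 1 /\
          'M_PT T t =
            ((rho X V 1 - rho X V 0)^-1 *
             derive1 (fun s : R => (1 - s) * G_rho X V s) t)%:E),
       (* recovery of X from G_rho *)
       (forall (d' : measure_display) (Om' : measurableType d')
               (P' : probability Om' R) (T' : {RV P' >-> R}),
          in_T T' ->
          (forall t : R, `|t| < eps0 ->
             'M_P' T' t =
               ((rho X V 1 - rho X V 0)^-1 *
                derive1 (fun s : R => (1 - s) * G_rho X V s) t)%:E) ->
          (forall (dY : measure_display) (OmY : measurableType dY)
                  (PY : probability OmY R) (Y : {RV PY >-> R}),
             (in_H0 Y /\ is_phi Y T') <-> is_phi' T' Y) /\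
          exists Y : {RV P >-> R},
            is_phi' T' Y /\
            same_law P P X
              (fun x => rho X V 0 + (rho X V 1 - rho X V 0) * Y x)) &
       (* G_rho determines the law of X *)
       (forall (d' : measure_display) (Om' : measurableType d')
               (P' : probability Om' R) (X' : {RV P' >-> R}),
          in_Hstar X' ->
          (exists2 p : R, 1 < p &
             ('E_P'[fun x => (Num.max (X' x) 0 `^ p)%R] < +oo)%E) ->
          (\forall t \near (0 : R), G_rho X' V t = G_rho X V t) ->
          same_law P P' X X')]).
Proof.
split; first exact: record_tfae.
move=> Ep; have finX := Hstar_rho_abs hV hX.
have D0 := Hstar_rho_diff_gt0 hV hX.
have [e [e01 He]] := exists_radius hV hX hT Ep.
have [Ge Me] : (G_w X V e < +oo)%E /\ ('M_PT T e < +oo)%E.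
  by apply: He; case/andP: e01 => ->; rewrite lexx.
have S := G_rho_mgf hV finX D0 hT e01 Ge Me.
exists e => //; split.
- by move=> t /S[].
- by move=> t /S[].
- move=> d' Om' P' T' hT' mgfT'; split.
    move=> dY OmY PY Y; split; first by case=> hY; exact: (in_H0_is_phi' hV hY).
    exact: (is_phi'_in_H0 hV hT').
  apply: (recover_affine hV hX hT).
  apply: (@same_law_of_mgf _ _ _ _ T _ _ _ T' e).
  + by case/andP: e01.
  + exact: (phi_gt0 hV finX D0 hT).
  + by case: hT'.
  + by move=> t /S[].
  + by move=> t te; rewrite mgfT'//; have [] := S t te.
- by move=> d' Om' P' X' hX' Ep' near_eq; exact: (G_rho_determines_law hV hX).
Qed.
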